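(* Assume that $A$ is an augmented algebra, and that $X$ is a convergent left-monomial presentation of $A$. Then the algebra $A$ admits a polygraphic resolution $\mathrm{Std}(\mathrm{Red}_m(X))$, whose $n$-cells are the $(n+1)$-tuples $u_0|\cdots|u_n$ of nontrivial reduced monomials of $X$, with source and target $$s(u_0|\cdots|u_n)=\sum_{\substack{0\leq i\leq n+1\\ n+1-i\text{ even}}}d_i(u_0|\cdots|u_n)+s'(u_0|\cdots|u_n)$$ and $$t(u_0|\cdots|u_n)=\sum_{\substack{0\leq i\leq n+1\\ n+1-i\text{ odd}}}d_i(u_0|\cdots|u_n)+t'(u_0|\cdots|u_n),$$ where $s'(u_0|\cdots|u_n)$ and $t'(u_0|\cdots|u_n)$ are identities, and where the maps $d_i$ are defined by $$d_i(u_0|\cdots|u_n)=\begin{cases}u_0\otimes u_1|\cdots|u_n&\text{if }i=0,\\ u_0|\cdots|\widehat{u_{i-1}u_i}|\cdots|u_n&\text{if }1\le i\le n,\\ u_0|\cdots|u_{n-1}\otimes u_n&\text{if }i=n+1.\end{cases}$$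
   Context: Fix a field $\mathbb{K}$; algebras are unital associative over $\mathbb{K}$. An augmented algebra $A=\mathbb{K}\oplus A_+$ is an algebra with an augmentation $A\to\mathbb{K}$ with kernel $A_+$. Convergent presentations. A $1$-polygraph $X=\langle X_0|X_1\rangle$ is a set $X_0$ and a set $X_1$ with maps $s,t:X_1\to\mathcal{A}(X_0)$ into the free algebra on $X_0$; it presents the algebra $\overline{X}=\mathcal{A}(X_0)/(s(\alpha)-t(\alpha),\alpha\in X_1)$, and is a presentation of $A$ if $A\simeq\overline{X}$. Monomials are elements of the free monoid $X_0^*$; a monomial is nontrivial if it is not $1$; $\mathrm{supp}(a)$ is the set of monomials with nonzero coefficient in $a$. $X$ is left-monomial if each $s(\alpha)$ is a monomial not in $\mathrm{supp}(t(\alpha))$. For left-monomial $X$, a one-step rewriting replaces $\lambda us(\alpha)v+a$ by $\lambda ut(\alpha)v+a$, for $\alpha\in X_1$, $u,v$ monomials, $\lambda\neq0$ and $a\in\mathcal{A}(X_0)$ with $us(\alpha)v\notin\mathrm{supp}(a)$. An element is reduced if no rewriting step applies to it. $X$ terminates if the smallest transitive relation $\succ_X$ on $X_0^*$, stable by product and with $s(\alpha)\succ_X v$ for $v\in\mathrm{supp}(t(\alpha))$, is wellfounded; $X$ is confluent if any two elements obtained from a common one by finite sequences of rewriting steps can be rewritten, by finite sequences of rewriting steps, into a common element; convergent means terminating and confluent. Then each $a\in\mathcal{A}(X_0)$ rewrites to a unique reduced element $\widehat{a}$, its normal form. $\mathrm{Red}_m(X)$ denotes the set of reduced monomials. Polygraphs.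 An $\infty$-algebra is a strict globular $\infty$-category internal to algebras: algebras $A_n$ ($n\ge0$, elements are $n$-cells), algebra morphisms $s,t:A_{n+1}\to A_n$, $i:A_n\to A_{n+1}$ ($i(a)=1_a$, often written $a$) with $ss=st$, $ts=tt$, $si=ti=\mathrm{id}$, and compositions $\star_k$ that are algebra morphisms and satisfy the usual axioms (necessarily $a\star_kb=a-t_k(a)+b$, with $s_k,t_k$ the iterated source and target in dimension $k$). An $n$-algebra is the same with cells of dimension at most $n$. Two $n$-cells are parallel if $n=0$ or they have the same source and the same target. A cellular extension of an $n$-algebra $A$ is a set $Z$ with maps $s,t:Z\to A_n$ such that $s(z),t(z)$ are parallel. The free $(n+1)$-algebra $A[Z]$ extends $A$ with $(n+1)$-cells, the elements of the quotient of the $A_0$-bimodule $(A_0\otimes\mathbb{K}Z\otimes A_0)\oplus A_n$ by the sub-bimodule generated by $(as_0(b)+t_0(a)b-t_0(a)s_0(b))-(s_0(a)b+at_0(b)-s_0(a)t_0(b))$, $a,b\in A_0\otimes\mathbb{K}Z\otimes A_0$; here $s(azb)=a\,s(z)\,b$, $t(azb)=a\,t(z)\,b$, $c\in A_n$ is the identity $1_c$, and the product is $ab=as_0(b)+t_0(a)b-t_0(a)s_0(b)$. $Z$ is acyclic if for all parallel $n$-cells $a,b$ of $A$ there is an $(n+1)$-cell $a\to b$ in $A[Z]$. An $\infty$-polygraph is a set $X_0$ and, for each $n\ge0$, a cellular extension $X_{n+1}$ of the free $n$-algebra $\mathcal{A}(X_0)[X_1]\cdots[X_n]$; $\mathcal{A}(X)$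 is the resulting free $\infty$-algebra. It is a polygraphic resolution of $A$ if its underlying $1$-polygraph presents $A$ and, for every $n\ge1$, $X_{n+1}$ is acyclic. Standard resolution. For a linear basis $\mathcal{B}$ of $A_+$, $\mathrm{Std}(\mathcal{B})$ is the $\infty$-polygraph with $n$-cells the elements $u_0|\cdots|u_n$ of $\mathcal{B}^{n+1}$ and $$s=\sum(-1)^{k+1}d_{i_1}^{-(n-i_1)}\cdots d_{i_k}^{-(n-i_k)},\qquad t=\sum(-1)^{k+1}d_{i_1}^{(n-i_1)}\cdots d_{i_k}^{(n-i_k)},$$ sums over $1\le k\le n$ and $1\le i_1<\cdots<i_k\le n$; here $d_i^-$ (resp. $d_i^+$) replaces the $i$-th vertical bar from the left with $\otimes$ (resp. with the product of $A_+$), $d_i^{(j)}$ is $d_i^-$ for $j$ odd and $d_i^+$ for $j$ even, $d_i^{-(j)}$ is the opposite choice. Results are expanded multilinearly in $\mathcal{B}$, blocks $u_0|\cdots|u_i$ are $i$-cells, $\otimes$ between blocks is the product of the free $\infty$-algebra, and lower-dimensional cells are seen as iterated identities. $\mathrm{Std}(\mathrm{Red}_m(X))$ denotes this construction for $\mathcal{B}=\mathrm{Red}_m(X)\setminus\{1\}$, taken as the linear basis of $A_+$, the product in $A$ of reduced monomials $u,v$ being $\widehat{uv}$.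
   Formalization: In A[Z] the exchange relations range over all a, b in (A_0⊗KZ⊗A_0)⊕A_n (needed for A[Z] to be an (n+1)-algebra when n≥1), and nontrivial reduced monomials are assumed to lie in A_+ (needed for Std(Red_m(X)) to be defined); that they form a basis of A_+ is proved. *)

(* Defs.v *)
From HB Require Import structures.
From Stdlib Require Import Relation_Operators.
From mathcomp Require Import all_boot all_algebra finmap.
From mathcomp Require Import boolp classical_sets.
From mathcomp.multinomials Require Import monalg.

Set Implicit Arguments.
Unset Strict Implicit.
Unset Printing Implicit Defensive.

Import GRing.Theory.
Local Open Scope ring_scope.

Notation free_algebra K I := {malg K[{fmonom I}]}.

Definition linear_ext (K : fieldType) (T : choiceType) (V : lmodType K)
    (f : T -> V) (x : {malg K[T]}) : V :=
  \sum_(k <- msupp x) x@_k *: f k.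

Definition eval_free (K : fieldType) (I : choiceType) (R : algType K)
    (g : I -> R) : free_algebra K I -> R :=
  linear_ext (fun m : {fmonom I} => \prod_(i <- (m : seq I)) g i).

Inductive ideal_gen (R : nzRingType) (G : R -> Prop) : R -> Prop :=
| ideal_incl x : G x -> ideal_gen G x
| ideal_zero : ideal_gen G 0
| ideal_add x y : ideal_gen G x -> ideal_gen G y -> ideal_gen G (x + y)
| ideal_mull a x : ideal_gen G x -> ideal_gen G (a * x)
| ideal_mulr a x : ideal_gen G x -> ideal_gen G (x * a).

(* f identifies V with U / N: "V is the quotient of U by N" is meant up to the
   canonical isomorphism.  Only used for additive f. *)
Definition is_quotient (U V : zmodType) (f : U -> V) (N : U -> Prop) :=
  (forall v, exists u, f u = v) /\ (forall u, f u = 0 <-> N u).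

Definition linear_basis_of (K : fieldType) (B : choiceType) (V : lmodType K)
    (b : B -> V) (S : V -> Prop) :=
  injective (linear_ext b) /\ (forall v, S v <-> exists x, linear_ext b x = v).

Record polygraph1 (K : fieldType) := Polygraph1 {
  gen0 : choiceType;
  rule : Type;
  rsrc : rule -> free_algebra K gen0;
  rtgt : rule -> free_algebra K gen0 }.

Section Rewriting.
Variables (K : fieldType) (X : polygraph1 K).

Definition relations (x : free_algebra K (gen0 X)) :=
  exists r : rule X, x = rsrc r - rtgt r.

Definition presentation (A : algType K)
    (phi : {lrmorphism free_algebra K (gen0 X) -> A}) :=
  is_quotient phi (ideal_gen relations).

Definition left_monomial :=
  forall r : rule X, exists2 m, rsrc r = << m >> & m \notin msupp (rtgt r).

Inductive step : free_algebra K (gen0 X) -> free_algebra K (gen0 X) -> Prop :=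
  Step (r : rule X) (u m v : {fmonom (gen0 X)}) (c : K)
       (a : free_algebra K (gen0 X)) :
    rsrc r = << m >> -> c != 0 -> mmul (mmul u m) v \notin msupp a ->
    step (c *: (<< u >> * rsrc r * << v >>) + a)
         (c *: (<< u >> * rtgt r * << v >>) + a).

Definition rewrites := clos_refl_trans _ step.

Definition reduced (a : free_algebra K (gen0 X)) := forall b, ~ step a b.

Inductive succ_mon : {fmonom (gen0 X)} -> {fmonom (gen0 X)} -> Prop :=
| succ_rule (r : rule X) m v :
    rsrc r = << m >> -> v \in msupp (rtgt r) -> succ_mon m v
| succ_trans u v w : succ_mon u v -> succ_mon v w -> succ_mon u w
| succ_mul u v p q :
    succ_mon u v -> succ_mon (mmul (mmul p u) q) (mmul (mmul p v) q).

Definition terminating := well_founded (fun v u => succ_mon u v).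

Definition confluent := forall a b c, rewrites a b -> rewrites a c ->
  exists2 d, rewrites b d & rewrites c d.

Definition convergent := terminating /\ confluent.

(* Meaningful when X is convergent; the default value is irrelevant. *)
Definition normal_form (a : free_algebra K (gen0 X)) : free_algebra K (gen0 X) :=
  xget a (fun b => rewrites a b /\ reduced b).

(* The nontrivial reduced monomials, i.e. Red_m(X) \ {1}. *)
Definition red_mon : choiceType :=
  {m : {fmonom (gen0 X)} | `[< reduced << m >> >] && (m != mone)}.

(* The normal form of uv, expanded on nontrivial reduced monomials.  When
   these span an ideal complementary to K, no term of the normal form lies
   outside of red_mon, so that nothing is lost in the None case. *)
Definition red_mul (u v : red_mon) : {malg K[red_mon]} :=
  linear_ext (fun m => if insub m is Some w then << w >> else 0)
             (normal_form << mmul (val u) (val v) >>).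

End Rewriting.

Record globular_algebra (K : fieldType) := GlobularAlgebra {
  cell :> nat -> algType K;
  src : forall n, {lrmorphism cell n.+1 -> cell n};
  tgt : forall n, {lrmorphism cell n.+1 -> cell n};
  idc : forall n, {lrmorphism cell n -> cell n.+1};
  src_glob : forall n (a : cell n.+2), src n (src n.+1 a) = src n (tgt n.+1 a);
  tgt_glob : forall n (a : cell n.+2), tgt n (src n.+1 a) = tgt n (tgt n.+1 a);
  src_idc : forall n (a : cell n), src n (idc n a) = a;
  tgt_idc : forall n (a : cell n), tgt n (idc n a) = a }.

Arguments src {K g n}.
Arguments tgt {K g n}.
Arguments idc {K g n}.

Section Globular.
Variables (K : fieldType) (A : globular_algebra K).

(* s_{n-j}(a) and t_{n-j}(a), seen again as n-cells (iterated identities). *)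
Fixpoint src_codim (j n : nat) : A n -> A n :=
  match j, n return A n -> A n with
  | j'.+1, n'.+1 => fun a => idc (src_codim j' (src a))
  | _, _ => id
  end.
Fixpoint tgt_codim (j n : nat) : A n -> A n :=
  match j, n return A n -> A n with
  | j'.+1, n'.+1 => fun a => idc (tgt_codim j' (tgt a))
  | _, _ => id
  end.

Fixpoint src0 (n : nat) : A n -> A 0%N :=
  if n is n'.+1 then fun a => src0 (src a) else id.
Fixpoint tgt0 (n : nat) : A n -> A 0%N :=
  if n is n'.+1 then fun a => tgt0 (tgt a) else id.

Fixpoint iter_id (n : nat) : A 0%N -> A n :=
  match n return A 0%N -> A n with
  | n'.+1 => fun a => idc (iter_id n' a)
  | 0%N => id
  end.

Definition parallel (n : nat) : A n -> A n -> Prop :=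
  match n return A n -> A n -> Prop with
  | n'.+1 => fun a b => src a = src b /\ tgt a = tgt b
  | 0%N => fun _ _ => True
  end.

(* In dimension 0 the condition is void: a 0-cell is its own 0-fold identity. *)
Definition is_identity (n : nat) : A n -> Prop :=
  match n return A n -> Prop with
  | n'.+1 => fun a => exists b : A n', a = idc b
  | 0%N => fun _ => True
  end.

(* t_{n-j}(a) = s_{n-j}(b). *)
Definition composable (j n : nat) (a b : A n) :=
  [/\ (0 < j)%N, (j <= n)%N & tgt_codim j a = src_codim j b].

End Globular.

(* [comp j a b] is the composite of the n-cells a and b along their common
   (n-j)-cell; its values on non-composable pairs are irrelevant. *)
Record inf_algebra (K : fieldType) := InfAlgebra {
  globular :> globular_algebra K;
  comp : forall (j n : nat), globular n -> globular n -> globular n;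
  comp_src1 : forall n (a b : globular n.+1), composable 1 a b ->
    src (comp 1 a b) = src a;
  comp_tgt1 : forall n (a b : globular n.+1), composable 1 a b ->
    tgt (comp 1 a b) = tgt b;
  comp_srcS : forall j n (a b : globular n.+1), composable j.+2 a b ->
    src (comp j.+2 a b) = comp j.+1 (src a) (src b);
  comp_tgtS : forall j n (a b : globular n.+1), composable j.+2 a b ->
    tgt (comp j.+2 a b) = comp j.+1 (tgt a) (tgt b);
  comp_idc : forall j n (a b : globular n), composable j a b ->
    idc (comp j a b) = comp j.+1 (idc a) (idc b);
  comp_unitl : forall j n (a : globular n), (0 < j <= n)%N ->
    comp j (src_codim j a) a = a;
  comp_unitr : forall j n (a : globular n), (0 < j <= n)%N ->
    comp j a (tgt_codim j a) = a;
  comp_assoc : forall j n (a b c : globular n),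
    composable j a b -> composable j b c ->
    comp j (comp j a b) c = comp j a (comp j b c);
  comp_exchange : forall j l n (a b c d : globular n), (j < l)%N ->
    composable j a b -> composable j c d -> composable l a c ->
    comp l (comp j a b) (comp j c d) = comp j (comp l a c) (comp l b d);
  comp_add : forall j n (a b c d : globular n),
    composable j a b -> composable j c d ->
    comp j (a + c) (b + d) = comp j a b + comp j c d;
  comp_scale : forall j n (k : K) (a b : globular n), composable j a b ->
    comp j (k *: a) (k *: b) = k *: comp j a b;
  comp_one : forall j n, (0 < j <= n)%N ->
    comp j (1 : globular n) (1 : globular n) = 1;
  comp_mul : forall j n (a b c d : globular n),
    composable j a b -> composable j c d ->
    comp j (a * c) (b * d) = comp j a b * comp j c d }.

Section FreeExtension.
Variables (K : fieldType) (A : globular_algebra K) (X : nat -> choiceType).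
Variables (g : forall n, X n -> A n) (coord0 : A 0%N -> free_algebra K (X 0%N)).
Variable n : nat.

Local Notation A0 := (free_algebra K (X 0%N)).
Local Notation ev0 := (eval_free (g (n:=0%N))).

(* (A_0 (x) K X_{n+1} (x) A_0) (+) A_n; since A_0 is free on X_0, its first
   summand has for basis the triples (u, z, v) with u, v monomials. *)
Definition ext_bimod : lmodType K :=
  ({malg K[({fmonom (X 0%N)} * X n.+1 * {fmonom (X 0%N)})%type]} * A n)%type.

Definition ext_lact (p : A0) (e : ext_bimod) : ext_bimod :=
  (linear_ext (fun m =>
     linear_ext (fun w => << (mmul m w.1.1, w.1.2, w.2) >>) e.1) p,
   iter_id n (ev0 p) * e.2).

Definition ext_ract (e : ext_bimod) (p : A0) : ext_bimod :=
  (linear_ext (fun m =>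
     linear_ext (fun w => << (w.1.1, w.1.2, mmul w.2 m) >>) e.1) p,
   e.2 * iter_id n (ev0 p)).

Definition ext_cst (p : A0) : ext_bimod := (0, iter_id n (ev0 p)).

Definition ext_eval (e : ext_bimod) : A n.+1 :=
  linear_ext (fun w => iter_id n.+1 (ev0 << w.1.1 >>) * g w.1.2
                       * iter_id n.+1 (ev0 << w.2 >>)) e.1
  + idc e.2.

Definition ext_src0 (e : ext_bimod) : A0 := coord0 (src0 (ext_eval e)).
Definition ext_tgt0 (e : ext_bimod) : A0 := coord0 (tgt0 (ext_eval e)).

Definition ext_relator (a b : ext_bimod) : ext_bimod :=
  (ext_ract a (ext_src0 b) + ext_lact (ext_tgt0 a) b
     - ext_cst (ext_tgt0 a * ext_src0 b))
  - (ext_lact (ext_src0 a) b + ext_ract a (ext_tgt0 b)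
     - ext_cst (ext_src0 a * ext_tgt0 b)).

(* Sub-bimodule generated by the relators, where a and b range over the whole
   bimodule, summand A_n included: when n > 0, the relators between an
   (n+1)-generator and an n-cell are needed for the composition along 0-cells
   to be multiplicative, and they do not follow from the other ones. *)
Inductive ext_exchange : ext_bimod -> Prop :=
| exchange_relator a b : ext_exchange (ext_relator a b)
| exchange_zero : ext_exchange 0
| exchange_add x y : ext_exchange x -> ext_exchange y -> ext_exchange (x + y)
| exchange_lact p x : ext_exchange x -> ext_exchange (ext_lact p x)
| exchange_ract p x : ext_exchange x -> ext_exchange (ext_ract x p).

End FreeExtension.

(* An infinity-polygraph with n-cells X n, together with the free
   infinity-algebra on it: [algebra] is, dimension after dimension, identified
   by [gen] with the free (n+1)-algebra on the cellular extension X n.+1 of its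
   underlying n-algebra.  The source and target of z : X n.+1 are
   [src (gen z)] and [tgt (gen z)]; they are parallel by globularity. *)
Record polygraph (K : fieldType) (X : nat -> choiceType) := Polygraph {
  algebra :> inf_algebra K;
  gen : forall n, X n -> algebra n;
  coord0 : algebra 0%N -> free_algebra K (X 0%N);
  eval0K : cancel (eval_free (gen (n:=0%N))) coord0;
  coord0K : cancel coord0 (eval_free (gen (n:=0%N)));
  free_ext : forall n,
    is_quotient (ext_eval gen (n:=n)) (ext_exchange gen coord0 (n:=n)) }.

Arguments gen {K X} p {n}.
Arguments coord0 {K X} p.

Section Resolution.
Variables (K : fieldType) (X : nat -> choiceType) (P : polygraph K X).

Definition underlying_polygraph1 : polygraph1 K :=
  Polygraph1 (fun z : X 1%N => coord0 P (src (gen P z)))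
             (fun z : X 1%N => coord0 P (tgt (gen P z))).

Definition acyclic (n : nat) :=
  forall a b : P n, parallel a b ->
    exists f : P n.+1, src f = a /\ tgt f = b.

Definition polygraphic_resolution (A : algType K) :=
  (exists phi : {lrmorphism free_algebra K (gen0 underlying_polygraph1) -> A},
     presentation phi)
  /\ (forall n, (0 < n)%N -> acyclic n).

End Resolution.

Section Standard.
Variables (K : fieldType) (B : choiceType) (mulB : B -> B -> {malg K[B]}).

Definition std_cells (n : nat) : choiceType := n.+1.-tuple B.

(* Blocks separated by tensors, a block u_0|...|u_i being the sequence of its
   elements. *)
Definition word := seq (seq B).

(* d_i^- (tens = true) and d_i^+ (tens = false), acting on the i-th vertical
   bar from the left, 1 <= i. *)
Fixpoint dbar (tens : bool) (i : nat) (w : word) : {malg K[word]} :=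
  if w is b :: r then
    if (i < size b)%N then
      if tens then << [:: take i b, drop i b & r] >>
      else if drop i.-1 b is x :: y :: c then
        linear_ext (fun v => << (take i.-1 b ++ v :: c) :: r >>) (mulB x y)
      else 0
    else linear_ext (fun r' => << b :: r' >>) (dbar tens (i - (size b).-1) r)
  else 0.

Variable P : polygraph K std_cells.

(* The (i-1)-cell given by a block of length i, seen as an n-cell, i <= n+1. *)
Fixpoint block_cell (n : nat) (b : seq B) : P n :=
  if insub b is Some z then gen P (z : std_cells n)
  else match n return P n with
       | n'.+1 => idc (block_cell n' b)
       | 0%N => 0
       end.

Definition word_cell (n : nat) (w : word) : P n :=
  \prod_(b <- w) block_cell n b.

(* The formulas for s (tg = false) and t (tg = true) of an (n+1)-cell.  The
   ordinal i stands for the bar i.+1; d_{i.+1} is d^- iff n+1-(i+1) is odd in t,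
   even in s.  The indices are enumerated increasingly, and the rightmost
   operator acts first. *)
Definition std_boundary (tg : bool) (n : nat) (z : std_cells n.+1) : P n :=
  \sum_(I : {set 'I_n.+1} | I != finset.set0)
    (-1) ^+ #|I|.+1 *:
    linear_ext (word_cell n)
      (foldr (fun i : 'I_n.+1 =>
                linear_ext (dbar (odd (n.+1 - i.+1) == tg) i.+1))
             << [:: (z : seq B)] >> (enum I)).

Definition is_std :=
  forall n (z : std_cells n.+1),
    src (gen P z) = std_boundary false z /\ tgt (gen P z) = std_boundary true z.

(* d_i(z) for an (n+1)-cell z, 0 <= i <= n+2. *)
Definition face (n : nat) (z : std_cells n.+1) (i : nat) : P n :=
  if i == 0%N then block_cell n (take 1 z) * block_cell n (drop 1 z)
  else if i == n.+2 then
    block_cell n (take n.+1 z) * block_cell n (drop n.+1 z)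
  else if drop i.-1 z is x :: y :: c then
    linear_ext (fun w => block_cell n (take i.-1 z ++ w :: c)) (mulB x y)
  else 0.

End Standard.

Arguments face {K B} mulB P {n} z i.

(* Main.v *)
Require Import Defs.
From HB Require Import structures.
From Stdlib Require Import Relation_Operators.
From mathcomp Require Import all_boot all_algebra finmap.
From mathcomp Require Import boolp.
From mathcomp.multinomials Require Import monalg.

Set Implicit Arguments.
Unset Strict Implicit.
Unset Printing Implicit Defensive.

Import GRing.Theory.
Local Open Scope ring_scope.

(** Rewriting only enters through two facts.  As X terminates and is confluent,
    each class modulo its relations contains exactly one combination of reduced
    monomials; since the augmentation vanishes on the nontrivial ones, these form
    a basis of the augmentation ideal ([red_mon_basis]), in which the product of
    A is [red_mul] ([red_mulE]).  What remains is a statement on an algebra A with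
    a basis made of 1 and of letters whose products are combinations of letters
    ([based_algebra]).

    The free infinity-algebra of the standard polygraph is not built dimension
    after dimension: it is guessed, and then shown to be free.  Let T be the free
    algebra on the letters, and let Bar be the bar complex of A with coefficients
    on both sides, spanned by the a[u_1|...|u_n]c.  An n-cell is a triple
    (s, t, y), where s and t are elements of T with the same image in A, its
    0-source and its 0-target, and where y is a chain of degree at most n + 1,
    whose part of degree 1 is the universal derivation of s and whose part of
    degree 2 bounds the difference of the derivations of t and s ([is_cell]).
    Triples are multiplied as in a square-zero extension.  The source of a cell
    truncates y, and its target moreover adds the boundary of the part of top
    degree.  Compositions are forced to be a - t(a) + b; they are compatible with
    products because a cell of zero target and a cell of zero source annihilate
    each other ([mul_cells0], [inf_of_globular]).

    The generator u_0|...|u_n is the triple made of the word u_0...u_n, of the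
    product of the u_i in A seen as a combination of letters, and of a chain
    defined by recursion on the first letter ([block_chain]), whose part of top
    degree is [u_0|...|u_n].  The formulas for the source and the target expand
    z - (1 - d_1)...(1 - d_n) z, where z is the generator ([alternating_cube]), and
    the product (1 - d_1)...(1 - d_n) z can be computed by recursion on the first
    letter too: its chain is [z] for the source and [z] minus the boundary of [z]
    for the target ([word_chain_cube_src], [word_chain_cube_tgt]).  So these
    formulas hold in the model ([src_gen_cell], [tgt_gen_cell]).

    Freeness ([cells_free_ext]) compares the bimodule T (x) KZ (x) T on the
    generators of top dimension with the degree n + 2 part of Bar, which is
    A (x) KZ (x) A: every cell is a combination of generators up to an identity
    ([eval_cells_surj]), and the relators identify coefficients in T with the same
    image in A, up to the exchanges between two 1-cells when n = 0
    ([kernel_eval_bar], [kernel_eval_bar_gap]).  Acyclicity follows from the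
    contraction of the bar complex ([bdry_homotopy], [fill_cell]).  Lastly, the
    terms of the source and of the target in which two bars or more are replaced
    only involve blocks of smaller dimension, hence are identities, and the terms
    with one bar are the faces d_i and identities ([boundary_faces]). *)

(** * Linear maps out of a free module *)

Section LinearExtension.
Variables (K : fieldType) (T : choiceType).
Local Notation W := {malg K[T]}.

Lemma malgUZ (c : K) (k : T) : << c *g k >> = c *: << k >> :> W.
Proof. by apply/malgP => k'; rewrite mcoeffZ !mcoeffU mulr_natr. Qed.

Lemma malg_ind (P : W -> Prop) :
  P 0 -> (forall c k x, P x -> P (c *: << k >> + x)) -> forall x, P x.
Proof.
move=> P0 PS x; rewrite [x]monalgE; elim: (enum_fset _) => [|k s IH].
  by rewrite big_nil.
by rewrite big_cons malgUZ; apply: PS.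
Qed.

Variable V : lmodType K.
Implicit Type f : T -> V.

Lemma linear_extEw f (x : W) (d : {fset T}) : (msupp x `<=` d)%fset ->
  linear_ext f x = \sum_(k <- d) x@_k *: f k.
Proof.
move=> le; rewrite /linear_ext (big_fset_incl _ le) //= => k _ /mcoeff_outdom ->.
by rewrite scale0r.
Qed.

Lemma linear_ext_is_linear f : linear (linear_ext f).
Proof.
move=> c x y; pose d := (msupp x `|` msupp y)%fset.
rewrite (@linear_extEw f x d) ?fsubsetUl // (@linear_extEw f y d) ?fsubsetUr //.
rewrite (@linear_extEw f _ d); last first.
  apply: fsubset_trans (msuppD_le _ _) _; apply: fsetSU; exact: msuppZ_le.
rewrite scaler_sumr -big_split; apply: eq_bigr => k _ /=.
by rewrite mcoeffD mcoeffZ scalerDl scalerA.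
Qed.

HB.instance Definition _ f :=
  GRing.isLinear.Build K W V *:%R (linear_ext f) (linear_ext_is_linear f).

Lemma linear_extU f k : linear_ext f << k >> = f k.
Proof.
rewrite (@linear_extEw f _ [fset k]%fset) ?msuppU_le // big_seq_fset1.
by rewrite mcoeffUU scale1r.
Qed.

Lemma eq_linear_ext f g : f =1 g -> linear_ext f =1 linear_ext g.
Proof. by move=> fg x; apply: eq_bigr => k _; rewrite fg. Qed.

Lemma linear_ext_uniq f (h : {linear W -> V}) :
  (forall k, h << k >> = f k) -> h =1 linear_ext f.
Proof.
move=> hf; elim/malg_ind => [|c k x IH]; first by rewrite !linear0.
by rewrite !linearD !linearZ /= linear_extU hf IH.
Qed.

Lemma linear_extP f c x y :
  linear_ext f (c *: x + y) = c *: linear_ext f x + linear_ext f y.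
Proof. exact: linearP. Qed.

Lemma linear_ext0 f : linear_ext f 0 = 0.
Proof. exact: linear0. Qed.

Lemma linear_extB f x y : linear_ext f (x - y) = linear_ext f x - linear_ext f y.
Proof. exact: linearB. Qed.

Lemma linear_extS f c k x :
  linear_ext f (c *: << k >> + x) = c *: f k + linear_ext f x.
Proof. by rewrite linearP /= linear_extU. Qed.

Lemma linear_ext_delta k0 (v : V) (x : W) :
  linear_ext (fun k => if k == k0 then v else 0) x = x@_k0 *: v.
Proof.
elim/malg_ind: x => [|c k x IH]; first by rewrite linear0 mcoeff0 scale0r.
rewrite linearP /= linear_extU IH mcoeffD mcoeffZ mcoeffU scalerDl.
by case: eqP => _; rewrite ?mulr1n ?mulr0n ?mulr1 ?mulr0 ?scale0r ?scaler0.
Qed.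

End LinearExtension.

Lemma linear_ext_id (K : fieldType) (T : choiceType) (x : {malg K[T]}) :
  linear_ext (fun k => << k >>) x = x.
Proof. by symmetry; apply: (linear_ext_uniq (h := idfun)). Qed.

Lemma linear_ext_comp (K : fieldType) (T : choiceType) (V V' : lmodType K)
    (h : {linear V -> V'}) (f : T -> V) x :
  h (linear_ext f x) = linear_ext (fun k => h (f k)) x.
Proof. by rewrite /linear_ext linear_sum; apply: eq_bigr => k _; rewrite linearZ. Qed.

Lemma linear_ext2S (K : fieldType) (T T' : choiceType) (V : lmodType K)
    (g : T' -> V) (f : T -> {malg K[T']}) c k x :
  linear_ext g (linear_ext f (c *: << k >> + x))
    = c *: linear_ext g (f k) + linear_ext g (linear_ext f x).
Proof. by rewrite linear_extS; apply: linear_extP. Qed.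

Lemma linear_ext20 (K : fieldType) (T T' : choiceType) (V : lmodType K)
    (g : T' -> V) (f : T -> {malg K[T']}) :
  linear_ext g (linear_ext f 0) = 0.
Proof. by rewrite linear_ext0; apply: linear_ext0. Qed.

Lemma linear_ext2U (K : fieldType) (T T' : choiceType) (V : lmodType K)
    (g : T' -> V) (f : T -> T') x :
  linear_ext g (linear_ext (fun k => << f k >>) x : {malg K[T']})
    = linear_ext (fun k => g (f k)) x.
Proof.
elim/malg_ind: x => [|c k x IH]; first by rewrite linear_ext20 linear_ext0.
by rewrite linear_ext2S linear_extS linear_extU IH.
Qed.

Lemma linear_ext_exchange (K : fieldType) (T T' : choiceType) (V : lmodType K)
    (f : T -> T' -> V) x y :
  linear_ext (fun i => linear_ext (fun j => f i j) y) x
    = linear_ext (fun j => linear_ext (fun i => f i j) x) y.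
Proof.
rewrite /linear_ext; under eq_bigr => i _ do rewrite scaler_sumr.
rewrite exchange_big; apply: eq_bigr => j _; rewrite scaler_sumr.
by apply: eq_bigr => i _; rewrite !scalerA mulrC.
Qed.

Lemma linear_ext_combo (K : fieldType) (T T' : choiceType) (V : lmodType K)
    (f : T -> T' -> V) (c : K) y z x :
  linear_ext (fun i => linear_ext (f i) (c *: y + z)) x =
  c *: linear_ext (fun i => linear_ext (f i) y) x
    + linear_ext (fun i => linear_ext (f i) z) x.
Proof.
by rewrite !(linear_ext_exchange f x) linearP.
Qed.

(** * Monomials and ideals of a free algebra *)

Section FreeAlgebra.
Variables (K : fieldType) (I : choiceType).
Implicit Types (u v m k : {fmonom I}) (x y : free_algebra K I).

Lemma monM u v : << u >> * << v >> = << mmul u v >> :> free_algebra K I.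
Proof. by rewrite malgM_def fgmulUU mulr1. Qed.

Lemma mon_conj u k v :
  << u >> * << k >> * << v >> = << mmul (mmul u k) v >> :> free_algebra K I.
Proof. by rewrite monM; apply: monM. Qed.

Lemma mmul_inj2 u v : injective (fun m => mmul (mmul u m) v).
Proof.
move=> m1 m2 /(congr1 val) /=; rewrite !fmM -!catA => e.
have szm : size m1 = size m2.
  by move/(congr1 size): e; rewrite !size_cat => /addnI/addIn.
apply: val_inj => /=; move/eqP: e; rewrite eqseq_cat // eqxx /= eqseq_cat //.
by case/andP=> /eqP.
Qed.

Lemma mul_gmalgC (c : K) x : x * c%:MP = c *: x.
Proof.
rewrite malgM_def malgZ_def fgmulgU; apply: eq_bigr => k _.
by rewrite mulm1 mulrC.
Qed.

Lemma malg_scaleAr (c : K) x y : c *: (x * y) = x * (c *: y).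
Proof.
have e : c%:MP * (x * y) = x * (c%:MP * y).
  by rewrite !mulrA mul_malgC -mul_gmalgC.
by rewrite !mul_malgC in e.
Qed.

Lemma msupp_mon_mul u v k x : k \in msupp (<< u >> * x * << v >>) ->
  exists2 m, m \in msupp x & k = mmul (mmul u m) v.
Proof.
case/msuppM_le=> k1 [k2] [/msuppM_le [k3] [k4] [+ k4x ->]].
rewrite !msuppU1 !inE => /eqP-> /eqP-> ->; by exists k4.
Qed.

End FreeAlgebra.

Section Ideal.
Variables (K : fieldType) (I : choiceType) (G : free_algebra K I -> Prop).

Lemma ideal_scale c x : ideal_gen G x -> ideal_gen G (c *: x).
Proof. by rewrite -mul_malgC; apply: ideal_mull. Qed.

Lemma ideal_trans x y z : ideal_gen G (x - y) -> ideal_gen G (y - z) ->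
  ideal_gen G (x - z).
Proof. by move=> Gx Gy; rewrite -(subrK y x) -addrA; apply: ideal_add. Qed.

Lemma ideal_conj s t u v : G (s - t) -> ideal_gen G (u * s * v - u * t * v).
Proof.
by move=> Gst; rewrite -mulrBl -mulrBr; apply/ideal_mulr/ideal_mull/ideal_incl.
Qed.

End Ideal.

Section MonomialAlgebra.
Variables (K : fieldType) (M : monomType) (R : lalgType K) (e : M -> R).
Hypotheses (e1 : e mone = 1) (eM : forall u v, e u * e v = e (mmul u v)).
Hypothesis e_ind : forall P : R -> Prop,
  P 0 -> (forall c k x, P x -> P (c *: e k + x)) -> forall x, P x.
Hypothesis scaleAr : forall (c : K) (x y : R), c *: (x * y) = x * (c *: y).

(** Multiplying by monomials on both sides is enough to exhaust the ideal: the
    predicate on x is strengthened to u x v for all monomials u and v, which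
    absorbs the two products. *)
Lemma ideal_gen_closed (G Q : R -> Prop) :
  Q 0 -> (forall k x y, Q x -> Q y -> Q (k *: x + y)) ->
  (forall x, G x -> forall u v, Q (e u * x * e v)) ->
  forall x, ideal_gen G x -> Q x.
Proof.
move=> Q0 QS QG x Gx; rewrite -[x]mul1r -[_ * x]mulr1 -e1; move: {2}mone => v.
move: mone => u; elim: Gx u v => {x} [//||x y _ Qx _ Qy|b x _ Qx|b x _ Qx] u v.
- by rewrite mulr0 mul0r.
- by rewrite mulrDr mulrDl -[_ * x * _]scale1r; apply: QS.
- elim/e_ind: b => [|c k b IH]; first by rewrite mul0r mulr0 mul0r.
  rewrite mulrDl mulrDr mulrDl -scalerAl -scaleAr -scalerAl (mulrA _ (e k)) eM.
  exact: QS.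
- elim/e_ind: b => [|c k b IH]; first by rewrite mulr0 mulr0 mul0r.
  rewrite mulrDr mulrDr mulrDl -scaleAr -scaleAr -scalerAl -!mulrA eM.
  by move: (Qx u (mmul k v)) IH; rewrite -!mulrA; apply: QS.
Qed.

Lemma linear_multiplicative (R2 : algType K) (f : {linear R -> R2}) :
  (forall u v, f (e (mmul u v)) = f (e u) * f (e v)) ->
  forall x y, f (x * y) = f x * f y.
Proof.
move=> fM x y; elim/e_ind: x => [|c k x IH]; first by rewrite mul0r linear0 mul0r.
rewrite mulrDl -scalerAl !linearP /= IH mulrDl -scalerAl; congr (_ *: _ + _).
elim/e_ind: y {IH} => [|d l y IH]; first by rewrite mulr0 linear0 mulr0.
by rewrite mulrDr -scaleAr !linearP /= IH mulrDr -scalerAr eM fM.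
Qed.

Lemma mon_conj_scale c u k v : e u * (c *: e k) * e v = c *: e (mmul (mmul u k) v).
Proof. by rewrite -scaleAr -scalerAl !eM. Qed.

End MonomialAlgebra.

Section Coefficients.
Variables (K : fieldType) (I : choiceType).
Implicit Types (u v m k : {fmonom I}) (x y : free_algebra K I).

Lemma mcoeff_mon_mul u v m x : (<< u >> * x * << v >>)@_(mmul (mmul u m) v) = x@_m.
Proof.
elim/malg_ind: x => [|c k x IH]; first by rewrite mulr0 mul0r !mcoeff0.
rewrite mulrDr mulrDl [LHS]mcoeffD [RHS]mcoeffD; congr (_ + _); last exact: IH.
apply: etrans (congr1 (mcoeff _) (mon_conj_scale (@monM K I) (@malg_scaleAr _ _) c u k v)) _; apply: etrans (mcoeffZ _ _ _) _.
rewrite [RHS](mcoeffZ c << k >> m); congr (_ * _).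
by rewrite !mcoeffU (inj_eq (@mmul_inj2 _ u v)).
Qed.

End Coefficients.

(** * Reduced monomials form a basis *)

Section RewritingModulo.
Variables (K : fieldType) (V : lmodType K) (R : V -> V -> Prop).
Local Notation eqv := (clos_refl_sym_trans V R).

(** A step may only be applied where the rewritten monomial does not occur in the
    rest.  In an arbitrary context, both sides are reached from the element in
    which the coefficient of that monomial has been collected. *)
Lemma eqv_any_context (ok : V -> Prop) s t :
  (forall e b, e != 0 -> ok b -> R (e *: s + b) (e *: t + b)) ->
  (forall a, exists l a', [/\ a = l *: s + a', ok a' & forall c, ok (c *: t + a')]) ->
  forall c a, eqv (c *: s + a) (c *: t + a).
Proof.
move=> Rst dec c a; have [l [a' [-> oka' oka]]] := dec a.
have one e b : ok b -> eqv (e *: s + b) (e *: t + b).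
  move=> okb; have [->|e0] := eqVneq e 0; first by rewrite !scale0r; apply: rst_refl.
  by apply: rst_step; apply: Rst.
apply: (@rst_trans _ _ _ ((c + l) *: t + a')).
  by rewrite addrA -scalerDl; apply: one.
apply: rst_sym; rewrite addrCA scalerDl [X in eqv _ (X + _)]addrC -addrA.
exact: one.
Qed.

(** Asking for all contexts and all coefficients makes this set a subspace. *)
Definition vanishing (x : V) := forall c a, eqv (c *: x + a) a.

Lemma vanishing0 : vanishing 0.
Proof. by move=> c a; rewrite scaler0 add0r; apply: rst_refl. Qed.

Lemma vanishing_combo k x y : vanishing x -> vanishing y -> vanishing (k *: x + y).
Proof.
move=> vx vy c a; rewrite scalerDr -addrA scalerA.
exact: rst_trans (vx _ _) (vy _ _).
Qed.

Lemma vanishing_rule s t :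
  (forall c a, eqv (c *: s + a) (c *: t + a)) -> vanishing (s - t).
Proof.
move=> H c a; rewrite scalerBr -addrA; apply: rst_trans (H _ _) _.
by rewrite addrA subrr add0r; apply: rst_refl.
Qed.

Lemma vanishing_eqv a b : vanishing (a - b) -> eqv a b.
Proof. by move/(_ 1 b); rewrite scale1r subrK. Qed.

End RewritingModulo.

Section ConvergentBasis.
Variables (K : fieldType) (X : polygraph1 K).
Hypotheses (Xleft : left_monomial X) (Xconv : convergent X).
Local Notation F := (free_algebra K (gen0 X)).
Local Notation I := (ideal_gen (@relations K X)).
Local Notation step := (@step K X).
Local Notation eqv := (clos_refl_sym_trans F step).
Implicit Types (a b : F) (m u v : {fmonom (gen0 X)}).

Lemma eqv_joinable a b : eqv a b -> exists2 d, rewrites a d & rewrites b d.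
Proof.
elim=> {a b} [a b s|a|a b _ [d ad bd]|a b c _ [d ad bd] _ [e be ce]].
- by exists b; [apply: rt_step | apply: rt_refl].
- by exists a; apply: rt_refl.
- by exists d.
case: (Xconv.2 _ _ _ bd be) => f df ef.
by exists f; [apply: rt_trans ad df | apply: rt_trans ce ef].
Qed.

Lemma eqv_rule (r : rule X) u v c a :
  eqv (c *: (<< u >> * rsrc r * << v >>) + a) (c *: (<< u >> * rtgt r * << v >>) + a).
Proof.
have [m rm mt] := Xleft r; pose M := mmul (mmul u m) v.
have sM : (<< u >> * rsrc r * << v >>)@_M = 1.
  by rewrite (mcoeff_mon_mul u v m) rm mcoeffUU.
have tM : (<< u >> * rtgt r * << v >>)@_M = 0.
  by rewrite (mcoeff_mon_mul u v m) (mcoeff_outdom mt).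
apply: (eqv_any_context (ok := fun b => M \notin msupp b)) => [e b e0 Mb|{c}a].
  exact: Step rm e0 Mb.
exists a@_M, (a - a@_M *: (<< u >> * rsrc r * << v >>)); split; first by rewrite addrC subrK.
  rewrite -mcoeff_eq0; apply/eqP; apply: etrans (mcoeffB _ _ _) _.
  by rewrite [X in _ - X]mcoeffZ sM mulr1 subrr.
move=> c; rewrite -mcoeff_eq0; apply/eqP; apply: etrans (mcoeffD _ _ _) _.
rewrite [X in X + _]mcoeffZ tM mulr0 add0r.
by apply: etrans (mcoeffB _ _ _) _; rewrite [X in _ - X]mcoeffZ sM mulr1 subrr.
Qed.

(** By [eqv_rule], the generators of the ideal are vanishing in the sense above,
    even between two monomials, hence so is the whole ideal. *)
Lemma eqv_ideal a b : I (a - b) -> eqv a b.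
Proof.
move=> Iab; apply: vanishing_eqv.
have H := ideal_gen_closed (e := fun k => << k >>) erefl (@monM _ _) (@malg_ind _ _)
  (@malg_scaleAr _ _) (@vanishing0 _ _ _) (@vanishing_combo _ _ _) _ Iab.
apply: (H step) => _ [r ->] u v.
rewrite mulrBr mulrBl; apply: vanishing_rule => c a'; exact: eqv_rule.
Qed.

Definition reduced_supp a := forall m, m \in msupp a -> reduced (<< m >> : F).

Lemma reduced_supp_reduced a : reduced_supp a -> reduced a.
Proof.
move=> ra b s; case: s ra => r u m v c a' rm c0 Ma' ra.
have /ra : mmul (mmul u m) v \in
    msupp (c *: (<< u >> * rsrc r * << v >>) + a').
  rewrite -mcoeff_neq0 mcoeffD mcoeffZ mcoeff_mon_mul rm mcoeffUU mulr1.
  by rewrite (mcoeff_outdom Ma') addr0.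
apply; rewrite -[<< _ >>]addr0 -[<< _ >>]scale1r -!monM -rm.
by apply: Step rm _ _; rewrite ?oner_neq0 // msupp0 inE.
Qed.

Lemma rewrites_reduced a b : rewrites a b -> reduced a -> b = a.
Proof.
elim=> {a b} [a b s ra|//|a b c _ IH1 _ IH2 ra]; first by case: (ra b).
by move: IH2; rewrite IH1 // => /(_ ra).
Qed.

(** A reduced element congruent to 0 is joinable with 0, and both are
    normal. *)
Lemma reduced_ideal a : reduced_supp a -> I a -> a = 0.
Proof.
rewrite -{2}[a]subr0 => ra /eqv_ideal /eqv_joinable [d ad zd].
rewrite -(rewrites_reduced ad (reduced_supp_reduced ra)).
apply: rewrites_reduced zd _; apply: reduced_supp_reduced => m.
by rewrite msupp0 inE.
Qed.

Lemma reduced_supp_combo c a b :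
  reduced_supp a -> reduced_supp b -> reduced_supp (c *: a + b).
Proof.
move=> ra rb m; move/(fsubsetP (msuppD_le _ _)); rewrite inE => /orP[|]; last exact: rb.
by move/(fsubsetP (msuppZ_le _ _)); apply: ra.
Qed.

Lemma reduced_supp0 : reduced_supp 0.
Proof. by move=> m; rewrite msupp0 inE. Qed.

Lemma reduced_mod_ideal_supp a :
  (forall m, m \in msupp a -> exists2 r, reduced_supp r & I (<< m >> - r)) ->
  exists2 r, reduced_supp r & I (a - r).
Proof.
move=> H; rewrite [a]monalgE big_seq.
elim/big_rec: _ => [|m y /H [r rr Ir] [r' rr' Ir']].
  by exists 0; [apply: reduced_supp0 | rewrite subr0; apply: ideal_zero].
exists (a@_m *: r + r'); first exact: reduced_supp_combo.
rewrite malgUZ opprD addrACA -scalerBr; apply: ideal_add => //.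
exact: ideal_scale.
Qed.

(** Wellfounded induction on monomials: a monomial that can be rewritten is
    congruent to a combination of smaller ones. *)
Lemma reduced_mod_ideal a : exists2 r, reduced_supp r & I (a - r).
Proof.
apply: reduced_mod_ideal_supp => m _ {a}.
elim/(well_founded_induction Xconv.1): m => m IH.
have [red|/existsNP [b /contrapT]] := pselect (reduced (<< m >> : F)).
  exists << m >>; last by rewrite subrr; apply: ideal_zero.
  by move=> k; rewrite msuppU1 inE => /eqP->.
move E: (<< m >> : F) => x s; case: s E => r u k v c a rk c0 Ma /esym e {b x}.
(* The coefficient of u k v is c, which is not 0, so m must be this monomial. *)
have eM : m = mmul (mmul u k) v.
  have := congr1 (mcoeff (mmul (mmul u k) v)) e.
  rewrite [LHS]mcoeffD [X in X + _]mcoeffZ mcoeff_mon_mul rk mcoeffUU mulr1.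
  rewrite (mcoeff_outdom Ma) addr0 mcoeffU1 => ec; apply/eqP; move: c0.
  by rewrite ec; case: (m == _); rewrite // mulr0n eqxx.
have [r' rr' Ir'] : exists2 r', reduced_supp r' &
    I (<< u >> * rtgt r * << v >> - r').
  apply: reduced_mod_ideal_supp => k' /msupp_mon_mul [k'' k''r ->]; apply: IH.
  by rewrite eM; apply: succ_mul; apply: succ_rule rk k''r.
exists r' => //; apply: ideal_trans Ir'.
have sM : << u >> * rsrc r * << v >> = << m >> :> F by rewrite rk mon_conj -eM.
by rewrite [X in I (X - _)]e -[X in I (X - _)]sM; apply: ideal_conj; exists r.
Qed.

(** The reduced element congruent to the monomial is reached by rewriting, because
    the two are joinable; confluence makes it the only reduced one reached. *)
Lemma normal_formP m : reduced_supp (normal_form (<< m >> : F)) /\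
  I (<< m >> - normal_form << m >>).
Proof.
have [r rr Ir] := reduced_mod_ideal (<< m >> : F).
have redr := reduced_supp_reduced rr.
have [d md rd] := eqv_joinable (eqv_ideal Ir).
have {md rd} mr : rewrites << m >> r by rewrite -(rewrites_reduced rd redr).
suff -> : normal_form << m >> = r by [].
rewrite /normal_form; case: classical_sets.xgetP => [b _ [mb rb]|/(_ r) []] //.
have [e be re] := Xconv.2 _ _ _ mb mr.
by rewrite -(rewrites_reduced be rb) (rewrites_reduced re redr).
Qed.

End ConvergentBasis.

Section AugmentedBasis.
Variables (K : fieldType) (A : algType K) (eps : {lrmorphism A -> K^o}).
Variables (X : polygraph1 K) (phi : {lrmorphism free_algebra K (gen0 X) -> A}).
Hypotheses (Xpres : presentation phi) (Xleft : left_monomial X).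
Hypotheses (Xconv : convergent X).
Hypothesis Xaug : forall u : red_mon X, eps (phi << val u >>) = 0.
Local Notation F := (free_algebra K (gen0 X)).
Local Notation I := (ideal_gen (@relations K X)).
Let b (u : red_mon X) : A := phi << val u >>.
Let pr : F -> {malg K[red_mon X]} :=
  linear_ext (fun m => if insub m is Some w then << w >> else 0).

Lemma reduced_decomp (r : F) : reduced_supp r ->
  phi r = r@_mone *: 1 + linear_ext b (pr r).
Proof.
move=> rr; rewrite (linear_ext_uniq (f := fun k => phi << k >>) (h := phi)) //.
rewrite -(linear_ext_delta mone (1 : A)) linear_ext_comp /linear_ext.
rewrite -big_split /= !big_seq; apply: eq_bigr => k kr.
rewrite -scalerDr; congr (_ *: _).
case: insubP => [w /andP[_ /negbTE km] wk|].
  by rewrite km linear_extU add0r /b wk.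
rewrite negb_and negbK => /orP[/asboolPn[]|/eqP->]; first exact: rr.
by rewrite eqxx linear0 addr0 rmorph1.
Qed.

Lemma phi_ideal x : I x -> phi x = 0.
Proof. by move/(Xpres.2 x). Qed.

Lemma phi_eqmod x y : I (x - y) -> phi x = phi y.
Proof.
by move/phi_ideal; rewrite linearB /= => /eqP; rewrite subr_eq0 => /eqP.
Qed.

Lemma phi_normal_form m : phi (normal_form << m >>) = phi << m >>.
Proof. by have [_ /phi_eqmod] := normal_formP Xleft Xconv m. Qed.

Lemma eps_linear_ext x : eps (linear_ext b x) = 0.
Proof.
rewrite linear_ext_comp /linear_ext big1 // => u _.
exact: etrans (congr1 (fun t => _ *: t) (Xaug u)) (scaler0 _ _).
Qed.

Lemma red_mon_basis : linear_basis_of b (fun a : A => eps a = 0).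
Proof.
split=> [x y|a].
  pose emb := linear_ext (fun u : red_mon X => << val u >> : F).
  have embE z : linear_ext b z = phi (emb z) by rewrite linear_ext_comp.
  have emb0 : emb 0 = 0 by apply: linear0.
  have embS c k z : emb (c *: << k >> + z) = c *: << val k >> + emb z.
    exact: linear_extS.
  have emb_coef z u : (emb z)@_(val u) = z@_u.
    elim/malg_ind: z => [|c k z IH]; first by rewrite emb0 !mcoeff0.
    rewrite embS [LHS]mcoeffD IH [RHS]mcoeffD; congr (_ + _).
    by rewrite [LHS]mcoeffZ [RHS]mcoeffZ !mcoeffU (inj_eq val_inj).
  have emb_red z : reduced_supp (emb z).
    elim/malg_ind: z => [|c k z IH]; first by rewrite emb0; apply: reduced_supp0.
    rewrite embS; apply: reduced_supp_combo => // m.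
    by rewrite msuppU1 inE => /eqP->; case: k => k /= /andP[/asboolP].
  rewrite !embE => /eqP; rewrite -subr_eq0 -linearB -linearB /= => /eqP.
  move/(Xpres.2 _)/(reduced_ideal Xleft Xconv (emb_red _)) => e.
  apply/eqP; rewrite -subr_eq0; apply/eqP/malgP => u.
  by rewrite -emb_coef e !mcoeff0.
split=> [ea|[x <-]]; last exact: eps_linear_ext.
have [p pa] := Xpres.1 a; have [r rr Ir] := reduced_mod_ideal Xconv p.
have ar : a = r@_mone *: 1 + linear_ext b (pr r).
  by rewrite -(reduced_decomp rr) -pa; apply: phi_eqmod.
exists (pr r); move: ea; rewrite {}ar linearD linearZ /= eps_linear_ext.
rewrite rmorph1 addr0 => e.
suff -> : r@_mone = 0 by rewrite scale0r add0r.
by rewrite -e -[LHS]mulr1.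
Qed.

(** The normal form of a product of two elements of the augmentation ideal has no
    constant term, so that nothing is lost by dropping the monomial 1. *)
Lemma red_mulE u v : linear_ext b (red_mul u v) = b u * b v.
Proof.
have [rr _] := normal_formP Xleft Xconv (mmul (val u) (val v)).
have e : phi (normal_form << mmul (val u) (val v) >>) = b u * b v.
  by rewrite phi_normal_form -monM rmorphM.
have := reduced_decomp rr; rewrite e -/(red_mul u v) => E.
have l0 : eps (b u * b v) = 0.
  rewrite rmorphM; exact: etrans (congr1 (fun t => t * _) (Xaug u)) (mul0r _).
move: l0; rewrite E linearD linearZ /= eps_linear_ext rmorph1 addr0.
set c := _@__ => e0; suff -> : c = 0 by rewrite scale0r add0r.
by rewrite -e0 -[LHS]mulr1.
Qed.

End AugmentedBasis.

(** * Evaluation, free modules and based algebras *)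

Section EvalFree.
Variables (K : fieldType) (I : choiceType) (R : algType K) (g : I -> R).

HB.instance Definition _ := GRing.Linear.copy (eval_free g)
  (linear_ext (fun m : {fmonom I} => \prod_(i <- (m : seq I)) g i)).

Lemma eval_freeU m : eval_free g << m >> = \prod_(i <- (m : seq I)) g i.
Proof. exact: linear_extU. Qed.

Lemma eval_free_monoid_morphism : monoid_morphism (eval_free g).
Proof.
split=> [|x y]; first by rewrite eval_freeU fm1 big_nil.
apply: (linear_multiplicative (f := eval_free g) (@monM K I) (@malg_ind _ _)
  (@malg_scaleAr _ _)) => u v.
by rewrite /= !eval_freeU fmM big_cat.
Qed.

HB.instance Definition _ :=
  GRing.isMonoidMorphism.Build (free_algebra K I) R (eval_free g)
    eval_free_monoid_morphism.

End EvalFree.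

(** A free module, known only through its universal property and the induction
    principle on combinations of basis elements. *)
Record free_lmod (K : fieldType) (T : choiceType) := FreeLmod {
  fl_sort : lmodType K;
  fl_elt : T -> fl_sort;
  fl_ext : forall V : lmodType K, (T -> V) -> {linear fl_sort -> V};
  fl_extE : forall (V : lmodType K) (f : T -> V) k, fl_ext f (fl_elt k) = f k;
  fl_ind : forall P : fl_sort -> Prop, P 0 ->
    (forall c k x, P x -> P (c *: fl_elt k + x)) -> forall x, P x }.

Lemma malg_free_lmod (K : fieldType) (T : choiceType) : free_lmod K T.
Proof.
refine (@FreeLmod K T {malg K[T]} (fun k => << k >>)
  (fun V f => (linear_ext f : {linear _ -> _})) _ _).
  exact: linear_extU.
exact: malg_ind.
Qed.

(** An augmented algebra with a basis of its augmentation ideal: [None] indexes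
    the unit, the letters index the basis of the ideal, which is closed under
    products by [lmulE]. *)
Record based_algebra (K : fieldType) := BasedAlgebra {
  base_alg : algType K;
  letter : choiceType;
  basis : option letter -> base_alg;
  coords : {linear base_alg -> {malg K[option letter]}};
  coordsK : cancel coords (linear_ext basis);
  basisK : forall o, coords (basis o) = << o >>;
  basis0 : basis None = 1;
  lmul : letter -> letter -> {malg K[letter]};
  lmulE : forall u v, basis (Some u) * basis (Some v)
    = linear_ext (fun w => basis (Some w)) (lmul u v) }.

(** * The bar complex and its contraction *)

Section BarComplex.
Variables (K : fieldType) (S : based_algebra K).
Local Notation A := (base_alg S).
Local Notation B := (letter S).
Local Notation coords := (@coords K S).
Local Notation basis := (@basis K S).

Definition ltr (u : B) : A := basis (Some u).
Definition aug (a : A) : K := (coords a)@_None.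

Lemma aug_is_linear : linear_for *%R aug.
Proof. by move=> c x y; rewrite /aug linearP mcoeffD mcoeffZ. Qed.
HB.instance Definition _ := GRing.isLinear.Build K A K *%R aug aug_is_linear.

Lemma aug1 : aug 1 = 1.
Proof. by rewrite /aug -basis0 basisK mcoeffUU. Qed.

Lemma aug_letter u : aug (ltr u) = 0.
Proof. by rewrite /aug basisK mcoeffU. Qed.

Lemma basis_ind (P : A -> Prop) : P 0 ->
  (forall c o a, P a -> P (c *: basis o + a)) -> forall a, P a.
Proof.
move=> P0 PS a; rewrite -[a]coordsK; elim/malg_ind: (coords a) => [|c o x IH].
  by rewrite linear0.
by rewrite linearP /= linear_extU; apply: PS.
Qed.

Lemma aug_letterl u a : aug (ltr u * a) = 0.
Proof.
elim/basis_ind: a => [|c o a IH]; first by rewrite mulr0 linear0.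
rewrite mulrDr -scalerAr linearP /= IH addr0.
case: o => [v|]; last by rewrite basis0 mulr1 aug_letter mulr0.
rewrite lmulE; elim/malg_ind: (lmul u v) => [|d w x IHx].
  by rewrite !linear0 mulr0.
by move: IHx; rewrite linear_extS linearP /= aug_letter mulr0 add0r.
Qed.

(** The basis elements a[w]c, where a and c run over the basis of the algebra. *)
Definition bar_basis : Type := option B * seq B * option B.
HB.instance Definition _ := Choice.on bar_basis.
Definition bar : lmodType K := fl_sort (malg_free_lmod K bar_basis).
Definition bar_elt (k : bar_basis) : bar := fl_elt (malg_free_lmod K bar_basis) k.

(** The chain a[w]c. *)
Definition brk (a : A) (w : seq B) (c : A) : bar :=
  linear_ext (fun o => linear_ext (fun o' => bar_elt (o, w, o')) (coords c)) (coords a).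

Lemma brk_linl w c k a a' : brk (k *: a + a') w c = k *: brk a w c + brk a' w c.
Proof. by rewrite /brk linearP linearP. Qed.

Lemma brk_linr w a k c c' : brk a w (k *: c + c') = k *: brk a w c + brk a w c'.
Proof. by rewrite /brk linearP linear_ext_combo. Qed.

Lemma brk0l w c : brk 0 w c = 0.
Proof. by rewrite /brk !linear0. Qed.

Lemma brk0r a w : brk a w 0 = 0.
Proof.
by have := brk_linr w a (-1) 0 0; rewrite scaler0 addr0 scaleN1r addNr.
Qed.

Lemma brk_basis o w o' : brk (basis o) w (basis o') = bar_elt (o, w, o').
Proof. by rewrite /brk !basisK !linear_extU. Qed.

Lemma bar_ind (P : bar -> Prop) : P 0 ->
  (forall k x y, P x -> P y -> P (k *: x + y)) ->
  (forall a w c, P (brk a w c)) -> forall y, P y.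
Proof.
move=> P0 PS Pb; elim/fl_ind=> // k [[o w] o'] y Py; apply: PS => //; rewrite -/(bar_elt _).
by rewrite -brk_basis.
Qed.

Section Ext.
Variables (V : lmodType K) (f : A -> seq B -> A -> V).

Definition bar_ext : {linear bar -> V} :=
  fl_ext _ (fun y : bar_basis => f (basis y.1.1) y.1.2 (basis y.2)).

Definition bilin := (forall w c k a a', f (k *: a + a') w c = k *: f a w c + f a' w c)
  /\ (forall a w k c c', f a w (k *: c + c') = k *: f a w c + f a w c').

Lemma bar_extE : bilin -> forall a w c, bar_ext (brk a w c) = f a w c.
Proof.
move=> [fl fr] a w c.
have f0l v d : f 0 v d = 0.
  by have := fl v d (-1) 0 0; rewrite scaler0 addr0 scaleN1r addNr.
have f0r v d : f d v 0 = 0.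
  by have := fr d v (-1) 0 0; rewrite scaler0 addr0 scaleN1r addNr.
elim/basis_ind: a => [|k o a IH]; first by rewrite brk0l linear0 f0l.
rewrite brk_linl linearP IH fl; congr (_ *: _ + _) => {IH a}.
elim/basis_ind: c => [|d o' c IH]; first by rewrite brk0r linear0 f0r.
rewrite brk_linr linearP IH fr; congr (_ *: _ + _).
by rewrite brk_basis; apply: fl_extE.
Qed.

End Ext.

Definition lact (x : A) : {linear bar -> bar} :=
  bar_ext (fun a w c => brk (x * a) w c).
Definition ract (x : A) : {linear bar -> bar} :=
  bar_ext (fun a w c => brk a w (c * x)).

Lemma lact_brk x a w c : lact x (brk a w c) = brk (x * a) w c.
Proof.
apply: bar_extE; split=> *; last exact: brk_linr.
by rewrite mulrDr -scalerAr brk_linl.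
Qed.

Lemma ract_brk x a w c : ract x (brk a w c) = brk a w (c * x).
Proof.
apply: bar_extE; split=> *; first exact: brk_linl.
by rewrite mulrDl -scalerAl brk_linr.
Qed.

Lemma lact_lin k x x' y : lact (k *: x + x') y = k *: lact x y + lact x' y.
Proof.
elim/bar_ind: y => [|e y z IHy IHz|a w c]; first by rewrite !linear0 addr0.
  by rewrite !linearP /= IHy IHz !scalerDr !scalerA [e * k]mulrC addrACA.
by rewrite !lact_brk mulrDl -scalerAl brk_linl.
Qed.

Lemma ract_lin k x x' y : ract (k *: x + x') y = k *: ract x y + ract x' y.
Proof.
elim/bar_ind: y => [|e y z IHy IHz|a w c]; first by rewrite !linear0 addr0.
  by rewrite !linearP /= IHy IHz !scalerDr !scalerA [e * k]mulrC addrACA.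
by rewrite !ract_brk mulrDr -scalerAr brk_linr.
Qed.

Lemma lact1 y : lact 1 y = y.
Proof.
elim/bar_ind: y => [|e y z IHy IHz|a w c]; first by rewrite linear0.
  by rewrite linearP /= IHy IHz.
by rewrite lact_brk mul1r.
Qed.

Lemma ract1 y : ract 1 y = y.
Proof.
elim/bar_ind: y => [|e y z IHy IHz|a w c]; first by rewrite linear0.
  by rewrite linearP /= IHy IHz.
by rewrite ract_brk mulr1.
Qed.

Lemma lactM x x' y : lact (x * x') y = lact x (lact x' y).
Proof.
elim/bar_ind: y => [|e y z IHy IHz|a w c]; first by rewrite !linear0.
  by rewrite !linearP /= IHy IHz.
by rewrite !lact_brk mulrA.
Qed.

Lemma ractM x x' y : ract (x * x') y = ract x' (ract x y).
Proof.
elim/bar_ind: y => [|e y z IHy IHz|a w c]; first by rewrite !linear0.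
  by rewrite !linearP /= IHy IHz.
by rewrite !ract_brk mulrA.
Qed.

Lemma lact_ract x x' y : lact x (ract x' y) = ract x' (lact x y).
Proof.
elim/bar_ind: y => [|e y z IHy IHz|a w c]; first by rewrite !linear0.
  by rewrite !linearP /= IHy IHz.
by rewrite !(lact_brk, ract_brk).
Qed.

Lemma lact0 y : lact 0 y = 0.
Proof. by have := lact_lin (-1) 0 0 y; rewrite scaler0 addr0 scaleN1r addNr. Qed.
Lemma ract0 y : ract 0 y = 0.
Proof. by have := ract_lin (-1) 0 0 y; rewrite scaler0 addr0 scaleN1r addNr. Qed.
Lemma lactD x x' y : lact (x + x') y = lact x y + lact x' y.
Proof. by have := lact_lin 1 x x' y; rewrite !scale1r. Qed.
Lemma ractD x x' y : ract (x + x') y = ract x y + ract x' y.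
Proof. by have := ract_lin 1 x x' y; rewrite !scale1r. Qed.
Lemma lactZ k x y : lact (k *: x) y = k *: lact x y.
Proof. by have := lact_lin k x 0 y; rewrite lact0 !addr0. Qed.
Lemma ractZ k x y : ract (k *: x) y = k *: ract x y.
Proof. by have := ract_lin k x 0 y; rewrite ract0 !addr0. Qed.

(** The part of a chain in the degrees satisfying p. *)
Definition degs (p : pred nat) : {linear bar -> bar} :=
  bar_ext (fun a w c => if p (size w) then brk a w c else 0).

Lemma degs_brk p a w c : degs p (brk a w c) = if p (size w) then brk a w c else 0.
Proof.
apply: bar_extE; split=> *; case: (p _) => /=.
- by rewrite brk_linl.
- by rewrite scaler0 addr0.
- by rewrite brk_linr.
- by rewrite scaler0 addr0.
Qed.

Lemma degsI p q y : degs p (degs q y) = degs (predI p q) y.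
Proof.
elim/bar_ind: y => [|e y z IHy IHz|a w c]; first by rewrite !linear0.
  by rewrite !linearP /= IHy IHz.
by rewrite !degs_brk /=; case: (q _); rewrite ?andbF ?linear0 // degs_brk andbT.
Qed.

Lemma eq_degs p q y : p =1 q -> degs p y = degs q y.
Proof.
move=> pq; elim/bar_ind: y => [|e y z IHy IHz|a w c]; first by rewrite !linear0.
  by rewrite !linearP /= IHy IHz.
by rewrite !degs_brk pq.
Qed.

Lemma degs_pred0 y : degs pred0 y = 0.
Proof.
elim/bar_ind: y => [|e y z IHy IHz|a w c]; first by rewrite !linear0.
  by rewrite !linearP /= IHy IHz scaler0 addr0.
by rewrite degs_brk.
Qed.

Lemma degs_lact p x y : degs p (lact x y) = lact x (degs p y).
Proof.
elim/bar_ind: y => [|e y z IHy IHz|a w c]; first by rewrite !linear0.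
  by rewrite !linearP /= IHy IHz.
by rewrite lact_brk !degs_brk; case: ifP; rewrite ?lact_brk ?linear0.
Qed.

Lemma degs_ract p x y : degs p (ract x y) = ract x (degs p y).
Proof.
elim/bar_ind: y => [|e y z IHy IHz|a w c]; first by rewrite !linear0.
  by rewrite !linearP /= IHy IHz.
by rewrite ract_brk !degs_brk; case: ifP; rewrite ?ract_brk ?linear0.
Qed.

(** The extra degeneracy of the normalized bar complex: v[w]c is sent to [v|w]c,
    and 1[w]c to 0. *)
Definition insert_letter (w : seq B) (c : A) (o : option B) : bar :=
  if o is Some v then brk 1 (v :: w) c else 0.
Definition homotopy : {linear bar -> bar} :=
  bar_ext (fun a w c => linear_ext (insert_letter w c) (coords a)).

Lemma homotopy_brk a w c : homotopy (brk a w c) = linear_ext (insert_letter w c) (coords a).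
Proof.
apply: bar_extE; split=> [v d k x x'|x v k d d']; first by rewrite !linearP.
rewrite /linear_ext scaler_sumr -big_split; apply: eq_bigr => o _ /=.
rewrite scalerA mulrC -scalerA -scalerDr; congr (_ *: _).
by case: o => [u|] /=; rewrite ?brk_linr // scaler0 addr0.
Qed.

Lemma homotopy_basis o w c : homotopy (brk (basis o) w c) = insert_letter w c o.
Proof. by rewrite homotopy_brk basisK linear_extU. Qed.

Lemma homotopy1 w c : homotopy (brk 1 w c) = 0.
Proof. by rewrite -basis0 homotopy_basis. Qed.

Lemma homotopy_letter v w c : homotopy (brk (ltr v) w c) = brk 1 (v :: w) c.
Proof. exact: homotopy_basis. Qed.

Lemma bar_basis_ind (P : bar -> Prop) : P 0 ->
  (forall k x y, P x -> P y -> P (k *: x + y)) ->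
  (forall w c, P (brk 1 w c)) -> (forall v w c, P (brk (ltr v) w c)) -> forall y, P y.
Proof.
move=> P0 PS P1 P2; elim/fl_ind=> // k [[o w] o'] y Py; apply: PS => //; rewrite -/(bar_elt _).
by rewrite -brk_basis; case: o => [v|]; [apply: P2 | rewrite basis0; apply: P1].
Qed.

Lemma homotopyK y : homotopy (homotopy y) = 0.
Proof.
elim/bar_basis_ind: y => [|e y z IHy IHz|w c|v w c]; first by rewrite !linear0.
- by rewrite !linearP /= IHy IHz scaler0 addr0.
- by rewrite homotopy1 linear0.
- by rewrite homotopy_letter homotopy1.
Qed.

Lemma homotopy_ract x y : homotopy (ract x y) = ract x (homotopy y).
Proof.
elim/bar_basis_ind: y => [|e y z IHy IHz|w c|v w c]; first by rewrite !linear0.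
- by rewrite !linearP /= IHy IHz.
- by rewrite ract_brk !homotopy1 linear0.
- by rewrite ract_brk !homotopy_letter ract_brk.
Qed.

Lemma degs_homotopy p y : degs p (homotopy y) = homotopy (degs (fun i => p i.+1) y).
Proof.
elim/bar_basis_ind: y => [|e y z IHy IHz|w c|v w c]; first by rewrite !linear0.
- by rewrite !linearP /= IHy IHz.
- by rewrite homotopy1 degs_brk; case: ifP; rewrite ?homotopy1 !linear0.
- by rewrite homotopy_letter !degs_brk /=; case: ifP; rewrite ?homotopy_letter ?linear0.
Qed.

(** Up to signs, the bar differential of [w].  It is defined from the homotopy by
    recursion on the first letter, which makes [bdry_homotopy] hold by
    construction. *)
Fixpoint bdry0 (w : seq B) : bar :=
  match w with
  | [::] => 0
  | [:: u] => brk (ltr u) [::] 1 - brk 1 [::] (ltr u)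
  | u :: w' => (-1) ^+ size w' *: brk (ltr u) w' 1 + homotopy (lact (ltr u) (bdry0 w'))
  end.

Lemma bdry0_cons u w : w != [::] ->
  bdry0 (u :: w) = (-1) ^+ size w *: brk (ltr u) w 1 + homotopy (lact (ltr u) (bdry0 w)).
Proof. by case: w. Qed.

Definition bdry : {linear bar -> bar} :=
  bar_ext (fun a w c => lact a (ract c (bdry0 w))).

Lemma bdry_brk a w c : bdry (brk a w c) = lact a (ract c (bdry0 w)).
Proof.
apply: bar_extE; split=> *; first exact: lact_lin.
by rewrite ract_lin linearP.
Qed.

Lemma bdry_lact x y : bdry (lact x y) = lact x (bdry y).
Proof.
elim/bar_ind: y => [|e y z IHy IHz|a w c]; first by rewrite !linear0.
  by rewrite !linearP /= IHy IHz.
by rewrite lact_brk !bdry_brk lactM.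
Qed.

Lemma bdry_ract x y : bdry (ract x y) = ract x (bdry y).
Proof.
elim/bar_ind: y => [|e y z IHy IHz|a w c]; first by rewrite !linear0.
  by rewrite !linearP /= IHy IHz.
by rewrite ract_brk !bdry_brk ractM lact_ract.
Qed.

Lemma bdry_brk1 w : bdry (brk 1 w 1) = bdry0 w.
Proof. by rewrite bdry_brk lact1 ract1. Qed.

Lemma degs_bdry0 p w : degs p (bdry0 w) = if p (size w).-1 then bdry0 w else 0.
Proof.
elim: w p => [|u [|v w] IH] p; first by rewrite linear0 if_same.
  by rewrite /= linearB /= !degs_brk /=; case: ifP; rewrite ?subrr.
rewrite bdry0_cons // linearD linearZ /= degs_brk degs_homotopy degs_lact IH /=.
by case: ifP => // _; rewrite !linear0 addr0.
Qed.

Lemma degs_bdry p y : degs p (bdry y) = bdry (degs (fun i => p i.-1) y).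
Proof.
elim/bar_ind: y => [|e y z IHy IHz|a w c]; first by rewrite !linear0.
  by rewrite !linearP /= IHy IHz.
rewrite bdry_brk degs_lact degs_ract degs_bdry0 degs_brk.
by case: ifP; rewrite ?bdry_brk // !linear0.
Qed.

(** The contraction.  By bilinearity, y may be taken of the form a[w]c where a is
    1 or a letter; when a is a letter the identity is the definition of
    the boundary of [a|w], and when a = 1 the homotopy sends y to 0 and extracts w
    from its boundary. *)
Lemma bdry_homotopy n y : (0 < n)%N -> degs (pred1 n) y = y ->
  bdry (homotopy y) = (-1) ^+ n *: y + homotopy (bdry y).
Proof.
move=> n0 <-.
elim/bar_basis_ind: y => [|e y z IHy IHz|w c|v w c].
- by rewrite !linear0 addr0.
- rewrite !linearP /= IHy IHz !scalerDr -!addrA; congr (_ + _).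
  exact: addrCA.
- rewrite degs_brk /=; case: eqP => [e|_]; last by rewrite !linear0 addr0.
  rewrite homotopy1 linear0 bdry_brk lact1 homotopy_ract.
  case: w e => [|u w] e; first by rewrite -e in n0.
  have -> : homotopy (bdry0 (u :: w)) = - (-1) ^+ n *: brk 1 (u :: w) 1.
    case: w e => [<-|v w <-].
      by rewrite linearB /= homotopy1 homotopy_letter subr0 expr1 opprK scale1r.
    rewrite bdry0_cons // linearD /= homotopyK addr0 linearZ /= homotopy_letter.
    by rewrite [in RHS]exprS mulN1r opprK.
  by rewrite linearZ /= ract_brk mul1r -scalerDl subrr scale0r.
- rewrite degs_brk /=; case: eqP => [e|_]; last by rewrite !linear0 addr0.
  rewrite homotopy_letter !bdry_brk lact1 bdry0_cons; last by case: w e n0 => // <-.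
  rewrite linearD linearZ /= ract_brk mul1r e; congr (_ + _).
  by rewrite -homotopy_ract lact_ract.
Qed.

Lemma bdry_homotopy0 a c : bdry (homotopy (brk a [::] c)) = brk a [::] c - brk 1 [::] (a * c).
Proof.
elim/basis_ind: a => [|k o a IH]; first by rewrite mul0r brk0l brk0r !linear0 addr0.
rewrite mulrDl -scalerAl brk_linl brk_linr !linearP /= IH addrACA -scalerDr.
congr (_ *: _ + _); case: o => [v|]; last by rewrite basis0 homotopy1 mul1r linear0 subrr.
by rewrite homotopy_letter bdry_brk lact1 /= linearB /= !ract_brk mul1r.
Qed.

(** By induction on the word: [bdry_homotopy], applied to u times the boundary
    of [w], cancels the two terms of the boundary of [u|w]. *)
Lemma bdryK y : bdry (bdry y) = 0.
Proof.
suff dd0 w : bdry (bdry0 w) = 0.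
  elim/bar_ind: y => [|e y z IHy IHz|a w c]; first by rewrite !linear0.
    by rewrite !linearP /= IHy IHz scaler0 addr0.
  by rewrite bdry_brk bdry_lact bdry_ract dd0 !linear0.
elim: w => [|u w IH]; first by rewrite linear0.
case: w IH => [_|v w IH].
  by rewrite /= linearB /= !bdry_brk !linear0 addr0.
have deg : degs (pred1 (size w)) (bdry0 (v :: w)) = bdry0 (v :: w).
  by rewrite degs_bdry0 /= eqxx.
rewrite bdry0_cons // linearD linearZZ bdry_brk ract1.
case: w IH deg => [_ _|x w IH deg].
  rewrite [size _]/= expr1 scaleN1r /= !linearB /= !lact_brk !mulr1 !bdry_homotopy0 !mulr1.
  move: (brk _ _ _) (brk (ltr u) _ _) (brk 1 _ _) => X Y W.
  have -> : X - W - (Y - W) = X - Y by rewrite opprB addrA subrK.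
  by rewrite opprK addrACA addNr subrr addr0.
rewrite (@bdry_homotopy (size (x :: w))) ?degs_lact ?deg //.
rewrite [bdry (lact _ _)]bdry_lact IH !linear0 addr0.
by rewrite [size _]/= exprS mulN1r scaleNr addNr.
Qed.

End BarComplex.

Arguments degs {K S} p.
Arguments homotopy {K S}.
Arguments bdry {K S}.

(** * Words and their derivation *)

(** The free algebra on the letters, known through its universal property and its
    identification with the free algebra on the 0-cells. *)
Record free_alg (K : fieldType) (B : choiceType) := FreeAlg {
  fa_sort : algType K;
  fa_mon : seq B -> fa_sort;
  fa_one : fa_mon [::] = 1;
  fa_mul : forall u v, fa_mon u * fa_mon v = fa_mon (u ++ v);
  fa_ext : forall V : lmodType K, (seq B -> V) -> {linear fa_sort -> V};
  fa_extE : forall (V : lmodType K) (f : seq B -> V) w, fa_ext f (fa_mon w) = f w;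
  fa_ind : forall P : fa_sort -> Prop, P 0 ->
    (forall c w x, P x -> P (c *: fa_mon w + x)) -> forall x, P x;
  fa_of : {lrmorphism free_algebra K (std_cells B 0) -> fa_sort};
  fa_ofE : forall m, fa_of << m >> = fa_mon [seq thead (i : 1.-tuple B) | i <- (m : seq _)];
  fa_to : fa_sort -> free_algebra K (std_cells B 0);
  fa_ofK : cancel fa_of fa_to;
  fa_toK : cancel fa_to fa_of }.

Section FreeAlg.
Variables (K : fieldType) (B : choiceType).
Definition concrete_fa : Type := free_algebra K (std_cells B 0).
HB.instance Definition _ := GRing.Lalgebra.on concrete_fa.
HB.instance Definition _ := GRing.Lalgebra_isAlgebra.Build K concrete_fa
  (@malg_scaleAr K (std_cells B 0)).

Definition letters_monom (w : seq B) : {fmonom (std_cells B 0)} :=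
  FMonom [seq [tuple u] : 1.-tuple B | u <- w].
Definition monom_letters (m : {fmonom (std_cells B 0)}) : seq B :=
  [seq thead (i : 1.-tuple B) | i <- (m : seq _)].

Lemma letters_monomK w : monom_letters (letters_monom w) = w.
Proof. by rewrite /monom_letters /= -map_comp map_id. Qed.

Lemma monom_lettersK m : letters_monom (monom_letters m) = m.
Proof.
case: m => m; rewrite /letters_monom /monom_letters /=; congr FMonom; rewrite -map_comp.
by apply: map_id_in => i _; apply/val_inj => /=; case/tupleP: i => x t; rewrite tuple0.
Qed.

Lemma letters_monom_cat u v : mmul (letters_monom u) (letters_monom v) = letters_monom (u ++ v).
Proof. by apply: val_inj; rewrite /= fmM /= map_cat. Qed.

Lemma malg_free_alg : free_alg K B.
Proof.
refine (@FreeAlg K B (concrete_fa : algType K) (fun w => << letters_monom w >>) _ _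
  (fun V f => (linear_ext (fun m => f (monom_letters m)) : {linear _ -> _})) _ _
  (idfun : {lrmorphism concrete_fa -> concrete_fa}) _ id _ _) => //.
- by rewrite /letters_monom /=; congr << _ >>; apply: val_inj; rewrite /= fm1.
- move=> u v; rewrite -letters_monom_cat; exact: (@monM K (std_cells B 0) (letters_monom u) (letters_monom v)).
- by move=> V f w; apply: etrans (linear_extU _ _) _; rewrite letters_monomK.
- move=> P P0 PS; apply: malg_ind => // c k x Px.
  by rewrite -(monom_lettersK k); apply: PS.
- by move=> m; rewrite /= monom_lettersK.
Qed.
End FreeAlg.

Section GoodSpan.
Variables (K : fieldType) (T : choiceType).

(** Combinations of basis elements satisfying S, to argue on words of a given
    shape only. *)
Inductive spanned (S : T -> Prop) : {malg K[T]} -> Prop :=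
| spanned0 : spanned S 0
| spannedS c k x : S k -> spanned S x -> spanned S (c *: << k >> + x).

Variable S : T -> Prop.

Lemma spannedU k : S k -> spanned S << k >>.
Proof. by move=> Sk; rewrite -[<< k >>]scale1r -[_ *: _]addr0; apply: spannedS (spanned0 _). Qed.

Lemma spanned_combo c x y : spanned S x -> spanned S y -> spanned S (c *: x + y).
Proof.
move=> gx gy; elim: gx => [|d k {}x Sk _ IH]; first by rewrite scaler0 add0r.
by rewrite scalerDr scalerA -addrA; apply: spannedS.
Qed.

Lemma spannedB x y : spanned S x -> spanned S y -> spanned S (x - y).
Proof. by move=> gx gy; rewrite addrC -scaleN1r; apply: spanned_combo. Qed.

End GoodSpan.

Lemma spanned_lin (K : fieldType) (T T' : choiceType) (S : T -> Prop) (S' : T' -> Prop)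
    (f : T -> {malg K[T']}) x :
  (forall k, S k -> spanned S' (f k)) -> spanned S x -> spanned S' (linear_ext f x).
Proof.
move=> Sf; elim=> [|c k {}x Sk _ IH]; first by rewrite linear0; apply: spanned0.
by rewrite linear_extS; apply: spanned_combo => //; apply: Sf.
Qed.

Section Cells.
Variables (K : fieldType) (S : based_algebra K).
Local Notation A := (base_alg S).
Local Notation B := (letter S).
Local Notation bar := (bar S).
Local Notation lmul := (@lmul K S).

Definition word_algebra : algType K := fa_sort (malg_free_alg K B).
Local Notation T := word_algebra.
Definition mon (w : seq B) : T := fa_mon (malg_free_alg K B) w.

Lemma mon1 : mon [::] = 1. Proof. exact: fa_one. Qed.
Lemma monD u v : mon u * mon v = mon (u ++ v). Proof. exact: fa_mul. Qed.
Lemma word_algebra_ind (P : T -> Prop) : P 0 ->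
  (forall c w x, P x -> P (c *: mon w + x)) -> forall x, P x.
Proof. exact: fa_ind. Qed.

Definition word_value (w : seq B) : A := \prod_(u <- w) ltr u.
Lemma word_value0 : word_value [::] = 1. Proof. exact: big_nil. Qed.
Lemma word_value_cons u w : word_value (u :: w) = ltr u * word_value w. Proof. exact: big_cons. Qed.
Lemma word_value_cat u w : word_value (u ++ w) = word_value u * word_value w. Proof. exact: big_cat. Qed.
Lemma aug_word_value_cons u w a : aug (word_value (u :: w) * a) = 0.
Proof. by rewrite word_value_cons -mulrA aug_letterl. Qed.

Definition proj : {linear T -> A} := fa_ext _ word_value.
Lemma proj_mon w : proj (mon w) = word_value w. Proof. exact: fa_extE. Qed.
Lemma projM x y : proj (x * y) = proj x * proj y.
Proof.
elim/word_algebra_ind: x => [|c w x IH]; first by rewrite mul0r !linear0 mul0r.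
rewrite mulrDl -scalerAl !linearP /= IH mulrDl -scalerAl; congr (_ *: _ + _).
elim/word_algebra_ind: y {IH} => [|d l y IH]; first by rewrite mulr0 !linear0 mulr0.
rewrite mulrDr -scalerAr !linearP /= IH mulrDr -scalerAr; congr (_ *: _ + _).
by rewrite monD !proj_mon word_value_cat.
Qed.
Lemma proj1 : proj 1 = 1. Proof. by rewrite -mon1 proj_mon word_value0. Qed.

Fixpoint word_der (w : seq B) : bar :=
  if w is u :: w' then lact (ltr u) (word_der w') + brk 1 [:: u] (word_value w') else 0.
(** The universal derivation of T, with values in the chains of degree 1:
    u_1...u_n is sent to the sum of the u_1...u_{i-1}[u_i]u_{i+1}...u_n. *)
Definition der : {linear T -> bar} := fa_ext _ word_der.
Lemma der_mon w : der (mon w) = word_der w. Proof. exact: fa_extE. Qed.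

Lemma word_der_cat u v : word_der (u ++ v) = lact (word_value u) (word_der v) + ract (word_value v) (word_der u).
Proof.
elim: u => [|x u IH] /=; first by rewrite word_value0 lact1 linear0 addr0.
by rewrite IH !linearD /= word_value_cons lactM lact_ract ract_brk word_value_cat -addrA.
Qed.

Lemma derM x y : der (x * y) = lact (proj x) (der y) + ract (proj y) (der x).
Proof.
elim/word_algebra_ind: x => [|c w x IH]; first by rewrite mul0r !linear0 lact0 addr0.
rewrite mulrDl -scalerAl !linearP /= IH lactD lactZ [RHS]addrACA -scalerDr; congr (_ *: _ + _).
elim/word_algebra_ind: y {IH} => [|d l y IH]; first by rewrite mulr0 !linear0 ract0 addr0.
rewrite mulrDr -scalerAr !linearP /= IH ractD ractZ [RHS]addrACA -scalerDr; congr (_ *: _ + _).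
by rewrite monD !der_mon !proj_mon word_der_cat.
Qed.

Lemma der1 : der 1 = 0. Proof. by rewrite -mon1 der_mon. Qed.

Lemma degs_word_der p w : degs p (word_der w) = if p 1%N then word_der w else 0.
Proof.
elim: w => [|u w IH] /=; first by rewrite linear0 if_same.
by rewrite linearD /= degs_lact IH degs_brk /=; case: (p _); rewrite ?linear0 ?addr0.
Qed.

Lemma degs_der p x : degs p (der x) = if p 1%N then der x else 0.
Proof.
elim/word_algebra_ind: x => [|c w x IH]; first by rewrite !linear0 if_same.
rewrite !linearP /= IH der_mon degs_word_der.
by case: (p _) => //; rewrite scaler0 addr0.
Qed.

(** * The chain of a generator *)

(** The effect on chains of the three ways to put a letter a in front of a
    word of blocks: [att_bar] puts it at the head of the first block,
    [att_merge] multiplies it with the first letter, and [att_alt] does so in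
    even degrees only and is the plain left action in odd degrees.  As long as the
    left coefficient a' is in the augmentation ideal, the first letter is in a',
    otherwise a' = 1 and it is the first letter of the bracket. *)
Definition merge (a : A) (w : seq B) (c : A) : bar :=
  if w is x :: w' then homotopy (brk (a * ltr x) w' c) else 0.

Definition att_bar (a : A) : {linear bar -> bar} :=
  bar_ext (fun a' w c => aug a' *: homotopy (brk a w c)).
Definition att_merge (a : A) : {linear bar -> bar} :=
  bar_ext (fun a' w c => brk (a * (a' - aug a' *: 1)) w c + aug a' *: merge a w c).
Definition att_alt (a : A) : {linear bar -> bar} :=
  bar_ext (fun a' w c => if odd (size w) then brk (a * a') w c
    else brk (a * (a' - aug a' *: 1)) w c + aug a' *: merge a w c).

Lemma merge_linr a w k c c' : merge a w (k *: c + c') = k *: merge a w c + merge a w c'.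
Proof.
by case: w => [|x w] /=; rewrite ?scaler0 ?addr0 // brk_linr linearP.
Qed.

Lemma att_bar_brk a a' w c : att_bar a (brk a' w c) = aug a' *: homotopy (brk a w c).
Proof.
apply: bar_extE; split=> [v d k x x'|x v k d d'].
  by rewrite linearP /= scalerDl scalerA.
by rewrite brk_linr linearP /= scalerDr !scalerA mulrC.
Qed.

Lemma mul_aug_lin (a : A) k (x x' : A) : a * (k *: x + x' - aug (k *: x + x') *: 1) =
  k *: (a * (x - aug x *: 1)) + a * (x' - aug x' *: 1).
Proof.
rewrite [aug _]linearP /= scalerDl -scalerA opprD addrACA -scalerBr mulrDr.
by rewrite -scalerAr.
Qed.

Lemma att_merge_bilin a : bilin (fun a' w c =>
  brk (a * (a' - aug a' *: 1)) w c + aug a' *: merge a w c).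
Proof.
split=> [v d k x x'|x v k d d'].
  rewrite mul_aug_lin linearP /= brk_linl scalerDl -scalerA addrACA.
  by rewrite -scalerDr.
by rewrite brk_linr merge_linr !scalerDr !scalerA [aug x * k]mulrC addrACA.
Qed.

Lemma att_merge_brk a a' w c : att_merge a (brk a' w c) =
  brk (a * (a' - aug a' *: 1)) w c + aug a' *: merge a w c.
Proof. exact: (bar_extE (att_merge_bilin a)). Qed.

Lemma att_alt_brk a a' w c : att_alt a (brk a' w c) =
  if odd (size w) then brk (a * a') w c
  else brk (a * (a' - aug a' *: 1)) w c + aug a' *: merge a w c.
Proof.
apply: bar_extE; split=> [v d k x x'|x v k d d']; case: (odd _).
- by rewrite mulrDr -scalerAr brk_linl.
- exact: (att_merge_bilin a).1.
- by rewrite brk_linr.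
- exact: (att_merge_bilin a).2.
Qed.

Lemma att_merge0 a a' w c : aug a' = 0 -> att_merge a (brk a' w c) = brk (a * a') w c.
Proof. by move=> e; rewrite att_merge_brk e !scale0r subr0 addr0. Qed.
Lemma att_alt0 a a' w c : aug a' = 0 -> att_alt a (brk a' w c) = brk (a * a') w c.
Proof. by move=> e; rewrite att_alt_brk e !scale0r subr0 addr0 if_same. Qed.
Lemma att_bar0 a a' w c : aug a' = 0 -> att_bar a (brk a' w c) = 0.
Proof. by move=> e; rewrite att_bar_brk e scale0r. Qed.

Section LinFamily.
Variable F : A -> {linear bar -> bar}.
Lemma lin_family : (forall k (x x' a : A) (w : seq B) (c : A), F (k *: x + x') (brk a w c)
    = k *: F x (brk a w c) + F x' (brk a w c)) ->
  forall k x x' y, F (k *: x + x') y = k *: F x y + F x' y.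
Proof.
move=> H k x x' y; elim/bar_ind: y => [|e y z IHy IHz|a w c].
- by rewrite !linear0 addr0.
- by rewrite !linearP /= IHy IHz !scalerDr !scalerA [e * k]mulrC addrACA.
- exact: H.
Qed.

Lemma ract_family : (forall (x a : A) (w : seq B) (c d : A), F x (brk a w (c * d)) = ract d (F x (brk a w c))) ->
  forall x d y, F x (ract d y) = ract d (F x y).
Proof.
move=> H x d y; elim/bar_ind: y => [|e y z IHy IHz|a w c].
- by rewrite !linear0.
- by rewrite !linearP /= IHy IHz.
- by rewrite ract_brk H.
Qed.
End LinFamily.

Lemma merge_linl w c k x x' : merge (k *: x + x') w c = k *: merge x w c + merge x' w c.
Proof.
case: w => [|y w] /=; first by rewrite scaler0 addr0.
by rewrite mulrDl -scalerAl brk_linl linearP.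
Qed.

Lemma merge_brk_lin k (x x' a : A) w (c : A) :
  brk ((k *: x + x') * a) w c = k *: brk (x * a) w c + brk (x' * a) w c.
Proof. by rewrite mulrDl -scalerAl brk_linl. Qed.

Lemma att_bar_lin k x x' y :
  att_bar (k *: x + x') y = k *: att_bar x y + att_bar x' y.
Proof.
apply: lin_family => {}k {}x {}x' a w c.
by rewrite !att_bar_brk brk_linl linearP /= scalerDr !scalerA mulrC.
Qed.

Lemma att_alt_lin k x x' y :
  att_alt (k *: x + x') y = k *: att_alt x y + att_alt x' y.
Proof.
apply: lin_family => {}k {}x {}x' a w c.
rewrite !att_alt_brk; case: (odd _); first exact: merge_brk_lin.
rewrite merge_brk_lin merge_linl !scalerDr !scalerA [aug _ * _]mulrC.
by rewrite addrACA.
Qed.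

Lemma merge_ract (x : A) w (c d : A) : merge x w (c * d) = ract d (merge x w c).
Proof.
by case: w => [|y w] /=; rewrite ?linear0 // -homotopy_ract ract_brk.
Qed.

Lemma att_bar_ract x d y : att_bar x (ract d y) = ract d (att_bar x y).
Proof.
apply: (ract_family (F := att_bar)) => {}x a w c {}d.
by rewrite !att_bar_brk linearZ /= -homotopy_ract ract_brk.
Qed.

Lemma att_merge_ract x d y : att_merge x (ract d y) = ract d (att_merge x y).
Proof.
apply: (ract_family (F := att_merge)) => {}x a w c {}d.
by rewrite !att_merge_brk [RHS]linearD [X in _ = _ + X]linearZ /= merge_ract ract_brk.
Qed.

Lemma att_alt_ract x d y : att_alt x (ract d y) = ract d (att_alt x y).
Proof.
apply: (ract_family (F := att_alt)) => {}x a w c {}d.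
rewrite !att_alt_brk; case: (odd _); first by rewrite ract_brk.
by rewrite [RHS]linearD [X in _ = _ + X]linearZ /= merge_ract ract_brk.
Qed.

Section Aug.
Variable x : A.
Hypothesis x0 : forall a, aug (x * a) = 0.

Lemma att_bar_lact a y : att_bar a (lact x y) = 0.
Proof.
elim/bar_ind: y => [|e y z IHy IHz|a' w c].
- by rewrite !linear0.
- by rewrite !linearP /= IHy IHz scaler0 addr0.
- by rewrite lact_brk att_bar0.
Qed.

Lemma att_merge_lact a y : att_merge a (lact x y) = lact (a * x) y.
Proof.
elim/bar_ind: y => [|e y z IHy IHz|a' w c].
- by rewrite !linear0.
- by rewrite !linearP /= IHy IHz.
- by rewrite !lact_brk att_merge0 // mulrA.
Qed.

Lemma att_alt_lact a y : att_alt a (lact x y) = lact (a * x) y.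
Proof.
elim/bar_ind: y => [|e y z IHy IHz|a' w c].
- by rewrite !linear0.
- by rewrite !linearP /= IHy IHz.
- by rewrite !lact_brk att_alt0 // mulrA.
Qed.
End Aug.

Lemma att_merge_homotopy a a' w c : att_merge a (homotopy (brk a' w c)) =
  homotopy (brk (a * (a' - aug a' *: 1)) w c).
Proof.
elim/basis_ind: a' => [|k o a' IH].
  by rewrite linear0 scale0r subr0 mulr0 brk0l !linear0.
rewrite mul_aug_lin !brk_linl !linearP /= IH; congr (_ *: _ + _).
case: o => [v|].
  rewrite -/(ltr v) aug_letter scale0r subr0 homotopy_letter att_merge_brk aug1 !scale1r subrr.
  by rewrite mulr0 brk0l add0r.
by rewrite basis0 aug1 scale1r subrr mulr0 brk0l homotopy1 !linear0.
Qed.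

(** How the chain of a generator changes when the letter a is put in front; q is
    the value in A of the letters already there. *)
Definition chain_step (a : A) (y : bar) (q : A) : bar :=
  att_bar a y + att_alt a y + homotopy (brk a [::] q).

Fixpoint block_chain (w : seq B) : bar :=
  if w is u :: w' then chain_step (ltr u) (block_chain w') (word_value w') else 0.

Lemma chain_step_lin k x x' y w : chain_step (k *: x + x') y w = k *: chain_step x y w + chain_step x' y w.
Proof.
rewrite /chain_step att_bar_lin att_alt_lin brk_linl linearP /=.
by rewrite !scalerDr [RHS]addrACA [X in _ = X + _]addrACA.
Qed.

Lemma chain_step0 y w : chain_step 0 y w = 0.
Proof. by have := chain_step_lin (-1) 0 0 y w; rewrite scaler0 addr0 scaleN1r addNr. Qed.

(** Multiplying the first letter commutes with adding it to the chain; this is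
    what the last operator on the first bar requires. *)
Lemma att_merge_chain_step a x y w : (forall b, aug (x * b) = 0) ->
  att_merge a (chain_step x y w) = chain_step (a * x) y w.
Proof.
move=> x0; have ex : aug x = 0 by rewrite -[x]mulr1 x0.
rewrite /chain_step !linearD /=; congr (_ + _ + _); last first.
- by rewrite att_merge_homotopy ex scale0r subr0.
- elim/bar_ind: y => [|e y z IHy IHz|a' v c].
  + by rewrite !linear0.
  + by rewrite !linearP /= IHy IHz.
  + rewrite !att_alt_brk; case: (odd _); first by rewrite att_merge0 ?mulrA.
    rewrite [LHS]linearD [X in _ + X = _]linearZ /= att_merge0 // mulrA; congr (_ + _ *: _).
    case: v => [|z v] /=; first by rewrite linear0.
    by rewrite att_merge_homotopy x0 scale0r subr0 mulrA.
- elim/bar_ind: y => [|e y z IHy IHz|a' v c].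
  + by rewrite !linear0.
  + by rewrite !linearP /= IHy IHz.
  + by rewrite !att_bar_brk linearZ /= att_merge_homotopy ex scale0r subr0.
Qed.

Lemma chain_step_lmul u v y w : chain_step (ltr u * ltr v) y w =
  linear_ext (fun x => chain_step (ltr x) y w) (lmul u v).
Proof.
rewrite [ltr u * ltr v]lmulE; elim/malg_ind: (lmul u v) => [|c k x IH].
  by rewrite !linear0 chain_step0.
by rewrite !linear_extS chain_step_lin IH.
Qed.

End Cells.

Arguments der {K S}.
Arguments proj {K S}.
Arguments mon {K S} w.

(** * The alternating product of the operators on bars *)

Lemma zmod_id1 (V : zmodType) (x a b c d : V) :
  x - a + (b - d) - (c - d) = x - (- b + (a + c)).
Proof. by rewrite opprB !addrA subrK !opprD opprK !addrA [x + b - a]addrAC. Qed.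

Lemma zmod_id2 (V : zmodType) (x a b c d : V) :
  x - a + (c - d) - (b - d) = x - (b + (a - c)).
Proof.
by rewrite opprB !addrA subrK !opprD opprK !addrA [x - b - a]addrAC [_ + c - b]addrAC.
Qed.

Section Words.
Variables (K : fieldType) (S : based_algebra K).
Local Notation A := (base_alg S).
Local Notation B := (letter S).
Local Notation bar := (bar S).
Local Notation T := (word_algebra S).
Local Notation coords := (@coords K S).
Local Notation basis := (@basis K S).
(** Gives access to the type of combinations of words with the choice structure
    that unification finds for [<< w >>]. *)
Definition word_unit (w : word B) := (<< w >> : {malg K[_]}).
Local Notation W :=
  ltac:(let t := type of word_unit in match t with _ -> ?r => exact r end).
Local Notation lmul := (@lmul K S).

Definition words_value (w : word B) : A := word_value (flatten w).
Fixpoint word_chain (w : word B) : bar :=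
  if w is b :: r then ract (words_value r) (block_chain b) + lact (word_value b) (word_chain r) else 0.

Definition letter_word (o : option B) : seq B := if o is Some u then [:: u] else [::].
(** The linear section of [proj] with values in the words of length at most 1. *)
Definition as_letters (a : A) : T := linear_ext (fun o => mon (letter_word o)) (coords a).
Lemma as_letters_is_linear : linear as_letters.
Proof. by move=> c x y; rewrite /as_letters !linearP. Qed.
HB.instance Definition _ := GRing.isLinear.Build K A T *:%R as_letters as_letters_is_linear.

Lemma as_letters_basis o : as_letters (basis o) = mon (letter_word o).
Proof. by rewrite /as_letters /= basisK linear_extU. Qed.
Lemma as_letters_letter u : as_letters (ltr u) = mon [:: u].
Proof. exact: as_letters_basis. Qed.
Lemma as_letters1 : as_letters 1 = 1.
Proof. by rewrite -basis0 as_letters_basis mon1. Qed.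
Lemma projK a : proj (as_letters a) = a.
Proof.
elim/basis_ind: a => [|c o a IH]; first by rewrite !linear0.
rewrite !linearP /= IH as_letters_basis proj_mon; congr (_ *: _ + _).
by case: o => [u|]; rewrite /= ?word_value_cons word_value0 ?mulr1 // basis0.
Qed.

(** The 0-source and the 0-target of a product of generators: in the first, all
    bars become products of T, and in the second, each block is replaced by the
    value in A of its letters. *)
Definition words_src (w : word B) : T := mon (flatten w).
Definition words_tgt (w : word B) : T := \prod_(b <- w) as_letters (word_value b).

Definition mul_first (u : B) : {linear T -> T} :=
  fa_ext _ (fun w => if w is x :: w' then as_letters (ltr u * ltr x) * mon w' else 0).
Lemma mul_first_mon u x w : mul_first u (mon (x :: w)) = as_letters (ltr u * ltr x) * mon w.
Proof. exact: fa_extE. Qed.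

Lemma aug_ind (P : A -> Prop) : P 0 ->
  (forall c v a, P a -> P (c *: ltr v + a)) -> forall a, aug a = 0 -> P a.
Proof.
move=> P0 PS a a0; rewrite -[a]subr0 -[0](scale0r 1) -a0 {a0}.
elim/basis_ind: a => [|k o a IH]; first by rewrite linear0 scale0r subr0.
have -> : k *: basis o + a - aug (k *: basis o + a) *: 1 =
    k *: (basis o - aug (basis o) *: 1) + (a - aug a *: 1).
  by rewrite [aug _]linearP /= scalerDl -scalerA opprD addrACA -scalerBr.
case: o => [v|]; last by rewrite basis0 aug1 scale1r subrr scaler0 add0r.
by rewrite -/(ltr v) aug_letter scale0r subr0; apply: PS.
Qed.

Lemma mul_first_as_letters u a t : aug a = 0 -> mul_first u (as_letters a * t) = as_letters (ltr u * a) * t.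
Proof.
elim/aug_ind => [|k v {}a IH]; first by rewrite mulr0 !linear0 !mul0r linear0.
rewrite [as_letters (_ + a)]linearP mulrDl -scalerAl [LHS]linearP /= IH.
rewrite mulrDr -scalerAr [as_letters (_ + _)]linearP /= mulrDl -scalerAl.
congr (_ *: _ + _); rewrite as_letters_letter.
elim/word_algebra_ind: t {IH} => [|c w t IHt]; first by rewrite !mulr0 linear0.
rewrite !mulrDr -!scalerAr [LHS]linearP /= IHt monD; congr (_ *: _ + _).
exact: mul_first_mon.
Qed.

(** The three ways to put a letter in front of a word of blocks. *)
Definition head_bar (u : B) (w : word B) : W :=
  if w is b :: r then << (u :: b) :: r >> else 0.
Definition head_tens (u : B) (w : word B) : W := << [:: u] :: w >>.
Definition head_merge (u : B) (w : word B) : W :=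
  if w is (x :: c) :: r then linear_ext (fun v => << (v :: c) :: r >>) (lmul u x) else 0.
(** The first letter of a word of blocks, on which these operators act, is
    that of its first block. *)
Definition headed (w : word B) : Prop := if w is (_ :: _) :: _ then True else False.

Local Notation ext f := (linear_ext f).

Lemma words_value_cons b r : words_value (b :: r) = word_value b * words_value r.
Proof. exact: word_value_cat. Qed.

Lemma words_value_bar u x : spanned headed x -> ext words_value (ext (head_bar u) x) = ltr u * ext words_value x.
Proof.
elim=> [|c w {}x gw _ IH]; first by rewrite linear_ext20 ?linear_ext0 ?linear0 mulr0.
rewrite linear_ext2S !linear_extS IH mulrDr -scalerAr; congr (_ *: _ + _).
by case: w gw => // -[//|y b] r _; rewrite linear_extU !words_value_cons !word_value_cons !mulrA.
Qed.

Lemma words_value_tens u x : ext words_value (ext (head_tens u) x) = ltr u * ext words_value x.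
Proof.
elim/malg_ind: x => [|c w x IH]; first by rewrite linear_ext20 ?linear_ext0 ?linear0 mulr0.
rewrite linear_ext2S !linear_extS IH mulrDr -scalerAr; congr (_ *: _ + _).
by rewrite linear_extU words_value_cons word_value_cons word_value0 mulr1.
Qed.

Lemma words_value_merge u x : spanned headed x -> ext words_value (ext (head_merge u) x) = ltr u * ext words_value x.
Proof.
elim=> [|c w {}x gw _ IH]; first by rewrite linear_ext20 ?linear_ext0 ?linear0 mulr0.
rewrite linear_ext2S !linear_extS IH mulrDr -scalerAr; congr (_ *: _ + _).
case: w gw => // -[//|y b] r _; rewrite /head_merge linear_ext2U.
rewrite words_value_cons word_value_cons !mulrA [ltr u * ltr y]lmulE.
elim/malg_ind: (lmul u y) => [|d v z IHz]; first by rewrite !linear0 !mul0r.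
by rewrite !linear_extS IHz !mulrDl -!scalerAl words_value_cons word_value_cons.
Qed.

Lemma chain_step_lin2 (a : A) k (y y' : bar) (q q' : A) :
  chain_step a (k *: y + y') (k *: q + q') = k *: chain_step a y q + chain_step a y' q'.
Proof.
rewrite /chain_step !linearP /= brk_linr linearP /= !scalerDr.
by rewrite [in RHS]addrACA [X in _ = X + _]addrACA.
Qed.

Lemma word_chain_bar u x : spanned headed x ->
  ext word_chain (ext (head_bar u) x) = chain_step (ltr u) (ext word_chain x) (ext words_value x).
Proof.
elim=> [|c w {}x gw _ IH].
  by rewrite linear_ext20 !linear_ext0 /chain_step brk0r !linear0 !addr0.
rewrite linear_ext2S !linear_extS chain_step_lin2 IH; congr (_ *: _ + _).
case: w gw => // -[//|y b] r _; rewrite linear_extU words_value_cons.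
have y0 a : aug (word_value (y :: b) * a) = 0 := aug_word_value_cons _ _ _.
move: (y :: b) y0 => {}b y0; rewrite /= /chain_step !linearD /=.
rewrite att_bar_lact // att_alt_lact // addr0 word_value_cons.
rewrite att_bar_ract att_alt_ract -homotopy_ract ract_brk -!addrA; congr (_ + _).
by congr (_ + _); rewrite addrC.
Qed.

Lemma word_chain_tens u x : ext word_chain (ext (head_tens u) x) =
  lact (ltr u) (ext word_chain x) + homotopy (brk (ltr u) [::] (ext words_value x)).
Proof.
elim/malg_ind: x => [|c w x IH]; first by rewrite linear_ext20 ?linear_ext0 ?linear0 brk0r !linear0 addr0.
rewrite linear_ext2S !linear_extS IH brk_linr !linearP /= [RHS]addrACA -scalerDr.
congr (_ *: _ + _); rewrite linear_extU /= word_value_cons word_value0 mulr1 addrC; congr (_ + _).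
by rewrite /chain_step !linear0 !add0r -homotopy_ract ract_brk mul1r.
Qed.

Lemma word_chain_merge u x : spanned headed x ->
  ext word_chain (ext (head_merge u) x) = att_merge (ltr u) (ext word_chain x).
Proof.
elim=> [|c w {}x gw _ IH]; first by rewrite linear_ext20 ?linear_ext0 ?linear0.
rewrite linear_ext2S linear_extS linearP /= IH; congr (_ *: _ + _).
case: w gw => // -[//|y b] r _; rewrite /head_merge linear_ext2U [word_chain _]/=.
rewrite linearD /= att_merge_lact; last by move=> a; apply: aug_word_value_cons.
rewrite att_merge_ract att_merge_chain_step; last by move=> a; apply: aug_letterl.
rewrite chain_step_lmul word_value_cons mulrA [ltr u * ltr y]lmulE.
elim/malg_ind: (lmul u y) => [|d v z IHz]; first by rewrite !linear0 !mul0r lact0 addr0.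
rewrite !linear_extS IHz mulrDl linearP /= -scalerAl lactD lactZ.
by rewrite [RHS]addrACA -scalerDr word_value_cons.
Qed.

Lemma words_src_bar u x : spanned headed x ->
  ext words_src (ext (head_bar u) x) = mon [:: u] * ext words_src x.
Proof.
elim=> [|c w {}x gw _ IH]; first by rewrite linear_ext20 ?linear_ext0 ?linear0 mulr0.
rewrite linear_ext2S !linear_extS IH mulrDr -scalerAr; congr (_ *: _ + _).
by case: w gw => // -[//|y b] r _; rewrite linear_extU /words_src /= monD.
Qed.

Lemma words_src_tens u x : ext words_src (ext (head_tens u) x) = mon [:: u] * ext words_src x.
Proof.
elim/malg_ind: x => [|c w x IH]; first by rewrite linear_ext20 ?linear_ext0 ?linear0 mulr0.
rewrite linear_ext2S !linear_extS IH mulrDr -scalerAr; congr (_ *: _ + _).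
by rewrite linear_extU /words_src /= monD.
Qed.

Lemma words_src_merge u x : spanned headed x ->
  ext words_src (ext (head_merge u) x) = mul_first u (ext words_src x).
Proof.
elim=> [|c w {}x gw _ IH]; first by rewrite linear_ext20 ?linear_ext0 ?linear0.
rewrite linear_ext2S linear_extS linearP /= IH; congr (_ *: _ + _).
case: w gw => // -[//|y b] r _; rewrite /head_merge linear_ext2U /words_src /= mul_first_mon.
rewrite [ltr u * ltr y]lmulE linear_ext_comp.
elim/malg_ind: (lmul u y) => [|d v z IHz]; first by rewrite !linear0 mul0r.
by rewrite !linear_extS /= IHz mulrDl -scalerAl as_letters_basis monD.
Qed.

Lemma words_tgt_cons b r : words_tgt (b :: r) = as_letters (word_value b) * words_tgt r.
Proof. exact: big_cons. Qed.

Lemma words_tgt_bar u x : spanned headed x ->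
  ext words_tgt (ext (head_bar u) x) = mul_first u (ext words_tgt x).
Proof.
elim=> [|c w {}x gw _ IH]; first by rewrite linear_ext20 ?linear_ext0 ?linear0.
rewrite linear_ext2S linear_extS linearP /= IH; congr (_ *: _ + _).
case: w gw => // -[//|y b] r _; rewrite linear_extU !words_tgt_cons.
by rewrite mul_first_as_letters ?(word_value_cons u) // -[word_value _]mulr1 aug_word_value_cons.
Qed.

Lemma words_tgt_merge u x : spanned headed x ->
  ext words_tgt (ext (head_merge u) x) = mul_first u (ext words_tgt x).
Proof.
elim=> [|c w {}x gw _ IH]; first by rewrite linear_ext20 ?linear_ext0 ?linear0.
rewrite linear_ext2S linear_extS linearP /= IH; congr (_ *: _ + _).
case: w gw => // -[//|y b] r _; rewrite /head_merge linear_ext2U words_tgt_cons.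
rewrite mul_first_as_letters; last by rewrite -[word_value _]mulr1 aug_word_value_cons.
rewrite word_value_cons mulrA [ltr u * ltr y]lmulE.
elim/malg_ind: (lmul u y) => [|d v z IHz]; first by rewrite !linear0 mul0r linear0 mul0r.
rewrite !linear_extS IHz mulrDl -scalerAl [X in _ = X * _]linearP mulrDl /=.
by rewrite -scalerAl words_tgt_cons word_value_cons.
Qed.

Lemma words_tgt_tens u x : ext words_tgt (ext (head_tens u) x) = mon [:: u] * ext words_tgt x.
Proof.
elim/malg_ind: x => [|c w x IH]; first by rewrite linear_ext20 ?linear_ext0 ?linear0 mulr0.
rewrite linear_ext2S !linear_extS IH mulrDr -scalerAr; congr (_ *: _ + _).
by rewrite linear_extU words_tgt_cons word_value_cons word_value0 mulr1 as_letters_letter.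
Qed.

(** (1 - d_1)...(1 - d_n) applied to a block.  All operators but the one on
    the first bar come from the block without its first letter, so that putting
    this letter in front with a bar, and then subtracting the operator of the first
    bar, gives a recursion. *)
Fixpoint cube (tg : bool) (z : seq B) : W :=
  match z with
  | [::] => 0
  | [:: u] => << [:: [:: u]] >>
  | u :: w => ext (head_bar u) (cube tg w)
      - (if odd (size w).-1 == tg then ext (head_tens u) (cube tg w)
         else ext (head_merge u) (cube tg w))
  end.

Lemma cube_cons tg u w : w != [::] -> cube tg (u :: w) = ext (head_bar u) (cube tg w)
      - (if odd (size w).-1 == tg then ext (head_tens u) (cube tg w)
         else ext (head_merge u) (cube tg w)).
Proof. by case: w. Qed.

Lemma spanned_bar u x : spanned headed x -> spanned headed (ext (head_bar u) x).
Proof. by apply: spanned_lin => -[//|b r] _; apply: spannedU. Qed.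
Lemma spanned_tens u x : spanned headed x -> spanned headed (ext (head_tens u) x).
Proof. by apply: spanned_lin => w _; apply: spannedU. Qed.
Lemma spanned_merge u x : spanned headed x -> spanned headed (ext (head_merge u) x).
Proof.
apply: spanned_lin => -[//|[//|y b] r] _; apply: (spanned_lin (S := fun _ => True)).
  by move=> v _; apply: spannedU.
by elim/malg_ind: (lmul u y) => [|c v z IH]; [apply: spanned0|apply: spannedS].
Qed.

Lemma spanned_cube tg z : spanned headed (cube tg z).
Proof.
elim: z => [|u [|x w] IH]; first exact: spanned0.
  exact: spannedU.
rewrite cube_cons //; apply: spannedB; first exact: spanned_bar.
by case: ifP => _; [apply: spanned_tens|apply: spanned_merge].
Qed.

(** The products of all letters agree in all the terms of the alternating
    product, so they cancel in pairs.  The same holds below for the words of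
    0-cells when the operator on the first bar does not change them, and
    otherwise their sum already vanishes on the tail. *)
Lemma words_value_cube tg u x w : ext words_value (cube tg [:: u, x & w]) = 0.
Proof.
rewrite cube_cons // linear_extB words_value_bar; last exact: spanned_cube.
case: ifP => _; first by rewrite words_value_tens subrr.
by rewrite words_value_merge ?subrr //; apply: spanned_cube.
Qed.

Lemma words_src_cube_src u x w : ext words_src (cube false [:: u, x & w]) = 0.
Proof.
elim: w u x => [|y w IH] u x; rewrite cube_cons // linear_extB.
  by rewrite words_src_bar ?words_src_tens ?subrr //; apply: spanned_cube.
rewrite words_src_bar ?IH; last exact: spanned_cube.
by case: ifP => _; rewrite ?words_src_tens ?words_src_merge ?IH ?mulr0 ?linear0 ?oppr0 ?addr0 //; apply: spanned_cube.
Qed.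

Lemma words_src_cube_tgt u x y w : ext words_src (cube true [:: u, x, y & w]) = 0.
Proof.
elim: w u x y => [|v w IH] u x y; rewrite cube_cons // linear_extB.
  by rewrite words_src_bar ?words_src_tens ?subrr //; apply: spanned_cube.
rewrite words_src_bar ?IH; last exact: spanned_cube.
by case: ifP => _; rewrite ?words_src_tens ?words_src_merge ?IH ?mulr0 ?linear0 ?oppr0 ?addr0 //; apply: spanned_cube.
Qed.

Lemma words_tgt_cube_tgt u x w : ext words_tgt (cube true [:: u, x & w]) = 0.
Proof.
elim: w u x => [|y w IH] u x; rewrite cube_cons // linear_extB.
  by rewrite words_tgt_bar ?words_tgt_merge ?subrr //; apply: spanned_cube.
rewrite words_tgt_bar ?IH; last exact: spanned_cube.
by case: ifP => _; rewrite ?words_tgt_tens ?words_tgt_merge ?IH ?mulr0 ?linear0 ?oppr0 ?addr0 //; apply: spanned_cube.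
Qed.

Lemma words_tgt_cube_src u x y w : ext words_tgt (cube false [:: u, x, y & w]) = 0.
Proof.
elim: w u x y => [|v w IH] u x y; rewrite cube_cons // linear_extB.
  by rewrite words_tgt_bar ?words_tgt_merge ?subrr //; apply: spanned_cube.
rewrite words_tgt_bar ?IH; last exact: spanned_cube.
by case: ifP => _; rewrite ?words_tgt_tens ?words_tgt_merge ?IH ?mulr0 ?linear0 ?oppr0 ?addr0 //; apply: spanned_cube.
Qed.

Lemma att_alt_deg (a : A) n (y : bar) : degs (pred1 n) y = y ->
  att_alt a y = if odd n then lact a y else att_merge a y.
Proof.
move=> <-; elim/bar_ind: y => [|e y z IHy IHz|a' w c].
- by rewrite !linear0 if_same.
- by rewrite !linearP /= IHy IHz; case: (odd n); rewrite ?linearP.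
- rewrite degs_brk /=; case: eqP => [<-|_]; last by rewrite !linear0 if_same.
  by rewrite att_alt_brk lact_brk att_merge_brk.
Qed.

Local Notation brk1 w := (brk (1 : A) w (1 : A)).

Lemma word_chain1 u : word_chain [:: [:: u]] = brk1 [:: u].
Proof. by rewrite /= /chain_step !linear0 /words_value /= word_value0 ract1 addr0 !add0r homotopy_letter. Qed.

Lemma att_bar1 u w : att_bar (ltr u) (brk1 w) = brk1 (u :: w).
Proof. by rewrite att_bar_brk aug1 scale1r homotopy_letter. Qed.

Lemma degs_brk1 w (c : A) : degs (pred1 (size w)) (brk 1 w c) = brk 1 w c.
Proof. by rewrite degs_brk /= eqxx. Qed.

(** Here the operator on the first bar is chosen so that it acts as
    [att_alt]; it cancels this term of [chain_step], and only [att_bar] is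
    left. *)
Lemma word_chain_cube_src z : z != [::] -> ext word_chain (cube false z) = brk1 z.
Proof.
elim: z => [//|u [|x w] IH] _; first by rewrite /= linear_extU word_chain1.
have {}IH := IH isT; have gx := spanned_cube false (x :: w).
rewrite cube_cons // linear_extB word_chain_bar // IH /chain_step att_bar1.
rewrite (att_alt_deg _ (degs_brk1 (x :: w) 1)).
case: w IH gx => [|y w] IH gx.
  by rewrite [size _]/= [odd 1]/= [odd 1.-1]/= eqxx word_chain_tens IH -[X in X - _]addrA addrK.
have e1 : odd (size [:: x, y & w]) = odd (size w) by rewrite /= negbK.
have e2 : odd (size [:: x, y & w]).-1 = ~~ odd (size w) by [].
rewrite words_value_cube brk0r linear0 addr0 e1 e2; case: (odd _).
  by rewrite word_chain_tens IH words_value_cube brk0r linear0 addr0 addrK.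
by rewrite word_chain_merge // IH addrK.
Qed.

Lemma homotopy_lact_homotopy u (y : bar) : homotopy (lact (ltr u) (homotopy y)) = att_bar (ltr u) (homotopy y).
Proof.
elim/bar_basis_ind: y => [|e y z IHy IHz|w c|v w c]; first by rewrite !linear0.
- by rewrite !linearP /= IHy IHz.
- by rewrite homotopy1 !linear0.
- by rewrite homotopy_letter lact_brk mulr1 att_bar_brk aug1 scale1r.
Qed.

(** The terms of the boundary with left coefficient 1 are those that
    [att_bar] keeps; the remaining one has left coefficient x, and gives the
    term where u and x are merged. *)
Lemma homotopy_lact_bdry0 u x w : w != [::] -> homotopy (lact (ltr u) (bdry0 (x :: w))) =
  att_bar (ltr u) (bdry0 (x :: w)) + (-1) ^+ size w *: att_merge (ltr u) (brk1 (x :: w)).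
Proof.
move=> w0; rewrite bdry0_cons // !linearD !linearZ /= homotopy_lact_homotopy.
rewrite att_bar0 ?aug_letter // scaler0 add0r addrC; congr (_ + _ *: _).
by rewrite att_merge_brk aug1 !scale1r subrr mulr0 brk0l add0r lact_brk.
Qed.

(** For the target, the operator on the first bar is the other one, and its
    difference with [att_alt] builds the boundary by the recursion of
    [homotopy_lact_bdry0]. *)
Lemma word_chain_cube_tgt u x w :
  ext word_chain (cube true [:: u, x & w]) = brk1 [:: u, x & w] - bdry0 [:: u, x & w].
Proof.
elim: w u x => [|y w IH] u x; have gx := spanned_cube true (x :: _).
  rewrite cube_cons // linear_extB word_chain_bar // word_chain_merge //.
  rewrite [cube _ _]/= !linear_extU word_chain1 /chain_step att_bar1.
  rewrite (att_alt_deg _ (degs_brk1 [:: x] 1)) /words_value /= word_value_cons word_value0 mulr1 expr1 scaleN1r.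
  rewrite lact_brk mulr1 linearB /= !lact_brk !mulr1 linearB /= !homotopy_letter.
  rewrite att_merge_brk aug1 !scale1r subrr mulr0 brk0l add0r /=.
  by rewrite !opprD !opprK -!addrA; do 2!congr (_ + _); rewrite addrC.
have {}gx := gx (y :: w); rewrite cube_cons //.
have p0 := words_value_cube true x y w; have {}IH := IH x y.
move: (cube true [:: x, y & w]) gx p0 IH => Q gx p0 IH.
rewrite linear_extB word_chain_bar // IH p0 /chain_step brk0r.
rewrite [in RHS]bdry0_cons // homotopy_lact_bdry0 //.
have deg : degs (pred1 (size w).+1) (bdry0 [:: x, y & w]) = bdry0 [:: x, y & w].
  by rewrite degs_bdry0 /= eqxx.
move: (bdry0 _) deg IH => D deg IH.
rewrite [homotopy 0]linear0 addr0 [size _]/= -pred_Sn.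
rewrite [att_bar _ _]linearB [att_alt _ _]linearB /= att_bar1.
rewrite (att_alt_deg _ (degs_brk1 [:: x, y & w] 1)) (att_alt_deg _ deg).
set X := brk1 [:: u, x, y & w]; set P := brk1 [:: x, y & w].
have lP : brk (ltr u) [:: x, y & w] 1 = lact (ltr u) P by rewrite lact_brk mulr1.
have e1 : odd (size [:: x, y & w]) = odd (size w) by rewrite /= negbK.
have e2 : odd (size w).+1 = ~~ odd (size w) by [].
rewrite lP e1 e2 ![size _]/= !exprS !mulN1r opprK -[(-1) ^+ size w]signr_odd.
case: (odd (size w)).
  rewrite [~~ _ == _]/= word_chain_merge // IH -/P [att_merge _ (_ - _)]linearB /=.
  by rewrite /= expr1 opprK scaleN1r scale1r; apply: zmod_id1.
rewrite [~~ _ == _]/= word_chain_tens IH p0 brk0r linear0 addr0.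
rewrite -/P [lact _ (_ - _)]linearB /=; by rewrite /= expr0 scaleN1r scale1r; apply: zmod_id2.
Qed.

End Words.

Section AlternatingProduct.
Variables (K : fieldType) (V : lmodType K) (I : finType) (f : I -> V -> V).
Hypothesis f_lin : forall i c x y, f i (c *: x + y) = c *: f i x + f i y.

Lemma op_sum i (J : finType) (P : pred J) (c : J -> K) (F : J -> V) :
  f i (\sum_(j | P j) c j *: F j) = \sum_(j | P j) c j *: f i (F j).
Proof.
have f0 : f i 0 = 0 by have := f_lin i (-1) 0 0; rewrite scaler0 addr0 scaleN1r addNr.
by elim/big_rec2: _ => [//|j y1 y2 _ <-]; rewrite f_lin.
Qed.

(** Expansion of a product of operators 1 - f_i, which need not commute: the
    subsets of the indices are read in the order of the product. *)
Lemma alternating_foldr_in (r : seq I) x : uniq r ->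
  \sum_(J : {set I} | J \subset r) (-1) ^+ #|J| *: foldr f x [seq i <- r | i \in J]
    = foldr (fun i y => y - f i y) x r.
Proof.
elim: r => [_|a r IH /= /andP[ar ur]].
  rewrite (big_pred1 finset.set0) => [|J]; first by rewrite cards0 expr0 scale1r.
  apply/fintype.subsetP/eqP => [sJ|-> i]; last by rewrite inE.
  by apply/setP => i; rewrite inE; apply/negP => /sJ.
rewrite (bigID (fun J : {set I} => a \in J)) /= addrC; congr (_ + _).
  rewrite -IH //; apply: eq_big => [J|J /andP[_ /negbTE->]] //.
  apply/andP/idP => [[/fintype.subsetP sJ aJ]|/fintype.subsetP sJ].
    apply/fintype.subsetP => i iJ; have := sJ i iJ; rewrite inE => /orP[/eqP ia|//].
    by rewrite -ia iJ in aJ.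
  split; first by apply/fintype.subsetP => i /sJ ir; rewrite inE ir orbT.
  by apply: contra ar => /sJ.
rewrite (reindex_onto (fun J : {set I} => a |: J) (fun J => J :\ a)) /=; last first.
  by move=> J /andP[_ aJ]; rewrite finset.setD1K.
rewrite -IH // op_sum -sumrN; apply: eq_big => [J|J /andP[/andP[sJ _] /eqP eJ]].
  rewrite finset.setU11 andbT; apply/andP/idP => [[/fintype.subsetP sJ /eqP eJ]|/fintype.subsetP sJ].
    apply/fintype.subsetP => i iJ; have := sJ i; rewrite in_setU1 iJ orbT inE => /(_ isT).
    by case/orP => // /eqP ia; move: iJ; rewrite -eJ ia in_setD1 eqxx.
  have aJ : a \notin J by apply: contra ar => /sJ.
  split; last by rewrite finset.setU1K.
  by apply/fintype.subsetP => i; rewrite in_setU1 inE => /orP[->//|/sJ ->]; rewrite orbT.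
have aJ : a \notin J by rewrite -eJ in_setD1 eqxx.
rewrite cardsU1 aJ finset.setU11 /= exprS mulN1r scaleNr; congr (- (_ *: f a (foldr _ _ _))).
apply: eq_in_filter => i ir; rewrite in_setU1; case: eqP => // ia.
by rewrite -ia ir in ar.
Qed.

Lemma alternating_foldr x :
  \sum_(J : {set I}) (-1) ^+ #|J| *: foldr f x (enum J)
    = foldr (fun i y => y - f i y) x (enum I).
Proof.
rewrite -alternating_foldr_in ?enum_uniq //; apply: eq_big => [J|J _].
  by apply/esym/fintype.subsetP => i _; rewrite mem_enum.
by congr (_ *: foldr _ _ _); rewrite /enum_mem -filter_predI; apply: eq_filter => i; rewrite /= andbT.
Qed.

Lemma alternating_foldr_proper x :
  \sum_(J : {set I} | J != finset.set0) (-1) ^+ #|J|.+1 *: foldr f x (enum J)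
    = x - foldr (fun i y => y - f i y) x (enum I).
Proof.
rewrite -alternating_foldr [in RHS](bigD1 finset.set0) //= cards0 expr0 scale1r enum_set0 /=.
rewrite opprD addrA subrr add0r -sumrN; apply: eq_bigr => J _.
by rewrite exprS mulN1r scaleNr.
Qed.

End AlternatingProduct.

Lemma spanned_true (K : fieldType) (T : choiceType) (x : {malg K[T]}) :
  spanned (fun _ => True) x.
Proof. by elim/malg_ind: x => [|c k x gx]; [apply: spanned0 | apply: spannedS]. Qed.

Lemma eq_spanned_comp (K : fieldType) (T T1 T2 : choiceType) (V : lmodType K)
    (S : T -> Prop) (g1 : T1 -> V) (f1 : T -> {malg K[T1]})
    (g2 : T2 -> V) (f2 : T -> {malg K[T2]}) x :
  (forall k, S k -> linear_ext g1 (f1 k) = linear_ext g2 (f2 k)) -> spanned S x ->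
  linear_ext g1 (linear_ext f1 x) = linear_ext g2 (linear_ext f2 x).
Proof.
move=> fg; elim=> [|c k {}x Sk _ IH]; first by rewrite !linear_ext20.
by rewrite !linear_ext2S IH fg.
Qed.

Section CubeFold.
Variables (K : fieldType) (S : based_algebra K).
Local Notation B := (letter S).
Local Notation lmul := (@lmul K S).
Local Notation ext f := (linear_ext f).

(** Away from the first bar, the operators do not see the first letter. *)
Lemma dbar_head_bar tens u i x : (0 < i)%N -> spanned (@headed _ S) x ->
  ext (dbar lmul tens i.+1) (ext (@head_bar _ S u) x) = ext (@head_bar _ S u) (ext (dbar lmul tens i) x).
Proof.
move=> i0; apply: eq_spanned_comp => -[//|[//|y b] r] _; rewrite linear_extU /=.
case: i i0 => // i _; rewrite !ltnS /=.
case: (_ < _)%N; last by rewrite subSS; symmetry; apply: linear_ext2U.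
case: tens; first by rewrite linear_extU.
case: (drop i (y :: b)) => [|x1 [|x2 t]]; rewrite ?linear_ext0 //.
apply: esym; apply: etrans (linear_ext2U _ _ _) _; apply: eq_linear_ext => v /=.
by case: (take i (y :: b)).
Qed.

Lemma spanned_dbar tens i x : (0 < i)%N -> spanned (@headed _ S) x ->
  spanned (@headed _ S) (ext (dbar lmul tens i) x).
Proof.
move=> i0; apply: spanned_lin => -[//|[//|y b] r] _ /=.
case: (_ < _)%N; last first.
  by apply: (spanned_lin (S := fun _ => True)) => [k _|]; [apply: spannedU | apply: spanned_true].
case: i i0 => // i _; case: tens; first exact: spannedU.
case: (drop _ _) => [|x1 [|x2 t]]; try exact: spanned0.
apply: (spanned_lin (S := fun _ => True)) => [v _|]; last exact: spanned_true.
by apply: spannedU; case: i.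
Qed.

Definition cube_factor (tg : bool) (n i : nat) x := x - ext (dbar lmul (odd (n - i) == tg) i) x.

Lemma spanned_cube_factor tg n i x : (0 < i)%N -> spanned (@headed _ S) x ->
  spanned (@headed _ S) (cube_factor tg n i x).
Proof. by move=> i0 gx; apply: spannedB => //; apply: spanned_dbar. Qed.

Lemma cube_factor_head_bar tg n u i x : (0 < i)%N -> spanned (@headed _ S) x ->
  cube_factor tg n.+1 i.+1 (ext (@head_bar _ S u) x) = ext (@head_bar _ S u) (cube_factor tg n i x).
Proof.
move=> i0 gx; rewrite /cube_factor linear_extB subSS; congr (_ - _).
exact: dbar_head_bar.
Qed.

Lemma foldr_cube_factor_head_bar tg n u s x : all (fun i => 0 < i)%N s -> spanned (@headed _ S) x ->
  spanned (@headed _ S) (foldr (cube_factor tg n) x s) /\ foldr (cube_factor tg n.+1) (ext (@head_bar _ S u) x) (map succn s)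
    = ext (@head_bar _ S u) (foldr (cube_factor tg n) x s).
Proof.
move=> + gx; elim: s => [//|i s IH] /andP[i0 /IH[g e]].
split; first exact: spanned_cube_factor.
exact: etrans (congr1 (cube_factor tg n.+1 i.+1) e) (cube_factor_head_bar _ _ _ i0 g).
Qed.

Lemma cube_factor1 tg n u x : spanned (@headed _ S) x ->
  cube_factor tg n 1 (ext (@head_bar _ S u) x) = ext (@head_bar _ S u) x
    - (if odd n.-1 == tg then ext (@head_tens _ S u) x else ext (@head_merge _ S u) x).
Proof.
move=> gx; rewrite /cube_factor subn1; congr (_ - _).
case: (_ == _).
  rewrite -[ext (head_tens _) x]linear_ext_id; apply: eq_spanned_comp gx.
  by move=> -[//|[//|y b] r] _; rewrite linear_ext_id linear_extU.
rewrite -[ext (head_merge _) x]linear_ext_id; apply: eq_spanned_comp gx.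
by move=> -[//|[//|y b] r] _; rewrite linear_ext_id linear_extU.
Qed.

(** [cube] is the product of the operators 1 - d_i: all of them but the
    one on the first bar act on the tail, by [cube_factor_head_bar]. *)
Lemma cube_foldr tg u w :
  foldr (cube_factor tg (size w)) << [:: u :: w] >> (iota 1 (size w)) = cube tg (u :: w).
Proof.
elim: w u => [//|x w IH] u.
pose G t := ext (@head_bar _ S u) t - (if odd (size w) == tg
  then ext (@head_tens _ S u) t else ext (@head_merge _ S u) t).
have all0 : all (fun i => 0 < i)%N (iota 1 (size w)).
  by apply/allP => i; rewrite mem_iota => /andP[].
have g0 : spanned (@headed _ S) (<< [:: x :: w] >> : {malg K[_]}) by apply: spannedU.
have [g e] := foldr_cube_factor_head_bar tg (size w) u all0 g0; rewrite linear_extU in e.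
apply: etrans _ (congr1 G (IH x)); apply: etrans _ (cube_factor1 tg (size (x :: w)) u g).
rewrite -[iota 1 (size (x :: w))]/(1%N :: iota (1 + 1) (size w)) iotaDl.
exact: (congr1 (cube_factor tg (size w).+1 1) e).
Qed.

Lemma alternating_cube (V : lmodType K) (G : word B -> V) tg n (z : n.+2.-tuple B) :
  \sum_(I : {set 'I_n.+1} | I != finset.set0) (-1) ^+ #|I|.+1 *:
    ext G (foldr (fun i : 'I_n.+1 => ext (dbar lmul (odd (n.+1 - i.+1) == tg) i.+1))
      << [:: (z : seq B)] >> (enum I))
  = G [:: (z : seq B)] - ext G (cube tg z).
Proof.
pose f (i : 'I_n.+1) := linear_ext (dbar lmul (odd (n.+1 - i.+1) == tg) i.+1).
have f_lin i c x y : f i (c *: x + y) = c *: f i x + f i y by apply: linear_extP.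
have e := alternating_foldr_proper f_lin << [:: (z : seq B)] >>.
have := congr1 (linear_ext G) e.
rewrite linear_extB linear_extU => eG.
have cz (s : seq B) : size s = n.+2 ->
    foldr (fun i y => y - f i y) << [:: s] >> (enum 'I_n.+1) = cube tg s.
  case: s => // u w [sw]; rewrite -cube_foldr sw.
  rewrite -[1%N]/(1 + 0)%N iotaDl -val_enum_ord -map_comp.
  by elim: (enum _) => [//|i s IHs]; apply: (congr1 (fun t => t - f i t) IHs).
rewrite -(cz z) ?size_tuple // -eG; symmetry.
elim/big_rec2: _ => [|J y1 y2 _ <-]; first exact: linear_ext0.
exact: linear_extP.
Qed.

End CubeFold.

(** * Compositions in a globular algebra *)

Section Codim.
Variables (K : fieldType) (A : globular_algebra K).

Lemma tgt_codim_lin j n c (a b : A n) :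
  tgt_codim j (c *: a + b) = c *: tgt_codim j a + tgt_codim j b.
Proof. by elim: j n a b => [|j IH] [|n] a b //=; rewrite linearP IH linearP. Qed.

Lemma src_codim_lin j n c (a b : A n) :
  src_codim j (c *: a + b) = c *: src_codim j a + src_codim j b.
Proof. by elim: j n a b => [|j IH] [|n] a b //=; rewrite linearP IH linearP. Qed.

Lemma tgt_codimD j n (a b : A n) : tgt_codim j (a + b) = tgt_codim j a + tgt_codim j b.
Proof. by have := tgt_codim_lin j 1 a b; rewrite !scale1r. Qed.
Lemma src_codimD j n (a b : A n) : src_codim j (a + b) = src_codim j a + src_codim j b.
Proof. by have := src_codim_lin j 1 a b; rewrite !scale1r. Qed.
Lemma tgt_codim0 j n : tgt_codim j (0 : A n) = 0.
Proof. by have := tgt_codim_lin j (-1) (0 : A n) 0; rewrite scaler0 addr0 scaleN1r addNr. Qed.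
Lemma src_codim0 j n : src_codim j (0 : A n) = 0.
Proof. by have := src_codim_lin j (-1) (0 : A n) 0; rewrite scaler0 addr0 scaleN1r addNr. Qed.
Lemma tgt_codimZ j n c (a : A n) : tgt_codim j (c *: a) = c *: tgt_codim j a.
Proof. by have := tgt_codim_lin j c a 0; rewrite tgt_codim0 !addr0. Qed.
Lemma src_codimZ j n c (a : A n) : src_codim j (c *: a) = c *: src_codim j a.
Proof. by have := src_codim_lin j c a 0; rewrite src_codim0 !addr0. Qed.
Lemma tgt_codimB j n (a b : A n) : tgt_codim j (a - b) = tgt_codim j a - tgt_codim j b.
Proof. by rewrite tgt_codimD -!scaleN1r tgt_codimZ. Qed.
Lemma src_codimB j n (a b : A n) : src_codim j (a - b) = src_codim j a - src_codim j b.
Proof. by rewrite src_codimD -!scaleN1r src_codimZ. Qed.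

Lemma tgt_codimM j n (a b : A n) : tgt_codim j (a * b) = tgt_codim j a * tgt_codim j b.
Proof. by elim: j n a b => [|j IH] [|n] a b //=; rewrite rmorphM IH rmorphM. Qed.
Lemma tgt_codim1 j n : tgt_codim j (1 : A n) = 1.
Proof. by elim: j n => [|j IH] [|n] //=; rewrite rmorph1 IH rmorph1. Qed.

Lemma tgt_codim_tgt j l n (a : A n) : (j <= l)%N ->
  tgt_codim j (tgt_codim l a) = tgt_codim l a.
Proof. by elim: j l n a => [|j IH] [|l] [|n] a //= jl; rewrite tgt_idc IH. Qed.

Lemma tgt_codim_src j l n (a : A n) : (j <= l)%N ->
  tgt_codim j (src_codim l a) = src_codim l a.
Proof. by elim: j l n a => [|j IH] [|l] [|n] a //= jl; rewrite tgt_idc IH. Qed.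

Lemma src_codim_tgt j l n (a : A n) : (j <= l)%N ->
  src_codim j (tgt_codim l a) = tgt_codim l a.
Proof. by elim: j l n a => [|j IH] [|l] [|n] a //= jl; rewrite src_idc IH. Qed.

Lemma tgt_codim_tgt_le j l n (a : A n) : (j <= l)%N ->
  tgt_codim l (tgt_codim j a) = tgt_codim l a.
Proof. by elim: j l n a => [|j IH] [|l] [|n] a //= jl; rewrite tgt_idc IH. Qed.

Lemma exchange_zmod (V : zmodType) (a x b y c z d w : V) :
  a - x + b - y + (c - z + d) = a - w + c - (x - w + z) + (b - y + d).
Proof.
rewrite opprD opprB [a - w + c]addrAC !addrA subrK; congr (_ + _).
by rewrite [a + c - x]addrAC [_ + c]addrAC [_ + b + c]addrAC [_ - y - z]addrAC [_ + b - z]addrAC.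
Qed.

(** The linear composition forced by the axioms. *)
Definition comp_sub (j n : nat) (a b : A n) : A n := a - tgt_codim j a + b.

Lemma comp_mul_ring (R : pzRingType) (a b c d m p : R) :
  (a - m) * (d - p) = 0 -> (b - m) * (c - p) = 0 ->
  a * c - m * p + b * d = (a - m + b) * (c - p + d).
Proof.
move=> e1 e2.
have f1 : a * (d - p) = m * (d - p).
  by apply/eqP; rewrite -subr_eq0 -mulrBl e1.
have f2 : (b - m) * c = (b - m) * p.
  by apply/eqP; rewrite -subr_eq0 -mulrBr e2.
have -> : a - m + b = a + (b - m) by rewrite addrAC addrA.
have -> : c - p + d = c + (d - p) by rewrite addrAC addrA.
rewrite [RHS]mulrDl [a * (_ + _)]mulrDr [(b - m) * (_ + _)]mulrDr f1 f2.
have g : m * (d - p) + (b - m) * (d - p) = b * (d - p) by rewrite -mulrDl addrC subrK.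
rewrite -!addrA; congr (_ + _); rewrite addrCA g mulrBl mulrBr.
by rewrite [_ - m * p]addrC [_ - b * p]addrC addrA addrK.
Qed.

(** The exchange condition, which makes the compositions multiplicative. *)
Hypothesis peiffer : forall j n (a b : A n), (0 < j <= n)%N ->
  tgt_codim j a = 0 -> src_codim j b = 0 -> a * b = 0 /\ b * a = 0.

Lemma composable_tgt_src j n (a b : A n.+1) : composable j.+1 a b ->
  tgt_codim j (tgt a) = src_codim j (src b).
Proof. by case=> _ _ /= /(congr1 src); rewrite !src_idc. Qed.

Definition inf_of_globular : inf_algebra K.
Proof.
refine (@InfAlgebra K A comp_sub _ _ _ _ _ _ _ _ _ _ _ _ _).
- move=> n a b /composable_tgt_src /= e.
  by rewrite /comp_sub linearD linearB /= src_idc e subrK.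
- move=> n a b /composable_tgt_src /= e.
  by rewrite /comp_sub linearD linearB /= tgt_idc subrr add0r.
- move=> j [|n] a b [_ jn _] //; rewrite /comp_sub linearD linearB /= src_idc.
  by rewrite tgt_glob.
- by move=> j [|n] a b [_ jn _] //; rewrite /comp_sub linearD linearB /= tgt_idc.
- by move=> j n a b _; rewrite /comp_sub linearD linearB /= tgt_idc.
- by move=> j n a _; rewrite /comp_sub tgt_codim_src // subrr add0r.
- by move=> j n a _; rewrite /comp_sub subrK.
- move=> j n a b c _ _; rewrite /comp_sub !(tgt_codimB, tgt_codimD) tgt_codim_tgt //.
  by rewrite subrr add0r !addrA.
- move=> j l n a b c d jl _ _ _; have jl' := ltnW jl.
  rewrite /comp_sub !(tgt_codimB, tgt_codimD) (tgt_codim_tgt_le _ jl') (tgt_codim_tgt _ jl').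
  rewrite subrr add0r; exact: exchange_zmod.
- move=> j n a b c d _ _; rewrite /comp_sub tgt_codimD opprD.
  by rewrite (addrACA a c) (addrACA (a - tgt_codim j a)).
- by move=> j n k a b _; rewrite /comp_sub tgt_codimZ -scalerBr -scalerDr.
- by move=> j n _; rewrite /comp_sub tgt_codim1 subrr add0r.
- move=> j n a b c d [j0 jn ab] [_ _ cd]; rewrite /comp_sub tgt_codimM.
  have jjn : (0 < j <= n)%N by rewrite j0.
  apply: comp_mul_ring.
    by have [] := @peiffer j n (a - tgt_codim j a) (d - tgt_codim j c) jjn; 
      rewrite ?tgt_codimB ?src_codimB ?tgt_codim_tgt ?src_codim_tgt ?subrr // cd subrr.
  by have [] := @peiffer j n (c - tgt_codim j c) (b - tgt_codim j a) jjn;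
    rewrite ?tgt_codimB ?src_codimB ?tgt_codim_tgt ?src_codim_tgt ?subrr // ab subrr.
Defined.

End Codim.

(** * The algebras of cells *)

Section CellAlgebra.
Variables (K : fieldType) (S : based_algebra K).
Local Notation bar := (bar S).
Local Notation T := (word_algebra S).

Definition table : Type := (T * T * bar)%type.
HB.instance Definition _ := GRing.Lmodule.on table.

Definition table_mul (x y : table) : table :=
  (x.1.1 * y.1.1, x.1.2 * y.1.2, lact (proj x.1.1) y.2 + ract (proj y.1.1) x.2).
Definition table_one : table := (1, 1, 0).

Lemma table_eq (x y : table) : x.1.1 = y.1.1 -> x.1.2 = y.1.2 -> x.2 = y.2 -> x = y.
Proof. by case: x => [[? ?] ?]; case: y => [[? ?] ?] /= -> -> ->. Qed.

Lemma table_mulA : associative table_mul.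
Proof.
move=> x y z; apply: table_eq; rewrite /= ?mulrA //.
by rewrite !projM lactM ractM !linearD /= lact_ract addrA.
Qed.
Lemma table_mul1 : left_id table_one table_mul.
Proof. by move=> x; apply: table_eq; rewrite /= ?mul1r // proj1 lact1 linear0 addr0. Qed.
Lemma table_mulr1 : right_id table_one table_mul.
Proof. by move=> x; apply: table_eq; rewrite /= ?mulr1 // proj1 ract1 linear0 add0r. Qed.
Lemma table_mulDl : left_distributive table_mul +%R.
Proof.
move=> x y z; apply: table_eq; rewrite /= ?mulrDl //.
by rewrite !linearD /= lactD addrACA.
Qed.
Lemma table_mulDr : right_distributive table_mul +%R.
Proof.
move=> x y z; apply: table_eq; rewrite /= ?mulrDr //.
by rewrite !linearD /= ractD addrACA.
Qed.
Lemma table_one_neq0 : table_one != 0.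
Proof. by apply/eqP => -[/eqP]; rewrite oner_eq0. Qed.

HB.instance Definition _ :=
  GRing.Zmodule_isNzRing.Build table table_mulA table_mul1 table_mulr1 table_mulDl table_mulDr table_one_neq0.

Lemma table_scaleAl (k : K) (x y : table) : k *: (x * y) = (k *: x) * y.
Proof.
apply: table_eq; rewrite /= ?scalerAl //.
by rewrite !linearZ /= lactZ scalerDr.
Qed.
HB.instance Definition _ := GRing.Lmodule_isLalgebra.Build K table table_scaleAl.

Lemma table_scaleAr (k : K) (x y : table) : k *: (x * y) = x * (k *: y).
Proof.
apply: table_eq; rewrite /= ?scalerAr //.
by rewrite !linearZ /= ractZ scalerDr.
Qed.
HB.instance Definition _ := GRing.Lalgebra_isAlgebra.Build K table table_scaleAr.

(** Triples (s, t, y): s and t are the 0-source and 0-target and y the chain.  In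
    dimension 0, s = t and the chain is the derivation of s; in general, its part
    of degree 2 connects the derivations of s and t, and the part of degree 0
    vanishes because it vanishes in derivations. *)
Definition is_cell (n : nat) (x : table) : bool :=
  [&& degs (fun i => i <= n.+1)%N x.2 == x.2,
      degs (fun i => i <= 1)%N x.2 == der x.1.1,
      der x.1.2 == der x.1.1 + bdry (degs (pred1 2) x.2),
      proj x.1.1 == proj x.1.2 & (n == 0)%N ==> (x.1.1 == x.1.2)].

Lemma is_cellP n x : reflect
  [/\ degs (fun i => i <= n.+1)%N x.2 = x.2,
      degs (fun i => i <= 1)%N x.2 = der x.1.1,
      der x.1.2 = der x.1.1 + bdry (degs (pred1 2) x.2),
      proj x.1.1 = proj x.1.2 & (n == 0)%N -> x.1.1 = x.1.2] (is_cell n x).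
Proof.
apply: (iffP and5P) => [[/eqP e1 /eqP e2 /eqP e3 /eqP e4 /implyP e5]|[-> -> -> -> e5]].
  by split=> // n0; apply/eqP/e5.
by rewrite !eqxx; split=> //; apply/implyP => /e5 ->.
Qed.

Lemma is_cell_subalg n : GRing.subsemialg_closed (is_cell n).
Proof.
apply: GRing.subalg_closed_semi; split.
- by apply/is_cellP; rewrite /= !linear0 der1 addr0.
- move=> k x y /is_cellP[x1 x2 x3 x4 x5] /is_cellP[y1 y2 y3 y4 y5].
  apply/is_cellP; rewrite /= !linearP /= x1 x2 x3 x4 y1 y2 y3 y4; split=> //.
    by rewrite !scalerDr addrACA.
  by move=> n0; rewrite x5 ?y5.
- move=> x y /is_cellP[x1 x2 x3 x4 x5] /is_cellP[y1 y2 y3 y4 y5].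
  apply/is_cellP; rewrite /= !projM !derM !linearD /= !degs_lact !degs_ract.
  rewrite x1 x2 x3 y1 y2 y3 -x4 -y4; split=> //.
    by rewrite !linearD /= bdry_lact bdry_ract addrACA.
  by move=> n0; rewrite x5 ?y5.
Qed.

HB.instance Definition _ n :=
  GRing.isSubalgClosed.Build K table (is_cell n) (is_cell_subalg n).

Record cell_of (n : nat) := CellOf { cell_val :> table; cell_valP : is_cell n cell_val }.
HB.instance Definition _ n := [isSub for @cell_val n].
HB.instance Definition _ n := [Choice of cell_of n by <:].
HB.instance Definition _ n := [SubChoice_isSubAlgebra of cell_of n by <:].

Section Boundaries.
Variable n : nat.

Definition table_src (x : table) : table :=
  (x.1.1, if n is 0 then x.1.1 else x.1.2, degs (fun i => i <= n.+1)%N x.2).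
Definition table_tgt (x : table) : table :=
  (if n is 0 then x.1.2 else x.1.1, x.1.2,
   degs (fun i => i <= n.+1)%N x.2 + bdry (degs (pred1 n.+2) x.2)).

Lemma table_src_lin k x y : table_src (k *: x + y) = k *: table_src x + table_src y.
Proof. by apply: table_eq; rewrite /= ?linearP //; case: n. Qed.
Lemma table_tgt_lin k x y : table_tgt (k *: x + y) = k *: table_tgt x + table_tgt y.
Proof.
apply: table_eq; rewrite /= ?linearP //; first by case: n.
by rewrite scalerDr addrACA.
Qed.

Lemma table_srcM x y : table_src (x * y) = table_src x * table_src y.
Proof.
apply: table_eq; rewrite //=; first by case: n.
by rewrite !linearD /= degs_lact degs_ract.
Qed.

Lemma table_tgtM x y : is_cell n.+1 x -> is_cell n.+1 y -> table_tgt (x * y) = table_tgt x * table_tgt y.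
Proof.
move=> /is_cellP[_ _ _ x4 _] /is_cellP[_ _ _ y4 _].
apply: table_eq; rewrite //=; first by case: n.
have -> : proj (if n is 0 then x.1.2 else x.1.1) = proj x.1.1 by case: n.
have -> : proj (if n is 0 then y.1.2 else y.1.1) = proj y.1.1 by case: n.
rewrite !linearD /= !degs_lact !degs_ract bdry_lact bdry_ract.
by rewrite addrACA.
Qed.

Lemma degs_id (p q : pred nat) (y : bar) : (forall i, q i -> p i) ->
  degs q y = y -> degs p y = y.
Proof.
move=> qp qy; rewrite -qy degsI; apply: eq_degs => i /=.
by case qi: (q i); rewrite ?andbF // qp.
Qed.

Lemma table_src_cell x : is_cell n.+1 x -> is_cell n (table_src x).
Proof.
case/is_cellP=> x1 x2 x3 x4 _; apply/is_cellP => /=; split.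
- by rewrite degsI; apply: eq_degs => i /=; rewrite andbb.
- rewrite degsI -x2; apply: eq_degs => i /=; case i1 : (i <= 1)%N => //=.
  by rewrite (leq_trans i1).
- rewrite degsI; case: n => [|m].
    rewrite (eq_degs (q := pred0)) ?degs_pred0 ?linear0 ?addr0 //.
    by move=> i /=; case: eqP => // ->.
  by rewrite x3; congr (_ + bdry _); apply: eq_degs => i /=; case: eqP => // ->.
- by case: n.
- by case: n.
Qed.

Lemma table_tgt_cell x : is_cell n.+1 x -> is_cell n (table_tgt x).
Proof.
case/is_cellP=> x1 x2 x3 x4 _; apply/is_cellP => /=.
have e0 (p : pred nat) : ~~ p n.+1 -> degs p (bdry (degs (pred1 n.+2) x.2)) = 0.
  move=> pn; rewrite degs_bdry degsI (eq_degs (q := pred0)) ?degs_pred0 ?linear0 //.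
  by move=> i /=; case: eqP => [->|]; rewrite ?andbF //= (negbTE pn).
have e1 (p : pred nat) : p n.+1 -> degs p (bdry (degs (pred1 n.+2) x.2)) =
    bdry (degs (pred1 n.+2) x.2).
  move=> pn; rewrite degs_bdry degsI; congr (bdry _); apply: eq_degs => i /=.
  by case: eqP => [->|]; rewrite ?andbF //= pn.
split.
- rewrite linearD /= e1 // degsI; congr (_ + _).
  by apply: eq_degs => i /=; rewrite andbb.
- have c1 : degs (fun i => i <= 1)%N (degs (fun i => i <= n.+1)%N x.2) = der x.1.1.
    rewrite degsI -x2; apply: eq_degs => i /=; case i1 : (i <= 1)%N => //=.
    by rewrite (leq_trans i1).
  rewrite linearD /= c1; case: n e0 e1 => [|m] e0 e1; last by rewrite e0 // addr0.
  by rewrite e1.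
- case: n e0 e1 x3 => [|m] e0 e1 x3 /=.
    rewrite linearD /= e0 // addr0 degsI (eq_degs (q := pred0)) ?degs_pred0.
      by rewrite linear0 addr0.
    by move=> i /=; case: eqP => // ->.
  rewrite x3 linearD linearD /=.
  have -> : bdry (degs (pred1 2) (bdry (degs (pred1 m.+3) x.2))) = 0.
    by rewrite degs_bdry bdryK.
  rewrite addr0 degsI; congr (_ + bdry _).
  by apply: eq_degs => i /=; case: eqP => // ->.
- by case: n.
- by case: n.
Qed.

Definition cell_src (x : cell_of n.+1) : cell_of n := CellOf (table_src_cell (cell_valP x)).
Definition cell_tgt (x : cell_of n.+1) : cell_of n := CellOf (table_tgt_cell (cell_valP x)).

Lemma cell_src_linear : linear cell_src.
Proof. by move=> k x y; apply: val_inj; apply: table_src_lin. Qed.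
Lemma cell_tgt_linear : linear cell_tgt.
Proof. by move=> k x y; apply: val_inj; apply: table_tgt_lin. Qed.
Lemma cell_src_mult : monoid_morphism cell_src.
Proof.
split=> [|x y]; apply: val_inj; last exact: table_srcM.
by apply: table_eq; rewrite //= ?linear0 //; case: n.
Qed.
Lemma cell_tgt_mult : monoid_morphism cell_tgt.
Proof.
split=> [|x y]; apply: val_inj; last by apply: table_tgtM; apply: cell_valP.
by apply: table_eq; rewrite //= ?linear0 ?addr0 //; case: n.
Qed.

HB.instance Definition _ := GRing.isLinear.Build K (cell_of n.+1) (cell_of n) *:%R cell_src cell_src_linear.
HB.instance Definition _ := GRing.isLinear.Build K (cell_of n.+1) (cell_of n) *:%R cell_tgt cell_tgt_linear.
HB.instance Definition _ := GRing.isMonoidMorphism.Build (cell_of n.+1) (cell_of n) cell_src cell_src_mult.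
HB.instance Definition _ := GRing.isMonoidMorphism.Build (cell_of n.+1) (cell_of n) cell_tgt cell_tgt_mult.

End Boundaries.
End CellAlgebra.

Section Globular.
Variables (K : fieldType) (S : based_algebra K).
Local Notation A := (base_alg S).
Local Notation B := (letter S).
Local Notation bar := (bar S).
Local Notation table := (table S).
Local Notation lmul := (@lmul K S).
Local Notation ext f := (linear_ext f).

Lemma is_cellW n x : @is_cell K S n x -> @is_cell K S n.+1 x.
Proof.
case/is_cellP=> x1 x2 x3 x4 x5; apply/is_cellP; split=> //.
by apply: degs_id x1 => i; apply: leqW.
Qed.

Definition cell_idc n (x : cell_of S n) : cell_of S n.+1 := CellOf (is_cellW (cell_valP x)).
Lemma cell_idc_linear n : linear (@cell_idc n).
Proof. by move=> k x y; apply: val_inj. Qed.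
Lemma cell_idc_mult n : monoid_morphism (@cell_idc n).
Proof. by split=> [|x y]; apply: val_inj. Qed.
HB.instance Definition _ n := GRing.isLinear.Build K (cell_of S n) (cell_of S n.+1) *:%R (@cell_idc n) (@cell_idc_linear n).
HB.instance Definition _ n := GRing.isMonoidMorphism.Build (cell_of S n) (cell_of S n.+1) (@cell_idc n) (@cell_idc_mult n).

Lemma degs_sub (p q : pred nat) (y : bar) : (forall i, p i -> q i) ->
  degs p (degs q y) = degs p y.
Proof.
move=> pq; rewrite degsI; apply: eq_degs => i /=.
by case pi : (p i); rewrite //= pq.
Qed.

Lemma degs_disj (p q : pred nat) (y : bar) : (forall i, p i -> ~~ q i) ->
  degs p (degs q y) = 0.
Proof.
move=> pq; rewrite degsI (eq_degs (q := pred0)) ?degs_pred0 // => i /=.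
by case pi : (p i); rewrite //= (negbTE (pq _ pi)).
Qed.

Lemma degs_bdry_top p n (y : bar) : ~~ p n -> degs p (bdry (degs (pred1 n.+1) y)) = 0.
Proof.
move=> pn; rewrite degs_bdry degs_disj ?linear0 // => i /= pi.
by apply/eqP => ei; rewrite ei (negbTE pn) in pi.
Qed.

Lemma cell_src_glob n (a : cell_of S n.+2) : cell_src (cell_src a) = cell_src (cell_tgt a).
Proof.
apply: val_inj; apply: table_eq => //=.
rewrite linearD /= degs_bdry_top ?addr0 //.
by rewrite ltnn.
Qed.

Lemma cell_tgt_glob n (a : cell_of S n.+2) : cell_tgt (cell_src a) = cell_tgt (cell_tgt a).
Proof.
apply: val_inj; apply: table_eq => //=.
rewrite !linearD /= degs_bdry_top ?ltnn // addr0 !(@degs_sub (pred1 n.+2)).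
- by rewrite degs_bdry bdryK addr0.
all: by move=> i /= /eqP->.
Qed.

Lemma cell_src_idc n (a : cell_of S n) : cell_src (cell_idc a) = a.
Proof.
apply: val_inj; case/is_cellP: (cell_valP a) => a1 _ _ _ a5.
by apply: table_eq => //=; case: n a a1 a5 => //= a a1 a5; apply: a5.
Qed.

Lemma cell_tgt_idc n (a : cell_of S n) : cell_tgt (cell_idc a) = a.
Proof.
apply: val_inj; case/is_cellP: (cell_valP a) => a1 _ _ _ a5.
apply: table_eq => //=; first by case: n a a1 a5 => //= a a1 a5; rewrite a5.
rewrite a1 -a1 degs_disj ?linear0 ?addr0 // => i /= /eqP->; by rewrite ltnn.
Qed.

Definition cells : globular_algebra K :=
  @GlobularAlgebra K (fun n => cell_of S n)
    (fun n => @cell_src K S n : {lrmorphism cell_of S n.+1 -> cell_of S n})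
    (fun n => @cell_tgt K S n : {lrmorphism cell_of S n.+1 -> cell_of S n})
    (fun n => @cell_idc n : {lrmorphism cell_of S n -> cell_of S n.+1})
    cell_src_glob cell_tgt_glob cell_src_idc cell_tgt_idc.

Lemma src_codim_val j n (a : cells n) : (val (src_codim j a)).1.1 = (val a).1.1.
Proof. by elim: j n a => [|j IH] [|n] a //; apply: etrans (IH _ _) _. Qed.
Lemma tgt_codim_val j n (a : cells n) : (val (tgt_codim j a)).1.2 = (val a).1.2.
Proof. by elim: j n a => [|j IH] [|n] a //; apply: etrans (IH _ _) _. Qed.

(** The product of chains only involves the images in A of the 0-sources, which
    are also those of the 0-targets; they vanish for both factors. *)
Lemma mul_cells0 n (a b : cell_of S n) : (val a).1.2 = 0 -> (val b).1.1 = 0 ->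
  a * b = 0 /\ b * a = 0.
Proof.
move=> a0 b0; case/is_cellP: (cell_valP a) => _ _ _ a4 _.
case/is_cellP: (cell_valP b) => _ _ _ b4 _.
have pa : proj (cell_val a).1.1 = 0 by rewrite a4 a0 linear0.
have pb : proj (cell_val b).1.1 = 0 by rewrite b0 linear0.
split; apply: val_inj; apply: table_eq;
  by rewrite /= ?pa ?pb ?lact0 ?ract0 ?addr0 // ?a0 ?b0 ?mulr0 ?mul0r.
Qed.

Lemma cells_peiffer j n (a b : cells n) : (0 < j <= n)%N ->
  tgt_codim j a = 0 -> src_codim j b = 0 -> a * b = 0 /\ b * a = 0.
Proof.
move=> _ /(congr1 val) ta /(congr1 val) sb; apply: mul_cells0.
  by rewrite -(tgt_codim_val j) ta.
by rewrite -(src_codim_val j) sb.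
Qed.

Definition cells_inf : inf_algebra K := inf_of_globular cells_peiffer.

(** * The generating cells and their boundaries *)

Definition block_table (z : seq B) : table := (mon z, as_letters (word_value z), block_chain z).
Definition word_table (w : word B) : table := \prod_(b <- w) block_table b.

Lemma word_tableE w : word_table w = (words_src w, words_tgt w, word_chain w).
Proof.
elim: w => [|b r IH]; first by rewrite /word_table big_nil /words_src mon1 /words_tgt big_nil.
rewrite /word_table big_cons -/(word_table r) IH; apply: table_eq => /=.
- exact: monD.
- by rewrite words_tgt_cons.
- by rewrite !proj_mon addrC.
Qed.

Lemma ext_word_table x : ext word_table x = (ext (@words_src _ S) x, ext (@words_tgt _ S) x, ext (@word_chain _ S) x).
Proof.
elim/malg_ind: x => [|c k x IH]; first by rewrite !linear_ext0.
by rewrite !linear_extS IH word_tableE.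
Qed.

Definition small (n : nat) (w : word B) : Prop := all (fun b => 0 < size b <= n)%N w.

Lemma small_dbar_head n tens i b (r : word B) : (0 < i < size b)%N ->
  (size b <= n.+1)%N -> small n r -> spanned (small n) (dbar lmul tens i (b :: r)).
Proof.
move=> /andP[i0 ib] bn sr /=; rewrite ib; case: tens.
  apply: spannedU; rewrite /small /= sr andbT size_take size_drop ib i0 subn_gt0 ib /=.
  rewrite -ltnS (leq_trans ib bn) leq_subLR (leq_trans bn) //.
  by rewrite -add1n leq_add2r.
case db : (drop i.-1 b) => [|x [|y c]]; try exact: spanned0.
apply: (spanned_lin (S := fun _ => True)) (spanned_true _) => v _; apply: spannedU.
rewrite /small /= sr andbT size_cat /= addnS /= -ltnS.
by apply: leq_trans bn; rewrite -[in leqRHS](cat_take_drop i.-1 b) db size_cat /= !addnS.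
Qed.

Lemma small_dbar n tens i w : (0 < i)%N -> small n w -> spanned (small n) (dbar lmul tens i w).
Proof.
move=> i0; elim: w i i0 => [|b r IH] i i0; first by move=> _; apply: spanned0.
case/andP=> /andP[b0 bn] sr.
case ib : (i < size b)%N.
  by apply: small_dbar_head => //; [rewrite i0 ib | apply: leqW].
rewrite /= ib; apply: spanned_lin (IH (i - (size b).-1)%N _ sr); last first.
  by rewrite subn_gt0 -ltnS prednK // ltnS leqNgt ib.
by move=> k sk; apply: spannedU; rewrite /small /= b0 bn.
Qed.

(** The term of the source or of the target indexed by a set of bars. *)
Definition bars_face tg n (z : seq B) (I : {set 'I_n.+1}) :=
  foldr (fun i : 'I_n.+1 => ext (dbar lmul (odd (n.+1 - i.+1) == tg) i.+1))
      << [:: z] >> (enum I).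

Lemma small_bars_face tg n (z : seq B) (I : {set 'I_n.+1}) : size z = n.+2 ->
  I != finset.set0 -> spanned (small n.+1) (bars_face tg z I).
Proof.
move=> sz; rewrite -card_gt0 cardE /bars_face.
elim: (enum I) => [//|i s IH] _ /=.
case: s IH => [_|j s IH].
  rewrite /= linear_extU; by apply: small_dbar_head; rewrite ?sz //=; exact: (ltn_ord i).
by apply: spanned_lin (IH isT) => w; apply: small_dbar.
Qed.

Definition std_table tg n (z : seq B) : table :=
  \sum_(I : {set 'I_n.+1} | I != finset.set0) (-1) ^+ #|I|.+1 *: ext word_table (bars_face tg z I).

Lemma std_tableE tg n (z : seq B) : size z = n.+2 ->
  std_table tg n z = block_table z - (ext (@words_src _ S) (cube tg z), ext (@words_tgt _ S) (cube tg z),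
                          ext (@word_chain _ S) (cube tg z)).
Proof.
move=> sz; have sz' : size z == n.+2 by rewrite sz.
have := alternating_cube word_table tg (Tuple sz'); rewrite /= -/(std_table tg n z) => ->.
by rewrite ext_word_table /word_table big_seq1.
Qed.

Lemma is_cell_lin n k x y : @is_cell K S n x -> is_cell n y -> is_cell n (k *: x + y).
Proof.
by have [_ [_ cD] cZ _] := is_cell_subalg S n => cx cy; apply: cD => //; apply: cZ.
Qed.
Lemma is_cell0 n : @is_cell K S n 0.
Proof. by have [_ [] ] := is_cell_subalg S n. Qed.
Lemma is_cell1 n : @is_cell K S n 1.
Proof. by have [] := is_cell_subalg S n. Qed.
Lemma is_cellM n x y : @is_cell K S n x -> is_cell n y -> is_cell n (x * y).
Proof. by have [_ _ _ cM] := is_cell_subalg S n; apply: cM. Qed.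

Lemma ext_cell n P (f : word B -> table) x :
  (forall w, P w -> is_cell n (f w)) -> spanned P x -> is_cell n (ext f x).
Proof.
move=> Pf; elim=> [|c w {}x Pw _ IH]; first by rewrite linear_ext0; apply: is_cell0.
by rewrite linear_extS; apply: is_cell_lin => //; apply: Pf.
Qed.

Lemma word_table_cell n w : small n.+1 w -> (forall b, (0 < size b <= n.+1)%N -> is_cell n (block_table b)) ->
  is_cell n (word_table w).
Proof.
move=> sw H; rewrite /word_table; elim: w sw => [|b r IH]; first by move=> _; rewrite big_nil; apply: is_cell1.
by case/andP=> sb /IH sr; rewrite big_cons; apply: is_cellM => //; apply: H.
Qed.

Lemma std_table_cell tg n (z : seq B) : size z = n.+2 ->
  (forall b, (0 < size b <= n.+1)%N -> is_cell n (block_table b)) -> is_cell n (std_table tg n z).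
Proof.
move=> sz H; rewrite /std_table; elim/big_rec: _ => [|I y I0 cy]; first exact: is_cell0.
apply: is_cell_lin cy.
by apply: ext_cell (small_bars_face tg sz I0) => w sw; apply: word_table_cell.
Qed.

Lemma is_cell_le m n x : (m <= n)%N -> @is_cell K S m x -> is_cell n x.
Proof. by move=> /subnKC <-; elim: (n - m)%N => [|k IH]; rewrite ?addn0 // addnS => /IH/is_cellW. Qed.

(** The alternating product leaves nothing but [z] in the source formula.  This
    also drives the induction showing that generators are cells: the source is a
    combination of products of generators of smaller dimension. *)
Lemma block_table_std_table n (z : seq B) : size z = n.+3 ->
  block_table z = std_table false n.+1 z + (0, 0, brk 1 z 1).
Proof.
move=> sz; rewrite std_tableE //.
case: z sz => [//|u [//|x [//|y w]]] sz.
by rewrite words_src_cube_src words_tgt_cube_src word_chain_cube_src // subrK.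
Qed.

Lemma der_as_letters (a : A) : aug a = 0 -> der (as_letters a) = homotopy (brk a [::] 1).
Proof.
elim/aug_ind => [|c v {}a IH]; first by rewrite brk0l !linear0.
rewrite linearP /= linearP /= IH brk_linl linearP /= as_letters_letter der_mon /= homotopy_letter.
by rewrite linear0 add0r word_value0.
Qed.

Lemma block_chain1 u : block_chain [:: u] = brk (1 : A) [:: u] 1.
Proof. by rewrite /= /chain_step !linear0 !add0r homotopy_letter word_value0. Qed.

Lemma block_chain2 u x : block_chain [:: u; x] =
  brk (1 : A) [:: u; x] 1 + brk (ltr u) [:: x] 1 + brk 1 [:: u] (ltr x).
Proof.
rewrite -[block_chain _]/(chain_step (ltr u) (block_chain [:: x]) (word_value [:: x])) block_chain1 /chain_step att_bar1.
by rewrite att_alt_brk mulr1 word_value_cons word_value0 mulr1 homotopy_letter.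
Qed.

Lemma word_der1 u : word_der [:: u] = brk (1 : A) [:: u] 1.
Proof. by rewrite /= linear0 add0r word_value0. Qed.

Lemma word_der2 u x : word_der [:: u; x] = brk (ltr u) [:: x] 1 + brk (1 : A) [:: u] (ltr x).
Proof.
by rewrite -[word_der _]/(lact (ltr u) (word_der [:: x]) + brk 1 [:: u] (word_value [:: x])) word_der1 lact_brk mulr1 word_value_cons word_value0 mulr1.
Qed.

(** In degree 2, the boundary is the difference between the derivations of the
    product ux in A and of the word ux. *)
Lemma bdry2 u x : bdry (brk (1 : A) [:: u; x] 1) =
  homotopy (brk (ltr u * ltr x) [::] 1) - (brk (ltr u) [:: x] 1 + brk 1 [:: u] (ltr x)).
Proof.
rewrite bdry_brk1 bdry0_cons // expr1 scaleN1r /= !linearB /= !lact_brk mulr1 homotopy_letter.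
by rewrite opprD addrCA.
Qed.

Lemma block_table_cell n (z : seq B) : size z = n.+1 -> is_cell n (block_table z).
Proof.
elim/ltn_ind: n z => n IH z sz.
case: n IH sz => [|[|n]] IH sz.
- case: z sz => [//|u [|//]] _; rewrite /block_table block_chain1 word_value_cons word_value0 mulr1.
  apply/is_cellP => /=; rewrite projK proj_mon word_value_cons word_value0 mulr1 as_letters_letter.
  by rewrite der_mon word_der1 !degs_brk /= linear0 addr0; split.
- case: z sz => [//|u [//|x [|//]]] _; rewrite /block_table block_chain2 !word_value_cons word_value0 mulr1.
  apply/is_cellP => /=; rewrite projK proj_mon !word_value_cons word_value0 mulr1.
  rewrite der_as_letters ?aug_letterl // der_mon word_der2 !linearD /= !degs_brk /= add0r; split=> //.
  by rewrite !linear0 !addr0 bdry2 addrC subrK.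
- have c0 : is_cell n.+1 (std_table false n.+1 z).
    apply: std_table_cell => // b /andP[b0 bn].
    apply: (@is_cell_le (size b).-1); first by rewrite -ltnS prednK.
    by apply: IH; rewrite ?prednK.
  rewrite (block_table_std_table sz); case/is_cellP: c0 => e1 e2 e3 e4 _.
  apply/is_cellP => /=; rewrite !addr0 !linearD /= !degs_brk sz /= !addr0.
  split=> //; last by rewrite linear0 addr0.
  by rewrite ltnS leqnn (degs_id _ e1) // => i; apply: leqW.
Qed.

Definition gen_cell n (z : std_cells B n) : cell_of S n :=
  CellOf (block_table_cell (size_tuple z)).

Lemma block_table_top n (z : seq B) : size z = n.+3 ->
  degs (fun i => i <= n.+2)%N (block_chain z) = block_chain z - brk 1 z 1 /\
  degs (pred1 n.+3) (block_chain z) = brk 1 z 1.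
Proof.
move=> sz; have : is_cell n.+1 (std_table false n.+1 z).
  apply: std_table_cell => // b /andP[b0 bn]; apply: (@is_cell_le (size b).-1).
    by rewrite -ltnS prednK.
  by apply: block_table_cell; rewrite prednK.
move/is_cellP=> [e1 _ _ _ _]; have := congr1 snd (block_table_std_table sz) => /= ->.
rewrite !linearD /= !degs_brk sz /= ltnn eqxx addr0 addrK; split=> //.
by rewrite -e1 degs_disj ?add0r // => i /= /eqP->; rewrite ltnn.
Qed.

Lemma is_cell0_eq_src x y : @is_cell K S 0 x -> is_cell 0 y -> x.1.1 = y.1.1 -> x = y.
Proof.
move=> /is_cellP[x1 x2 _ _ x5] /is_cellP[y1 y2 _ _ y5] e.
by apply: table_eq => //; [rewrite -x5 // -y5 | rewrite -x1 -y1 x2 y2 e].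
Qed.

Lemma src_gen_cell n (z : std_cells B n.+1) : val (cell_src (gen_cell z)) = std_table false n z.
Proof.
have sz : size z = n.+2 := size_tuple z.
case: n z sz => [|n] z sz.
  apply: is_cell0_eq_src; first exact: cell_valP.
    apply: std_table_cell => // b /andP[b0 b1]; apply: block_table_cell.
    by case: (size b) b0 b1 => [|[]].
  rewrite std_tableE //=; case: (z : seq B) sz => [//|u [//|x w]] _.
  by rewrite words_src_cube_src subr0.
have [g1 _] := block_table_top sz.
change (table_src n.+1 (block_table z) = std_table false n.+1 z).
rewrite std_tableE //; move: (tval z) sz g1 => {}z; case: z => [//|u [//|x [//|y w]]] sz g1.
rewrite words_src_cube_src words_tgt_cube_src word_chain_cube_src //.
by apply: table_eq; rewrite /= ?subr0 // g1.
Qed.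

Lemma is_cell0_eq_tgt x y : @is_cell K S 0 x -> is_cell 0 y -> x.1.2 = y.1.2 -> x = y.
Proof.
move=> cx cy e; apply: is_cell0_eq_src => //.
by case/is_cellP: cx => _ _ _ _ x5; case/is_cellP: cy => _ _ _ _ y5; rewrite x5 // e y5.
Qed.

Lemma tgt_gen_cell n (z : std_cells B n.+1) : val (cell_tgt (gen_cell z)) = std_table true n z.
Proof.
have sz : size z = n.+2 := size_tuple z.
case: n z sz => [|n] z sz.
  apply: is_cell0_eq_tgt; first exact: cell_valP.
    apply: std_table_cell => // b /andP[b0 b1]; apply: block_table_cell.
    by case: (size b) b0 b1 => [|[]].
  rewrite std_tableE //=; case: (z : seq B) sz => [//|u [//|x w]] _.
  by rewrite words_tgt_cube_tgt subr0.
have [g1 g2] := block_table_top sz.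
change (table_tgt n.+1 (block_table z) = std_table true n.+1 z).
rewrite std_tableE //; move: (tval z) sz g1 g2 => {}z sz g1 g2.
have [-> -> ->] : [/\ ext (@words_src _ S) (cube true z) = 0, ext (@words_tgt _ S) (cube true z) = 0
    & ext (@word_chain _ S) (cube true z) = brk 1 z 1 - bdry0 z].
  case: z sz {g1 g2} => [//|u [//|x [//|y w]]] _.
  by split; [apply: words_src_cube_tgt | apply: words_tgt_cube_tgt | apply: word_chain_cube_tgt].
apply: table_eq; rewrite /= ?subr0 //.
by rewrite g1 g2 bdry_brk1 opprB addrA addrAC.
Qed.

End Globular.

(** * The free bimodule on the generators, and the kernel of its evaluation *)

Section FreeBimodule.
Variables (K : fieldType) (S : based_algebra K) (n : nat).
Local Notation A := (base_alg S).
Local Notation B := (letter S).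
Local Notation bar := (bar S).
Local Notation T := (word_algebra S).
Local Notation Z := (n.+2.-tuple B).

Definition fbim_basis : Type := (seq B * Z * seq B)%type.
HB.instance Definition _ := Choice.on fbim_basis.
Definition fbim : lmodType K := fl_sort (malg_free_lmod K fbim_basis).
Definition fbim_elt (u : seq B) (z : Z) (v : seq B) : fbim :=
  fl_elt (malg_free_lmod K fbim_basis) (u, z, v).

Section Ext.
Variables (V : lmodType K) (f : seq B -> Z -> seq B -> V).
Definition fbim_ext : {linear fbim -> V} :=
  fl_ext _ (fun k : fbim_basis => f k.1.1 k.1.2 k.2).
Lemma fbim_extE u z v : fbim_ext (fbim_elt u z v) = f u z v.
Proof. exact: fl_extE. Qed.
End Ext.

Lemma fbim_ind (P : fbim -> Prop) : P 0 ->
  (forall c u z v y, P y -> P (c *: fbim_elt u z v + y)) -> forall y, P y.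
Proof. by move=> P0 PS; elim/fl_ind => // c [[u z] v] y; apply: PS. Qed.

Definition tri (x : T) (z : Z) (y : T) : fbim :=
  fa_ext (malg_free_alg K B) (fun u => fa_ext (malg_free_alg K B) (fun v => fbim_elt u z v) y) x.

Lemma tri_mon u z v : tri (mon u) z (mon v) = fbim_elt u z v.
Proof. by rewrite /tri !fa_extE. Qed.

Lemma tri_linl z y k x x' : tri (k *: x + x') z y = k *: tri x z y + tri x' z y.
Proof. exact: linearP. Qed.

Lemma tri_linr z x k y y' : tri x z (k *: y + y') = k *: tri x z y + tri x z y'.
Proof.
elim/word_algebra_ind: x => [|c u x IH]; first by rewrite /tri !linear0 addr0.
rewrite !tri_linl IH !scalerDr addrACA !scalerA [k * c]mulrC -!scalerA -scalerDr.
by congr (_ *: _ + _); rewrite /tri !fa_extE linearP.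
Qed.

Lemma tri0l z y : tri 0 z y = 0.
Proof. exact: linear0. Qed.
Lemma tri0r z x : tri x z 0 = 0.
Proof. by have := tri_linr z x (-1) 0 0; rewrite scaler0 addr0 scaleN1r addNr. Qed.
Lemma tri_addl z y x x' : tri (x + x') z y = tri x z y + tri x' z y.
Proof. by have := tri_linl z y 1 x x'; rewrite !scale1r. Qed.
Lemma tri_addr z x y y' : tri x z (y + y') = tri x z y + tri x z y'.
Proof. by have := tri_linr z x 1 y y'; rewrite !scale1r. Qed.

Lemma tri_subl z y x x' : tri (x - x') z y = tri x z y - tri x' z y.
Proof. by rewrite -[in RHS](subrK x' x) (tri_addl z y (x - x')) addrK. Qed.
Lemma tri_subr z x y y' : tri x z (y - y') = tri x z y - tri x z y'.
Proof. by rewrite -[in RHS](subrK y' y) (tri_addr z x (y - y')) addrK. Qed.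

(** Equality of two bilinear expressions is checked on monomials. *)
Lemma fbim_ext_tri (V : lmodType K) (f : seq B -> Z -> seq B -> V) (F : T -> Z -> T -> V) :
  (forall u z v, F (mon u) z (mon v) = f u z v) ->
  (forall z y k x x', F (k *: x + x') z y = k *: F x z y + F x' z y) ->
  (forall z x k y y', F x z (k *: y + y') = k *: F x z y + F x z y') ->
  forall x z y, fbim_ext f (tri x z y) = F x z y.
Proof.
move=> Fm Fl Fr x z y.
have F0l y' : F 0 z y' = 0.
  by have := Fl z y' (-1) 0 0; rewrite scaler0 addr0 scaleN1r addNr.
have F0r x' : F x' z 0 = 0.
  by have := Fr z x' (-1) 0 0; rewrite scaler0 addr0 scaleN1r addNr.
elim/word_algebra_ind: x => [|c u x IH]; first by rewrite tri0l linear0 F0l.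
rewrite tri_linl linearP IH Fl /=; congr (_ *: _ + _) => {IH x}.
elim/word_algebra_ind: y => [|c' v y IH]; first by rewrite tri0r linear0 F0r.
by rewrite tri_linr linearP IH Fr /= tri_mon fbim_extE Fm.
Qed.

Definition flact (x : T) : {linear fbim -> fbim} := fbim_ext (fun u z v => tri (x * mon u) z (mon v)).
Definition fract (x : T) : {linear fbim -> fbim} := fbim_ext (fun u z v => tri (mon u) z (mon v * x)).

Lemma flact_tri a x z y : flact a (tri x z y) = tri (a * x) z y.
Proof.
apply: (fbim_ext_tri (F := fun x z y => tri (a * x) z y)) => [//|w y' k x1 x2|w x' k y1 y2].
  by rewrite mulrDr -scalerAr tri_linl.
by rewrite tri_linr.
Qed.

Lemma fract_tri a x z y : fract a (tri x z y) = tri x z (y * a).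
Proof.
apply: (fbim_ext_tri (F := fun x z y => tri x z (y * a))) => [//|w y' k x1 x2|w x' k y1 y2].
  by rewrite tri_linl.
by rewrite mulrDl -scalerAl tri_linr.
Qed.

Lemma flact_lin k x x' y : flact (k *: x + x') y = k *: flact x y + flact x' y.
Proof.
elim/fbim_ind: y => [|c u z v y IH]; first by rewrite !linear0 addr0.
rewrite !linearP /= IH [RHS]addrACA -scalerDr.
by congr (_ *: _ + _); rewrite -tri_mon !flact_tri mulrDl -scalerAl tri_linl.
Qed.

Lemma fract_lin k x x' y : fract (k *: x + x') y = k *: fract x y + fract x' y.
Proof.
elim/fbim_ind: y => [|c u z v y IH]; first by rewrite !linear0 addr0.
rewrite !linearP /= IH [RHS]addrACA -scalerDr.
by congr (_ *: _ + _); rewrite -tri_mon !fract_tri mulrDr -scalerAr tri_linr.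
Qed.

Lemma flact0 y : flact 0 y = 0.
Proof. by have := flact_lin (-1) 0 0 y; rewrite scaler0 addr0 scaleN1r addNr. Qed.
Lemma fract0 y : fract 0 y = 0.
Proof. by have := fract_lin (-1) 0 0 y; rewrite scaler0 addr0 scaleN1r addNr. Qed.

Lemma flactB x x' y : flact (x - x') y = flact x y - flact x' y.
Proof. by rewrite [x - x']addrC -[- x']scaleN1r flact_lin scaleN1r addrC. Qed.
Lemma fractB x x' y : fract (x - x') y = fract x y - fract x' y.
Proof. by rewrite [x - x']addrC -[- x']scaleN1r fract_lin scaleN1r addrC. Qed.
Lemma flact1 y : flact 1 y = y.
Proof.
elim/fbim_ind: y => [|c u z v y IH]; first by rewrite !linear0.
by rewrite !linearP /= IH -tri_mon flact_tri mul1r.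
Qed.

Lemma flactM x x' y : flact (x * x') y = flact x (flact x' y).
Proof.
elim/fbim_ind: y => [|c u z v y IH]; first by rewrite !linear0.
by rewrite !linearP /= IH -tri_mon !flact_tri mulrA.
Qed.

Lemma fractM x x' y : fract (x * x') y = fract x' (fract x y).
Proof.
elim/fbim_ind: y => [|c u z v y IH]; first by rewrite !linear0.
by rewrite !linearP /= IH -tri_mon !fract_tri mulrA.
Qed.

Definition eval_bar : {linear fbim -> bar} := fbim_ext (fun u z v => brk (word_value u) z (word_value v)).

Lemma eval_bar_tri x z y : eval_bar (tri x z y) = brk (proj x) z (proj y).
Proof.
apply: (fbim_ext_tri (F := fun x z y => brk (proj x) z (proj y))) => [u w v|w y' k x1 x2|w x' k y1 y2].
- by rewrite !proj_mon.
- by rewrite linearP brk_linl.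
- by rewrite linearP brk_linr.
Qed.

Lemma eval_bar_deg y : degs (pred1 n.+2) (eval_bar y) = eval_bar y.
Proof.
elim/fbim_ind: y => [|c u z v y IH]; first by rewrite !linear0.
by rewrite !linearP /= IH -tri_mon eval_bar_tri degs_brk /= size_tuple eqxx.
Qed.

(** A section of [eval_bar] in degree n + 2: coefficients in A are lifted to
    combinations of letters. *)
Definition bar_lift : {linear bar -> fbim} := bar_ext (fun a w c =>
  if insub w is Some z then tri (as_letters a) z (as_letters c) else 0).

Lemma bar_lift_brk a (z : Z) c : bar_lift (brk a z c) = tri (as_letters a) z (as_letters c).
Proof.
rewrite /bar_lift bar_extE ?valK // /bilin.
split=> [w d k x x'|x w k d d']; case: insubP => [z' _ _|_]; rewrite ?scaler0 ?addr0 //.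
  by rewrite linearP tri_linl.
by rewrite linearP tri_linr.
Qed.

Lemma eval_bar_lift y : degs (pred1 n.+2) y = y -> eval_bar (bar_lift y) = y.
Proof.
move=> <-; elim/bar_ind: y => [|e y z IHy IHz|a w c]; first by rewrite !linear0.
  by rewrite !linearP /= IHy IHz.
rewrite degs_brk /=; case: eqP => [sw|_]; last by rewrite !linear0.
have sw' : size w == n.+2 by rewrite sw.
by rewrite (bar_lift_brk a (Tuple sw')) eval_bar_tri !projK.
Qed.

End FreeBimodule.

Arguments eval_bar {K S n}.
Arguments flact {K S n}.
Arguments fract {K S n}.
Arguments bar_lift {K S n}.

Section Relation.
Variables (K : fieldType) (S : based_algebra K).
Local Notation A := (base_alg S).
Local Notation B := (letter S).
Local Notation bar := (bar S).
Local Notation T := (word_algebra S).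
Local Notation fbm0 := (fbim S 0).

(** The 0-target minus the 0-source of the generator e. *)
Definition gen_gap (e : seq B) : T := as_letters (word_value e) - mon e.
Definition eval_gap : {linear fbm0 -> T} :=
  fbim_ext (fun u (e : 2.-tuple B) v => mon u * gen_gap e * mon v).

Lemma eval_gap_tri x e y : eval_gap (tri x e y) = x * gen_gap e * y.
Proof.
apply: (fbim_ext_tri (F := fun x (e : 2.-tuple B) y => x * gen_gap e * y)) => [//|w y' k x1 x2|w x' k y1 y2].
  by rewrite !mulrDl -!scalerAl.
by rewrite mulrDr -scalerAr.
Qed.

Lemma proj_gen_gap e : proj (gen_gap e) = 0.
Proof. by rewrite /gen_gap linearB /= projK proj_mon subrr. Qed.

Lemma proj_eval_gap y : proj (eval_gap y) = 0.
Proof.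
elim/fbim_ind: y => [|c u e v y IH]; first by rewrite !linear0.
by rewrite !linearP /= IH -tri_mon eval_gap_tri !projM proj_gen_gap mulr0 mul0r scaler0 addr0.
Qed.

(** Both sides are the part of degree 1 of the target minus the source of a
    1-cell. *)
Lemma bdry_eval_bar y : bdry (eval_bar y) = der (eval_gap y).
Proof.
elim/fbim_ind: y => [|c u e v y IH]; first by rewrite !linear0.
rewrite !linearP /= IH -tri_mon; congr (_ *: _ + _).
rewrite eval_bar_tri eval_gap_tri !derM projM proj_gen_gap mulr0 lact0 ract0 addr0 add0r bdry_brk.
rewrite lact_ract; congr (ract _ (lact _ _)).
case/tupleP: e => x t; case/tupleP: t => y' t; rewrite tuple0.
rewrite -[tval _]/[:: x; y'] -bdry_brk1 bdry2 /gen_gap linearB /= der_mon !word_value_cons word_value0 mulr1 der_as_letters ?aug_letterl //.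
by rewrite word_der2.
Qed.

Lemma linear_ext_mulr (I : choiceType) (R : algType K) (f : I -> R) z t :
  linear_ext f z * t = linear_ext (fun k => f k * t) z.
Proof. by rewrite /linear_ext mulr_suml; apply: eq_bigr => k _; rewrite scalerAl. Qed.

Lemma linear_ext_addf (I : choiceType) (V : lmodType K) (f g : I -> V) z :
  linear_ext f z + linear_ext g z = linear_ext (fun k => f k + g k) z.
Proof. by rewrite /linear_ext -big_split; apply: eq_bigr => k _; rewrite scalerDr. Qed.

Lemma gen_gapE u v :
  gen_gap [:: u; v] = linear_ext (fun x => mon [:: x]) (lmul u v) - mon [:: u; v].
Proof.
rewrite /gen_gap !word_value_cons word_value0 mulr1 [ltr u * ltr v]lmulE linear_ext_comp; congr (_ - _).
by apply: eq_linear_ext => x; exact: as_letters_letter.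
Qed.

(** Reducing a word to a combination of letters by multiplying its first two
    letters, again and again; each multiplication is a generator with trivial left
    coefficient, applied to the rest of the word. *)
Fixpoint gap_lift_word (w : seq B) : B -> fbm0 :=
  match w with
  | [::] => fun _ => 0
  | v :: w' => fun u => linear_ext (gap_lift_word w') (lmul u v) - tri 1 [tuple u; v] (mon w')
  end.
Lemma gap_lift_word_cons v w u :
  gap_lift_word (v :: w) u = linear_ext (gap_lift_word w) (lmul u v) - tri 1 [tuple u; v] (mon w).
Proof. by []. Qed.

Definition gap_lift : {linear T -> fbm0} :=
  fa_ext _ (fun w => if w is u :: w' then gap_lift_word w' u else 0).
Lemma gap_lift_mon0 : gap_lift (mon [::]) = 0. Proof. exact: fa_extE. Qed.
Lemma gap_lift_mon u w : gap_lift (mon (u :: w)) = gap_lift_word w u. Proof. exact: fa_extE. Qed.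

(** The difference between x and its reduction to letters telescopes. *)
Lemma eval_gap_gap_lift x : eval_gap (gap_lift x) = x - as_letters (proj x).
Proof.
elim/word_algebra_ind: x => [|c w x IH]; first by rewrite !linear0 addr0.
rewrite !linearP /= IH [RHS]addrACA -scalerDr; congr (_ *: _ + _).
case: w => [|u w]; first by rewrite gap_lift_mon0 linear0 proj_mon word_value0 as_letters1 mon1 subrr.
rewrite gap_lift_mon proj_mon; elim: w u => [|v w IHw] u.
  by rewrite linear0 word_value_cons word_value0 mulr1 as_letters_letter subrr.
rewrite gap_lift_word_cons linearB eval_gap_tri mul1r gen_gapE mulrBl monD opprB addrCA; congr (_ + _).
rewrite linear_ext_comp linear_ext_mulr !word_value_cons mulrA [ltr u * ltr v]lmulE.
rewrite linear_ext_mulr !linear_ext_comp linear_ext_addf.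
apply: eq_linear_ext => k; rewrite IHw monD word_value_cons.
by rewrite addrAC [_ + _ (mon _)]subrr sub0r; exact: linear_ext_comp.
Qed.

Lemma gap_lift_relator (e : 2.-tuple B) y : gap_lift (gen_gap e * y) = tri 1 e y.
Proof.
elim/word_algebra_ind: y => [|c w y IH]; first by rewrite mulr0 linear0 tri0r.
rewrite mulrDr -scalerAr linearP IH tri_linr; congr (_ *: _ + _) => {IH y}.
case/tupleP: e => u t; case/tupleP: t => v t; rewrite (tuple0 t).
rewrite -[tval _]/[:: u; v] gen_gapE mulrBl linearB linear_ext_mulr monD linear_ext_comp.
rewrite -[[:: u; v] ++ w]/[:: u, v & w] gap_lift_mon gap_lift_word_cons.
have -> : linear_ext (fun k => gap_lift (mon [:: k] * mon w)) (lmul u v) = linear_ext (gap_lift_word w) (lmul u v).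
  by apply: eq_linear_ext => k; rewrite monD gap_lift_mon.
by rewrite opprB addrC subrK; congr tri; apply: val_inj.
Qed.

(** The elements whose left coefficients are scalars.  On them the gap is
    injective, with inverse [gap_lift], as in the reduction to letters only the
    first two letters are multiplied. *)
Inductive left_trivial : fbm0 -> Prop :=
| LeftTrivial0 : left_trivial 0
| LeftTrivialS c e y m : left_trivial m -> left_trivial (c *: tri 1 e y + m).

Lemma left_trivial_lin c x y :
  left_trivial x -> left_trivial y -> left_trivial (c *: x + y).
Proof.
move=> Sx Sy; elim: Sx => [|d e t m _ IH]; first by rewrite scaler0 add0r.
by rewrite scalerDr -addrA scalerA; apply: LeftTrivialS.
Qed.

Lemma left_trivial_tri e y : left_trivial (tri 1 e y).
Proof. by rewrite -[tri _ _ _]scale1r -[_ *: _]addr0; do 2!constructor. Qed.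

Lemma left_trivial_ract (t : T) x : left_trivial x -> left_trivial (fract t x).
Proof.
elim=> [|c e y m _ IH]; first by rewrite linear0; constructor.
by rewrite linearP /= fract_tri; apply: LeftTrivialS.
Qed.

Lemma left_trivial_gap_lift (x : T) : left_trivial (gap_lift x).
Proof.
elim/word_algebra_ind: x => [|c w x IH]; first by rewrite linear0; constructor.
rewrite linearP; apply: left_trivial_lin IH.
case: w => [|u w]; first by rewrite gap_lift_mon0; constructor.
rewrite gap_lift_mon; elim: w u => [|v w IH] u; first by constructor.
rewrite gap_lift_word_cons addrC -scaleN1r; apply: left_trivial_lin; first exact: left_trivial_tri.
elim/malg_ind: (lmul u v) => [|c' x' z IHz]; first by rewrite linear0; constructor.
by rewrite linear_extS; apply: left_trivial_lin.
Qed.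

Lemma left_trivialK x : left_trivial x -> gap_lift (eval_gap x) = x.
Proof.
elim=> [|c e y m _ IH]; first by rewrite !linear0.
by rewrite !linearP /= IH eval_gap_tri mul1r gap_lift_relator.
Qed.

Lemma homotopy_eval_bar_left_trivial x : left_trivial x -> homotopy (eval_bar x) = 0.
Proof.
elim=> [|c e y m _ IH]; first by rewrite !linear0.
by rewrite !linearP /= IH eval_bar_tri proj1 homotopy1 scaler0 addr0.
Qed.

Record subbimodule n (Q : fbim S n -> Prop) := Subbimodule {
  subbim0 : Q 0;
  subbimS : forall c x y, Q x -> Q y -> Q (c *: x + y);
  subbim_lact : forall (t : T) x, Q x -> Q (flact t x);
  subbim_ract : forall (t : T) x, Q x -> Q (fract t x) }.

Section Modulo.
Variables (n : nat) (Q : fbim S n -> Prop) (QQ : subbimodule Q).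

Lemma subbimD x y : Q x -> Q y -> Q (x + y).
Proof. by rewrite -{2}[x]scale1r; apply: subbimS. Qed.

Lemma subbimN x : Q x -> Q (- x).
Proof. by rewrite -[- x]addr0 -scaleN1r => Qx; apply: subbimS => //; apply: subbim0. Qed.

Hypotheses (Ql : forall (e : 2.-tuple B) y, Q (flact (gen_gap e) y))
           (Qr : forall (e : 2.-tuple B) y, Q (fract (gen_gap e) y)).

Lemma subbim_lact_gap r y : Q (flact (eval_gap r) y).
Proof.
elim/fbim_ind: r => [|c u e v r IH]; first by rewrite linear0 flact0; apply: subbim0.
rewrite linearP flact_lin; apply: subbimS => //.
by rewrite -tri_mon eval_gap_tri !flactM; apply: subbim_lact => //.
Qed.

Lemma subbim_ract_gap r y : Q (fract (eval_gap r) y).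
Proof.
elim/fbim_ind: r => [|c u e v r IH]; first by rewrite linear0 fract0; apply: subbim0.
rewrite linearP fract_lin; apply: subbimS => //.
by rewrite -tri_mon eval_gap_tri !fractM; apply: subbim_ract => //.
Qed.

(** The gaps of generators act by 0 modulo Q, hence so does each x minus its
    reduction to letters, by [eval_gap_gap_lift]; the coefficients in T may thus be
    replaced by the chosen lifts of their images in A. *)
Lemma mod_bar_lift y : Q (y - bar_lift (eval_bar y)).
Proof.
elim/fbim_ind: y => [|c u z v y IH]; first by rewrite !linear0 addr0; apply: subbim0.
rewrite !linearP /= addrACA -scalerDr; apply: subbimS => //.
rewrite -tri_mon eval_bar_tri bar_lift_brk.
rewrite -(subrK (tri (as_letters (proj (mon u))) z (mon v)) (tri (mon u) z (mon v))) -addrA.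
apply: subbimD.
  have <- : flact (eval_gap (gap_lift (mon u))) (tri 1 z (mon v)) =
            tri (mon u) z (mon v) - tri (as_letters (proj (mon u))) z (mon v).
    by rewrite flact_tri mulr1 eval_gap_gap_lift tri_subl.
  exact: subbim_lact_gap.
have <- : fract (eval_gap (gap_lift (mon v))) (tri (as_letters (proj (mon u))) z 1) =
    tri (as_letters (proj (mon u))) z (mon v) - tri (as_letters (proj (mon u))) z (as_letters (proj (mon v))).
  by rewrite fract_tri mul1r eval_gap_gap_lift tri_subr.
exact: subbim_ract_gap.
Qed.

Lemma kernel_eval_bar y : eval_bar y = 0 -> Q y.
Proof. by move=> e; have := mod_bar_lift y; rewrite e linear0 subr0. Qed.

End Modulo.

Lemma aug_ideal_part (a : A) : aug (a - (aug a)%:A) = 0.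
Proof.
rewrite linearB.
by rewrite linearZ /= aug1 mulr1 subrr.
Qed.

(** The lift of [bar_lift] restricted to left coefficients in the augmentation
    ideal. *)
Definition aug_lift : {linear bar -> fbm0} := bar_ext (fun a w c =>
  if insub w is Some z then tri (as_letters (a - (aug a)%:A)) z (as_letters c) else 0).

Lemma aug_lift_brk a (z : 2.-tuple B) c :
  aug_lift (brk a z c) = tri (as_letters (a - (aug a)%:A)) z (as_letters c).
Proof.
rewrite /aug_lift bar_extE ?valK // /bilin.
split=> [w d k x x'|x w k d d']; case: insubP => [z' _ _|_]; rewrite ?scaler0 ?addr0 //.
  rewrite -tri_linl -linearP; congr (tri (as_letters _) _ _).
  by rewrite linearP scalerDl opprD addrACA -scalerA -scalerBr.
by rewrite linearP tri_linr.
Qed.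

Lemma aug_lift_left_trivial m : left_trivial m -> aug_lift (eval_bar m) = 0.
Proof.
elim=> [|c e y x _ IH]; first by rewrite !linear0.
by rewrite !linearP /= IH eval_bar_tri proj1 aug_lift_brk aug1 scale1r subrr linear0 tri0l scaler0 addr0.
Qed.

(** Dimension 1, where a gap does not act by 0, but can be moved from the left of
    a generator to its right: the exchange of y and y'. *)
Section LowKernel.
Variables (Q : fbm0 -> Prop) (QQ : subbimodule Q).
Hypothesis Qx : forall y y', Q (flact (eval_gap y) y' - fract (eval_gap y') y).
Hypothesis Q0 : forall y, Q y -> eval_bar y = 0 /\ eval_gap y = 0.

(** Modulo Q, an element splits into a part whose left coefficients are
    scalars, determined by its gap, and a part with lifted coefficients, the left
    ones in the augmentation ideal, determined by its chain. *)
Definition reducible y := exists m1 m2,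
  [/\ left_trivial m1, aug_lift (eval_bar m2) = m2 & Q (y - (m1 + m2))].

Lemma reducible_left m : left_trivial m -> reducible m.
Proof.
by move=> Lm; exists m, 0; rewrite !linear0 addr0 subrr; split=> //; apply: (subbim0 QQ).
Qed.

Lemma reducible_lin c x y : reducible x -> reducible y -> reducible (c *: x + y).
Proof.
move=> [m1 [m2 [L1 L2 L3]]] [p1 [p2 [P1 P2 P3]]].
exists (c *: m1 + p1), (c *: m2 + p2); split; first exact: left_trivial_lin.
  by rewrite !linearP /= L2 P2.
by rewrite addrACA -scalerDr opprD addrACA -scalerBr; apply: (subbimS QQ).
Qed.

Lemma reducible_mod x y : Q (x - y) -> reducible y -> reducible x.
Proof.
move=> Qxy [m1 [m2 [L1 L2 L3]]]; exists m1, m2; split=> //.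
by rewrite -(subrK y x) -addrA; apply: (subbimD QQ).
Qed.

Lemma reducible_D x y : reducible x -> reducible y -> reducible (x + y).
Proof. by rewrite -{2}[x]scale1r; apply: reducible_lin. Qed.

(** A left coefficient of zero image in A is a gap, which the exchange moves to
    the right. *)
Lemma reducible_ideal x e y : proj x = 0 -> reducible (tri x e y).
Proof.
move=> px; have xE : x = eval_gap (gap_lift x) by rewrite eval_gap_gap_lift px linear0 subr0.
apply: (reducible_mod (y := fract (eval_gap (tri 1 e y)) (gap_lift x))).
  by have := Qx (gap_lift x) (tri 1 e y); rewrite -xE flact_tri mulr1.
by apply: reducible_left; apply: left_trivial_ract; apply: left_trivial_gap_lift.
Qed.

Lemma reducible_lact x m : proj x = 0 -> left_trivial m -> reducible (flact x m).
Proof.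
move=> px; elim=> [|c e y {}m _ IH].
  by rewrite linear0; apply: reducible_left; constructor.
by rewrite linearP /= flact_tri; apply: reducible_lin => //; apply: reducible_ideal; rewrite mulr1.
Qed.

Lemma reducible_all y : reducible y.
Proof.
elim/fbim_ind: y => [|c u e v y IH]; first by apply: reducible_left; constructor.
apply: reducible_lin IH => {c y}; rewrite -tri_mon.
move: (mon u) (mon v) => x y {u v}.
have -> : x = (x - as_letters (proj x)) + as_letters (proj x) by rewrite subrK.
rewrite tri_addl; apply: reducible_D.
  by apply: reducible_ideal; rewrite linearB /= projK subrr.
(* What is left of x is a lift; its constant term gives a left trivial element. *)
move: (proj x) => {x} p; rewrite -[p](subrK (aug p)%:A) linearD tri_addl.
apply: reducible_D; last first.
  rewrite linearZ /= as_letters1 -[_ *: 1]addr0 tri_linl tri0l.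
  by apply: reducible_lin; apply: reducible_left; [exact: left_trivial_tri | constructor].
have -> : y = eval_gap (gap_lift y) + as_letters (proj y) by rewrite eval_gap_gap_lift subrK.
set q := p - _; rewrite tri_addr; apply: reducible_D; last first.
  exists 0, (tri (as_letters q) e (as_letters (proj y))); split; first by constructor.
    rewrite eval_bar_tri !projK aug_lift_brk; congr (tri (as_letters _) _ _).
    by rewrite aug_ideal_part scale0r subr0.
  by rewrite add0r subrr; apply: (subbim0 QQ).
apply: (reducible_mod (y := flact (eval_gap (tri (as_letters q) e 1)) (gap_lift y))).
  rewrite -opprB; apply: (subbimN QQ).
  by have := Qx (tri (as_letters q) e 1) (gap_lift y); rewrite fract_tri mul1r.
by apply: reducible_lact; [exact: proj_eval_gap | exact: left_trivial_gap_lift].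
Qed.

(** The chain of y determines the lifted part of its decomposition, which
    therefore vanishes, and then its gap determines the left trivial part. *)
Lemma kernel_eval_bar_gap y : eval_bar y = 0 -> eval_gap y = 0 -> Q y.
Proof.
move=> y1 y2; have [m1 [m2 [L1 L2 L3]]] := reducible_all y.
have [] := Q0 L3; rewrite !linearB /= y1 y2 !sub0r !linearD /= => /eqP.
rewrite -opprD oppr_eq0 => /eqP e1 /eqP; rewrite -opprD oppr_eq0 => /eqP e2.
have m20 : m2 = 0.
  by have := congr1 aug_lift e1; rewrite linear0 linearD /= aug_lift_left_trivial // add0r L2.
move: e2; rewrite m20 linear0 addr0 => e2.
by move: L3; rewrite m20 addr0 -(left_trivialK L1) e2 linear0 subr0.
Qed.

End LowKernel.

Lemma homotopy_aug_lift b : degs (pred1 2) b = b -> homotopy (eval_bar (aug_lift b)) = homotopy b.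
Proof.
move=> <-; elim/bar_ind: b => [|c b1 b2 IH1 IH2|a w c]; first by rewrite !linear0.
  by rewrite !linearP /= IH1 IH2.
rewrite degs_brk /=; case: eqP => [sw|_]; last by rewrite !linear0.
have sw' : size w == 2 by rewrite sw.
rewrite (aug_lift_brk a (Tuple sw')) eval_bar_tri !projK.
by rewrite addrC -scaleNr brk_linl linearP /= homotopy1 scaler0 add0r.
Qed.

(** The lift of b is corrected by a left trivial element to get the right gap.
    The defect b' on chains is then a cycle killed by the homotopy, as this
    correction and the constants of the left coefficients are, so it
    vanishes by contraction. *)
Lemma eval_bar_gap_surj (t : T) (b : bar) : degs (pred1 2) b = b -> proj t = 0 ->
  der t = bdry b -> exists y : fbm0, eval_gap y = t /\ eval_bar y = b.
Proof.
move=> db pt dt; pose y := aug_lift b + gap_lift (t - eval_gap (aug_lift b)).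
have evy : eval_gap y = t.
  by rewrite linearD eval_gap_gap_lift linearB /= pt proj_eval_gap subrr linear0 subr0 addrC subrK.
exists y; split=> //; apply/eqP; rewrite eq_sym -subr_eq0; apply/eqP.
set b' := b - eval_bar y.
have hb : homotopy b' = 0.
  rewrite /b' /y linearB linearD linearD /= (homotopy_eval_bar_left_trivial (left_trivial_gap_lift _)).
  by rewrite addr0 homotopy_aug_lift // subrr.
have db' : degs (pred1 2) b' = b' by rewrite /b' linearB /= db eval_bar_deg.
have bb : bdry b' = 0 by rewrite /b' linearB /= bdry_eval_bar evy dt subrr.
by have := bdry_homotopy (n := 2) isT db'; rewrite hb bb !linear0 addr0 sqrrN expr1n scale1r => <-.
Qed.

End Relation.
Arguments eval_gap {K S}.
Arguments gap_lift {K S}.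
Arguments gen_gap {K S} e.
Arguments aug_lift {K S}.

(** * Cells are combinations of generators *)

Section Identities.
Variables (K : fieldType) (S : based_algebra K).
Local Notation A := (base_alg S).
Local Notation B := (letter S).
Local Notation bar := (bar S).
Local Notation T := (word_algebra S).
Local Notation table := (table S).

Definition id_table (x : T) : table := (x, x, der x).

Lemma id_table_cell n x : is_cell n (id_table x).
Proof.
by apply/is_cellP; rewrite /= !degs_der /= linear0 addr0; split.
Qed.

Definition id_cell n (x : T) : cell_of S n := CellOf (id_table_cell n x).

Lemma id_cell_linear n : linear (id_cell n).
Proof. by move=> k x y; apply: val_inj; apply: table_eq => //=; rewrite linearP. Qed.
Lemma id_cell_mult n : monoid_morphism (id_cell n).
Proof.
split=> [|x y]; apply: val_inj; apply: table_eq => //=; first exact: der1.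
exact: derM.
Qed.
HB.instance Definition _ n :=
  GRing.isLinear.Build K T (cell_of S n) *:%R (id_cell n) (@id_cell_linear n).
HB.instance Definition _ n :=
  GRing.isMonoidMorphism.Build T (cell_of S n) (id_cell n) (@id_cell_mult n).

Definition src_word n (x : cell_of S n) : T := (cell_val x).1.1.
Definition tgt_word n (x : cell_of S n) : T := (cell_val x).1.2.
Arguments src_word : simpl never.
Arguments tgt_word : simpl never.
Lemma src_word_linear n : linear (@src_word n). Proof. by []. Qed.
Lemma tgt_word_linear n : linear (@tgt_word n). Proof. by []. Qed.
Lemma src_word_mult n : monoid_morphism (@src_word n). Proof. by []. Qed.
Lemma tgt_word_mult n : monoid_morphism (@tgt_word n). Proof. by []. Qed.
HB.instance Definition _ n :=
  GRing.isLinear.Build K (cell_of S n) T *:%R (@src_word n) (@src_word_linear n).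
HB.instance Definition _ n :=
  GRing.isLinear.Build K (cell_of S n) T *:%R (@tgt_word n) (@tgt_word_linear n).
HB.instance Definition _ n :=
  GRing.isMonoidMorphism.Build (cell_of S n) T (@src_word n) (@src_word_mult n).
HB.instance Definition _ n :=
  GRing.isMonoidMorphism.Build (cell_of S n) T (@tgt_word n) (@tgt_word_mult n).

Lemma cell0E (x : cell_of S 0) : x = id_cell 0 (src_word x).
Proof. by apply: val_inj; apply: is_cell0_eq_src => //; [exact: cell_valP | exact: id_table_cell]. Qed.

Lemma src_wordP n c x y : src_word (c *: x + y) = c *: src_word x + @src_word n y.
Proof. by []. Qed.
Lemma src_wordM n x y : src_word (x * y) = src_word x * @src_word n y. Proof. by []. Qed.
Lemma tgt_wordM n x y : tgt_word (x * y) = tgt_word x * @tgt_word n y. Proof. by []. Qed.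
Lemma src_id n x : src_word (id_cell n x) = x. Proof. by []. Qed.
Lemma tgt_id n x : tgt_word (id_cell n x) = x. Proof. by []. Qed.
Lemma src_word_gen_cell n (z : std_cells B n) : src_word (gen_cell z) = mon z. Proof. by []. Qed.
Lemma tgt_word_gen_cell n (z : std_cells B n) : tgt_word (gen_cell z) = as_letters (word_value z).
Proof. by []. Qed.

Section Eval.
Variable n : nat.
Definition eval_cells : {linear fbim S n -> cell_of S n.+1} :=
  fbim_ext (fun u (z : n.+2.-tuple B) v => id_cell n.+1 (mon u) * gen_cell z * id_cell n.+1 (mon v)).

Lemma eval_cells_tri x z y : eval_cells (tri x z y) = id_cell n.+1 x * gen_cell z * id_cell n.+1 y.
Proof.
apply: (fbim_ext_tri (F := fun x (z : n.+2.-tuple B) y => id_cell n.+1 x * gen_cell z * id_cell n.+1 y)) => //.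
  by move=> w y' k x1 x2; rewrite linearP /= !mulrDl -!scalerAl.
by move=> w x' k y1 y2; rewrite linearP /= mulrDr -scalerAr.
Qed.

Lemma gen_cell_top (z : n.+2.-tuple B) : degs (pred1 n.+2) (block_chain z) = brk (1 : A) z 1.
Proof.
case: n z => [|m] z; last by have [_ ->] := block_table_top (size_tuple z).
case/tupleP: z => u t; case/tupleP: t => v t; rewrite (tuple0 t).
rewrite -[tval _]/[:: u; v]; rewrite block_chain2 !linearD /= !degs_brk /=.
by rewrite !addr0.
Qed.

(** The part of degree n + 2 of a combination of generators forgets everything but
    the images in A of its coefficients. *)
Lemma eval_cells_top y : degs (pred1 n.+2) (cell_val (eval_cells y)).2 = eval_bar y.
Proof.
elim/fbim_ind: y => [|c u z v y IH]; first by rewrite !linear0.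
rewrite linearP [in RHS]linearP -IH [in LHS]linearP; congr (_ *: _ + _).
rewrite -tri_mon eval_cells_tri eval_bar_tri /= !linearD /= !(degs_lact, degs_ract).
rewrite !degs_der /= gen_cell_top !linear0 ?addr0 ?add0r lact_brk ract_brk.
by rewrite mulr1 mul1r.
Qed.

Lemma eval_cells_lact t y : eval_cells (flact t y) = id_cell n.+1 t * eval_cells y.
Proof.
elim/fbim_ind: y => [|c u z v y IH]; first by rewrite !linear0 mulr0.
rewrite !linearP /= IH mulrDr -scalerAr; congr (_ *: _ + _).
by rewrite -tri_mon flact_tri !eval_cells_tri rmorphM !mulrA.
Qed.

Lemma eval_cells_ract t y : eval_cells (fract t y) = eval_cells y * id_cell n.+1 t.
Proof.
elim/fbim_ind: y => [|c u z v y IH]; first by rewrite !linear0 mul0r.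
rewrite !linearP /= IH mulrDl -scalerAl; congr (_ *: _ + _).
by rewrite -tri_mon fract_tri !eval_cells_tri rmorphM !mulrA.
Qed.

End Eval.
Arguments eval_cells {n}.

Lemma eval_cells_gap (y : fbim S 0) : tgt_word (eval_cells y) - src_word (eval_cells y) = eval_gap y.
Proof.
elim/fbim_ind: y => [|c u z v y IH]; first by rewrite !linear0 addr0.
rewrite (linearP eval_cells) (linearP (@tgt_word 1)) (linearP (@src_word 1)) (linearP eval_gap) /= -IH.
rewrite opprD [LHS]addrACA -scalerBr; congr (_ *: _ + _).
rewrite -tri_mon eval_cells_tri eval_gap_tri.
by rewrite !src_wordM !tgt_wordM !src_id !tgt_id src_word_gen_cell tgt_word_gen_cell -mulrBl -mulrBr.
Qed.

Lemma degs_split n (y : bar) : degs (fun i => i <= n.+1)%N y =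
  degs (fun i => i <= n)%N y + degs (pred1 n.+1) y.
Proof.
elim/bar_ind: y => [|c y z IHy IHz|a w c]; first by rewrite !linear0 addr0.
  by rewrite !linearP /= IHy IHz scalerDr addrACA.
rewrite !degs_brk /= [(size w <= n.+1)%N]leq_eqVlt ltnS.
by case: eqP => [->|_] /=; rewrite ?ltnn ?add0r ?addr0.
Qed.

Lemma cell_idc_surj n (v : cell_of S n.+1) : degs (pred1 n.+2) (cell_val v).2 = 0 ->
  (n = 0%N -> src_word v = tgt_word v) -> exists a : cell_of S n, cell_idc a = v.
Proof.
move=> v0 vn; case/is_cellP: (cell_valP v) => v1 v2 v3 v4 _.
have vc : is_cell n (cell_val v).
  apply/is_cellP; split=> // [|/eqP n0]; last exact: vn n0.
  by have := v1; rewrite degs_split v0 addr0.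
by exists (CellOf vc); apply: val_inj.
Qed.

Lemma cell_idc_inj n : injective (@cell_idc K S n).
Proof. by move=> x y /(congr1 val) /= e; apply: val_inj. Qed.

Lemma cell_idc_top n (a : cell_of S n) : degs (pred1 n.+2) (cell_val (cell_idc a)).2 = 0.
Proof.
case/is_cellP: (cell_valP a) => a1 _ _ _ _; rewrite /= -a1.
by rewrite degs_disj // => i /= /eqP->; rewrite ltnn.
Qed.

Lemma cell_idc_gap (a : cell_of S 0) : src_word (cell_idc a) = tgt_word (cell_idc a).
Proof. by case/is_cellP: (cell_valP a) => _ _ _ _; apply. Qed.

(** Above dimension 1, removing the part of top degree of a cell leaves an
    identity.  In dimension 1, its 0-source and 0-target have to be made equal as
    well. *)
Lemma eval_cells_surj n (v : cell_of S n.+1) : exists y a, eval_cells y + cell_idc a = v.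
Proof.
case: n v => [|n] v; last first.
  pose b := degs (pred1 n.+3) (cell_val v).2.
  have [|//|a ea] := @cell_idc_surj _ (v - eval_cells (bar_lift b)).
    rewrite linearB /= eval_cells_top eval_bar_lift ?subrr // /b degsI.
    by apply: eq_degs => i /=; rewrite andbb.
  by exists (bar_lift b), a; rewrite ea addrC subrK.
case/is_cellP: (cell_valP v) => v1 v2 v3 v4 _.
have [|||y [y1 y2]] := @eval_bar_gap_surj K S (tgt_word v - src_word v) (degs (pred1 2) (cell_val v).2).
- by rewrite degsI; apply: eq_degs => i /=; rewrite andbb.
- by rewrite linearB /src_word /tgt_word /= v4 subrr.
- by rewrite linearB /src_word /tgt_word /= v3 addrAC subrr add0r.
have [||a ea] := @cell_idc_surj _ (v - eval_cells y).
- by rewrite linearB /= eval_cells_top y2 subrr.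
- move=> _; apply/eqP; rewrite eq_sym -subr_eq0.
  rewrite (linearB (@tgt_word 1)) (linearB (@src_word 1)) /= opprD addrACA.
  by rewrite -opprD eval_cells_gap y1 subrr.
by exists y, a; rewrite ea addrC subrK.
Qed.

End Identities.
Arguments eval_cells {K S n}.

(** * Freeness of the algebra of cells *)

Lemma malg_cancel (K : fieldType) (I : choiceType) (V : lmodType K)
    (f : {linear {malg K[I]} -> V}) (h : {linear V -> {malg K[I]}}) :
  (forall k, h (f << k >>) = << k >>) -> cancel f h.
Proof.
move=> fh x; rewrite -[RHS](linear_ext_id x).
exact: (linear_ext_uniq (h := h \o f)).
Qed.

Lemma mul_gap (R : pzRingType) (x y t s : R) :
  (x - t) * (y - s) = 0 -> x * s + t * y - t * s = x * y.
Proof.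
by move/eqP; rewrite mulrBl !mulrBr subr_eq0 subr_eq => /eqP ->; rewrite [RHS]addrC addrA.
Qed.

Section FreeExtension.
Variables (K : fieldType) (S : based_algebra K).
Local Notation A := (base_alg S).
Local Notation B := (letter S).
Local Notation T := (word_algebra S).
Local Notation X := (std_cells B).
Local Notation A0 := (free_algebra K (X 0)).
Local Notation fa := (malg_free_alg K B).
Local Notation g := (fun n => @gen_cell K S n : X n -> cells S n).

Definition words_of : {lrmorphism A0 -> T} := fa_of fa.
Definition of_words : T -> A0 := @fa_to _ _ fa.
Lemma of_wordsK t : words_of (of_words t) = t. Proof. exact: fa_toK. Qed.
Definition cell_coord (x : cells S 0) : A0 := of_words (src_word (x : cell_of S 0)).

Lemma words_ofP c x y : words_of (c *: x + y) = c *: words_of x + words_of y.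
Proof. exact: linearP. Qed.
Lemma words_ofM x y : words_of (x * y) = words_of x * words_of y.
Proof. exact: rmorphM. Qed.

Lemma words_ofE m : words_of << m >> = mon (monom_letters m).
Proof. exact: fa_ofE. Qed.

Lemma words_coord x : words_of (cell_coord x) = src_word (x : cell_of S 0).
Proof. exact: fa_toK. Qed.

Local Notation ev0 := (eval_free (R := cells S 0) (@gen_cell K S 0)).

Lemma ev0P c x y : ev0 (c *: x + y) = c *: ev0 x + ev0 y.
Proof. exact: linearP. Qed.

Lemma ev0E p : ev0 p = id_cell 0 (words_of p).
Proof.
rewrite [LHS]cell0E; congr id_cell.
elim/malg_ind: p => [|c m p IH]; first by rewrite !linear0.
rewrite words_ofP -IH words_ofE ev0P src_wordP.
have -> // : src_word (ev0 << m >> : cell_of S 0) = mon (monom_letters m).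
rewrite eval_freeU /monom_letters; elim: (m : seq _) => [|i s IHs]; first by rewrite big_nil /= mon1.
rewrite big_cons src_wordM IHs /= -cat1s -monD; congr (_ * _).
by case/tupleP: i => u t; rewrite (tuple0 t).
Qed.

Lemma ev0K : cancel ev0 cell_coord.
Proof. by move=> p; rewrite ev0E /cell_coord /src_word /=; apply: fa_ofK. Qed.

Lemma coordK : cancel cell_coord ev0.
Proof. by move=> x; rewrite ev0E words_coord; symmetry; exact: (cell0E (x : cell_of S 0)). Qed.

Lemma iter_id_cell n x : iter_id n (id_cell 0 x : cells S 0) = id_cell n x.
Proof. by elim: n => [//|n IH] /=; rewrite IH; apply: val_inj. Qed.

Lemma iter_idE n p : iter_id n (ev0 p) = id_cell n (words_of p).
Proof. by rewrite ev0E iter_id_cell. Qed.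

Section Dim.
Variable n : nat.
Local Notation E := {malg K[({fmonom (X 0)} * X n.+1 * {fmonom (X 0)})%type]}.
Local Notation bimod := (@ext_bimod K (cells S) X n).

Definition to_fbim : {linear E -> fbim S n} :=
  linear_ext (fun w => tri (words_of << w.1.1 >>) w.1.2 (words_of << w.2 >>)).

Lemma to_fbmU w : to_fbim << w >> = tri (words_of << w.1.1 >>) w.1.2 (words_of << w.2 >>).
Proof. exact: linear_extU. Qed.

Definition of_fbim : {linear fbim S n -> E} :=
  fbim_ext (fun u z v => << (letters_monom u, z, letters_monom v) >> : E).

Lemma of_fbmE u z v : of_fbim (tri (mon u) z (mon v)) = << (letters_monom u, z, letters_monom v) >>.
Proof. by rewrite tri_mon; apply: fbim_extE. Qed.

Lemma to_fbimK : cancel to_fbim of_fbim.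
Proof.
apply: malg_cancel => -[[m z] m'].
by rewrite to_fbmU /= !words_ofE of_fbmE !monom_lettersK.
Qed.

Lemma of_fbimK : cancel of_fbim to_fbim.
Proof.
elim/fbim_ind => [|c u z v x IH]; first by rewrite !linear0.
rewrite (linearP of_fbim) (linearP to_fbim) IH; congr (_ *: _ + _).
by rewrite -tri_mon of_fbmE to_fbmU /= !words_ofE !letters_monomK.
Qed.

Lemma to_fbim_lact p (e : bimod) : to_fbim (ext_lact g p e).1 = flact (words_of p) (to_fbim e.1).
Proof.
rewrite /=; elim/malg_ind: p => [|c m p IH]; first by rewrite linear_ext20 linear0 flact0.
rewrite linear_ext2S IH words_ofP flact_lin; congr (_ *: _ + _).
elim/malg_ind: e.1 => [|d w x IHx]; first by rewrite linear_ext20 linear_ext0 linear0.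
rewrite linear_ext2S IHx linear_extS [in RHS]linearP; congr (_ *: _ + _).
by rewrite linear_extU /= flact_tri -monM words_ofM.
Qed.

Lemma to_fbim_ract p (e : bimod) : to_fbim (ext_ract g e p).1 = fract (words_of p) (to_fbim e.1).
Proof.
rewrite /=; elim/malg_ind: p => [|c m p IH]; first by rewrite linear_ext20 linear0 fract0.
rewrite linear_ext2S IH words_ofP fract_lin; congr (_ *: _ + _).
elim/malg_ind: e.1 => [|d w x IHx]; first by rewrite linear_ext20 linear_ext0 linear0.
rewrite linear_ext2S IHx linear_extS [in RHS]linearP; congr (_ *: _ + _).
by rewrite linear_extU /= fract_tri -monM words_ofM.
Qed.

Lemma ext_evalE (e : bimod) : ext_eval g e = eval_cells (to_fbim e.1) + cell_idc e.2.
Proof.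
rewrite /ext_eval; congr (_ + _).
elim/malg_ind: e.1 => [|c w x IH]; first by rewrite !linear0.
rewrite linear_extS IH (linearP to_fbim) (linearP eval_cells); congr (_ *: _ + _).
by rewrite to_fbmU eval_cells_tri !iter_idE.
Qed.

Lemma src0_word m (x : cells S m) : src_word (src0 x : cell_of S 0) = src_word (x : cell_of S m).
Proof. by elim: m x => [//|m IH] x; apply: IH. Qed.
Lemma tgt0_word m (x : cells S m) : src_word (tgt0 x : cell_of S 0) = tgt_word (x : cell_of S m).
Proof.
have tgt0' : tgt_word (tgt0 x : cell_of S 0) = tgt_word (x : cell_of S m).
  by elim: m x => [//|m IH] x; apply: IH.
by rewrite -tgt0'; case/is_cellP: (cell_valP (tgt0 x : cell_of S 0)) => _ _ _ _; apply.
Qed.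

Local Notation ev e := (ext_eval g (e : bimod) : cell_of S n.+1).

Lemma ext_src0E e : words_of (ext_src0 g cell_coord e) = src_word (ev e).
Proof. by rewrite /ext_src0 words_coord src0_word. Qed.
Lemma ext_tgt0E e : words_of (ext_tgt0 g cell_coord e) = tgt_word (ev e).
Proof. by rewrite /ext_tgt0 words_coord tgt0_word. Qed.

Lemma ext_eval_lact p e : ev (ext_lact g p e) = id_cell n.+1 (words_of p) * ev e.
Proof.
rewrite !ext_evalE to_fbim_lact eval_cells_lact mulrDr; congr (_ + _).
by rewrite [(ext_lact _ _ _).2]/= iter_idE; apply: val_inj.
Qed.
Lemma ext_eval_ract p e : ev (ext_ract g e p) = ev e * id_cell n.+1 (words_of p).
Proof.
rewrite !ext_evalE to_fbim_ract eval_cells_ract mulrDl; congr (_ + _).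
by rewrite [(ext_ract _ _ _).2]/= iter_idE; apply: val_inj.
Qed.
Lemma ext_eval_cst p : ev (ext_cst g n p) = id_cell n.+1 (words_of p).
Proof. by rewrite ext_evalE linear0 linear0 add0r [(ext_cst _ _ _).2]/= iter_idE; apply: val_inj. Qed.

Lemma ext_evalD e e' : ev (e + e') = ev e + ev e'.
Proof. by rewrite !ext_evalE !linearD /= addrACA. Qed.
Lemma ext_evalB e e' : ev (e - e') = ev e - ev e'.
Proof. by rewrite !ext_evalE !linearB /= opprD addrACA. Qed.

Lemma ext_eval_src_tgt a b p q :
  ev (ext_ract g a p + ext_lact g q b - ext_cst g n (q * p))
  = ev a * id_cell n.+1 (words_of p) + id_cell n.+1 (words_of q) * ev b
    - id_cell n.+1 (words_of q) * id_cell n.+1 (words_of p).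
Proof.
apply: etrans (ext_evalB _ _) _; rewrite ext_eval_cst words_ofM.
apply: etrans (congr1 (fun x => x - _) (ext_evalD _ _)) _.
by rewrite ext_eval_lact ext_eval_ract (rmorphM (@id_cell K S n.+1)).
Qed.

Lemma ext_eval_tgt_src a b p q :
  ev (ext_lact g q b + ext_ract g a p - ext_cst g n (q * p))
  = id_cell n.+1 (words_of q) * ev b + ev a * id_cell n.+1 (words_of p)
    - id_cell n.+1 (words_of q) * id_cell n.+1 (words_of p).
Proof.
apply: etrans (ext_evalB _ _) _; rewrite ext_eval_cst words_ofM.
apply: etrans (congr1 (fun x => x - _) (ext_evalD _ _)) _.
by rewrite ext_eval_lact ext_eval_ract (rmorphM (@id_cell K S n.+1)).
Qed.

(** Both halves of the relator evaluate to the product of the cells, as the cells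
    x - t(x) and y - s(y) annihilate each other, and so do x - s(x)
    and y - t(y). *)
Lemma ext_eval_relator a b : ev (ext_relator g cell_coord a b) = 0.
Proof.
rewrite /ext_relator; move: (ext_src0E a) (ext_src0E b) (ext_tgt0E a) (ext_tgt0E b).
move: (ext_src0 _ _ a) (ext_src0 _ _ b) (ext_tgt0 _ _ a) (ext_tgt0 _ _ b) => sa sb ta tb.
move=> esa esb eta etb; apply: etrans (ext_evalB _ _) _.
apply: etrans (congr2 (fun x y => x - y) (ext_eval_src_tgt _ _ _ _) (ext_eval_tgt_src _ _ _ _)) _.
rewrite esa esb eta etb {esa esb eta etb}; move: (ev a) (ev b) => x y.
have gap (u v w z : cell_of S n.+1) : tgt_word u = 0 -> src_word v = 0 -> 
    u = w -> v = z -> w * z = 0 /\ z * w = 0.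
  by move=> u0 v0 <- <-; apply: mul_cells0.
have [xy _] : (x - id_cell n.+1 (tgt_word x)) * (y - id_cell n.+1 (src_word y)) = 0 /\
    (y - id_cell n.+1 (src_word y)) * (x - id_cell n.+1 (tgt_word x)) = 0.
  by apply: gap (erefl _) (erefl _); rewrite /tgt_word /src_word /= subrr.
have [_ yx] : (y - id_cell n.+1 (tgt_word y)) * (x - id_cell n.+1 (src_word x)) = 0 /\
    (x - id_cell n.+1 (src_word x)) * (y - id_cell n.+1 (tgt_word y)) = 0.
  by apply: gap (erefl _) (erefl _); rewrite /tgt_word /src_word /= subrr.
by rewrite (mul_gap xy) [_ * y + _]addrC (mul_gap yx) subrr.
Qed.

Lemma exchange_sound e : ext_exchange g cell_coord e -> ev e = 0.
Proof.
elim=> [a b||x y _ IHx _ IHy|p x _ IH|p x _ IH].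
- exact: ext_eval_relator.
- by rewrite ext_evalE !linear0 addr0.
- by rewrite ext_evalD IHx IHy addr0.
- by rewrite ext_eval_lact IH mulr0.
- by rewrite ext_eval_ract IH mul0r.
Qed.

(** Nothing is lost by forgetting the component in the cells of lower
    dimension: identities are injective, see [exchanged_bimod]. *)
Definition exchanged (y : fbim S n) := exists2 e, ext_exchange g cell_coord e & to_fbim e.1 = y.

Lemma exchanged_subbim : subbimodule exchanged.
Proof.
split.
- by exists 0; [exact: exchange_zero | exact: linear0].
- move=> c _ _ [x Qx <-] [y Qy <-].
  exists (ext_lact g (of_words c%:A) x + y); first exact: exchange_add (exchange_lact _ Qx) Qy.
  apply: etrans (linearD to_fbim (ext_lact g (of_words c%:A) x).1 y.1) _; congr (_ + _).
  rewrite to_fbim_lact of_wordsK -[_%:A]addr0 flact_lin flact0 addr0 flact1 //.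
- move=> t _ [x Qx <-]; exists (ext_lact g (of_words t) x); first exact: exchange_lact.
  by rewrite to_fbim_lact of_wordsK.
- move=> t _ [x Qx <-]; exists (ext_ract g x (of_words t)); first exact: exchange_ract.
  by rewrite to_fbim_ract of_wordsK.
Qed.

(** The first component of a relator between a and b only depends on the gaps
    of a and b. *)
Lemma exchanged_relator (a b : bimod) :
  exchanged (flact (tgt_word (ev a) - src_word (ev a)) (to_fbim b.1)
             - fract (tgt_word (ev b) - src_word (ev b)) (to_fbim a.1)).
Proof.
exists (ext_relator g cell_coord a b); first exact: exchange_relator.
rewrite /ext_relator; move: (ext_src0E a) (ext_src0E b) (ext_tgt0E a) (ext_tgt0E b).
move: (ext_src0 _ _ a) (ext_src0 _ _ b) (ext_tgt0 _ _ a) (ext_tgt0 _ _ b) => sa sb ta tb <- <- <- <-.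
have cst p : to_fbim (ext_cst g n p).1 = 0 by apply: linear0.
have half p q : to_fbim (ext_ract g a p + ext_lact g q b - ext_cst g n (q * p)).1
    = fract (words_of p) (to_fbim a.1) + flact (words_of q) (to_fbim b.1).
  rewrite -(to_fbim_ract p a) -(to_fbim_lact q b) -[RHS]subr0 -(cst (q * p)).
  rewrite -(linearD to_fbim) -(linearB to_fbim); congr (to_fbim _).
have half' p q : to_fbim (ext_lact g q b + ext_ract g a p - ext_cst g n (q * p)).1
    = flact (words_of q) (to_fbim b.1) + fract (words_of p) (to_fbim a.1).
  rewrite -(to_fbim_ract p a) -(to_fbim_lact q b) -[RHS]subr0 -(cst (q * p)).
  by rewrite -(linearD to_fbim) -(linearB to_fbim); congr (to_fbim _).
have tB (x y : bimod) : to_fbim (x - y).1 = to_fbim x.1 - to_fbim y.1.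
  exact: (linearB to_fbim).
apply: etrans (tB _ _) _.
apply: etrans (congr2 (fun x y => x - y) (half _ _) (half' _ _)) _.
rewrite flactB fractB opprD [X in X + _]addrC addrACA opprB; congr (_ + _).
Qed.

Lemma exchanged_bimod y x : eval_cells y + cell_idc x = 0 -> exchanged y -> ext_exchange g cell_coord (of_fbim y, x).
Proof.
move=> y0 [[m x'] ex my].
have := exchange_sound ex; rewrite ext_evalE my -y0 => /addrI/cell_idc_inj <-.
by rewrite -my to_fbimK.
Qed.

Lemma exchanged_bimod_eval (e : bimod) :
  (forall y x, eval_cells y = cell_idc x -> exchanged y) -> ev e = 0 -> ext_exchange g cell_coord e.
Proof.
case: e => m x H mx; rewrite -(to_fbimK m).
have mx' : eval_cells (to_fbim m) + cell_idc x = 0 by rewrite -[LHS](ext_evalE (m, x)).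
apply: exchanged_bimod (mx') _; apply: H (- x) _.
by rewrite linearN; apply/eqP; rewrite -addr_eq0 mx'.
Qed.

Lemma ext_eval_fbim y x : ev (of_fbim y, x) = eval_cells y + cell_idc x.
Proof. by rewrite ext_evalE of_fbimK. Qed.

End Dim.
Arguments to_fbim {n}.
Arguments of_fbim {n}.

(** For n > 0, the relators with the 1-cell u|v seen as an n-cell, which has no
    component on the generators, make the gap of u|v act by 0 on both sides. *)
Lemma kernel_exchanged n y x : eval_cells y = cell_idc x -> exchanged (n := n) y.
Proof.
case: n y x => [|n] y x yx.
  apply: (kernel_eval_bar_gap (exchanged_subbim 0)).
  - move=> a b; have := exchanged_relator (of_fbim a, 0) (of_fbim b, 0).
    by rewrite !ext_eval_fbim !linear0 !addr0 !of_fbimK !eval_cells_gap.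
  - move=> z [[m x'] ex <-].
    have := exchange_sound ex; rewrite ext_evalE => /eqP; rewrite addr_eq0 -linearN => /eqP e.
    by rewrite -eval_cells_top -eval_cells_gap e cell_idc_top cell_idc_gap subrr.
  - by rewrite -eval_cells_top yx cell_idc_top.
  - by rewrite -eval_cells_gap yx cell_idc_gap subrr.
have e_cell (e : 2.-tuple B) : is_cell n.+1 (block_table e).
  by apply: (@is_cell_le _ _ 1) => //; apply: block_table_cell; rewrite size_tuple.
have e_gap e : tgt_word (cell_idc (CellOf (e_cell e))) - src_word (cell_idc (CellOf (e_cell e))) = gen_gap e.
  by [].
have e_ev (e : 2.-tuple B) : ext_eval g (0, CellOf (e_cell e)) = cell_idc (CellOf (e_cell e)).
  by rewrite ext_evalE !linear0 add0r.
apply: (kernel_eval_bar (exchanged_subbim n.+1)).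
- move=> e z; have := exchanged_relator (0, CellOf (e_cell e)) (of_fbim z, 0).
  by rewrite e_ev e_gap of_fbimK !linear0 addr0.
- move=> e z; have := exchanged_relator (of_fbim z, 0) (0, CellOf (e_cell e)).
  by rewrite e_ev e_gap of_fbimK !linear0 add0r => /(subbimN (exchanged_subbim _)); rewrite opprK.
by rewrite -eval_cells_top yx cell_idc_top.
Qed.

Lemma cells_free_ext n : is_quotient (ext_eval g (n:=n)) (ext_exchange g cell_coord (n:=n)).
Proof.
split=> [v|e].
  have [y [a <-]] := eval_cells_surj (v : cell_of S n.+1).
  by exists (of_fbim y, a); rewrite ext_eval_fbim.
split; last exact: exchange_sound.
by apply: exchanged_bimod_eval => y x; apply: kernel_exchanged.
Qed.

Definition std_polygraph : polygraph K X :=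
  @Polygraph K X (cells_inf S) g cell_coord ev0K coordK cells_free_ext.

End FreeExtension.

(** * Acyclicity and presentation *)

Section Resolution.
Variables (K : fieldType) (S : based_algebra K).
Local Notation A := (base_alg S).
Local Notation B := (letter S).
Local Notation X := (std_cells B).
Local Notation P := (std_polygraph S).

(** The chains of two parallel cells differ by a cycle d of top degree; the
    homotopy applied to d gives the part of top degree of a cell between them. *)
Lemma fill_cell n (a b : cell_of S n.+1) : cell_src a = cell_src b -> cell_tgt a = cell_tgt b ->
  exists f : cell_of S n.+2, cell_src f = a /\ cell_tgt f = b.
Proof.
move=> /(congr1 val)/= [es _ ey] /(congr1 val)/= [_ et ebd].
case/is_cellP: (cell_valP a) => a1 a2 a3 a4 _; case/is_cellP: (cell_valP b) => b1 _ _ _ _.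
set d := (cell_val b).2 - (cell_val a).2.
have dtop : degs (pred1 n.+2) d = d.
  have := degs_split n.+1 d; rewrite {1}/d linearB /= a1 b1 -/d.
  by rewrite [degs _ d]linearB /= ey subrr add0r.
have dbd : bdry d = 0.
  move: ebd; rewrite ey => /addrI e; rewrite -dtop /d.
  by rewrite !linearB /= e subrr.
pose top := (-1) ^+ n.+2 *: homotopy d.
have topE p : degs p top = if p n.+3 then top else 0.
  rewrite /top linearZ /= degs_homotopy -dtop degsI.
  case pn : (p n.+3).
    congr (_ *: homotopy _); apply: eq_degs => i /=.
    by case: eqP => [->|]; rewrite ?pn ?andbF.
  rewrite (eq_degs (q := pred0)) ?degs_pred0 ?linear0 ?scaler0 // => i /=.
  by case: eqP => [->|]; rewrite ?pn ?andbF.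
have topd : bdry top = d.
  by rewrite /top linearZ /= (bdry_homotopy _ dtop) // dbd linear0 addr0 signrZK.
have fc : is_cell n.+2 ((cell_val a).1.1, (cell_val a).1.2, (cell_val a).2 + top).
  apply/is_cellP; rewrite /= !linearD /= !topE /= !addr0 a2 a3 leqnn; split=> //.
    by rewrite (degs_id _ a1) // => i; apply: leqW.
  by rewrite linear0 addr0.
exists (CellOf fc); split; apply: val_inj; apply: table_eq => //=.
- by rewrite linearD /= topE ltnn addr0.
have a0 : degs (pred1 n.+3) (cell_val a).2 = 0.
  by rewrite -a1 degs_disj // => i /= /eqP->; rewrite ltnn.
by rewrite !linearD /= a0 !topE /= ltnn eqxx addr0 a1 linear0 add0r topd addrC subrK.
Qed.

Lemma std_acyclic n : (0 < n)%N -> acyclic P n.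
Proof. by case: n => [//|n] _ a b [ab1 ab2]; apply: fill_cell. Qed.

(** The presentation of A: a word of 0-cells is evaluated to the product of its
    letters. *)
Definition std_eval (p : free_algebra K (X 0)) : A := proj (words_of S p).
Lemma std_eval_linear : linear std_eval.
Proof. by move=> c x y; rewrite /std_eval words_ofP linearP. Qed.
Lemma std_eval_mult : monoid_morphism std_eval.
Proof.
by split=> [|x y]; rewrite /std_eval ?words_ofM ?projM // (rmorph1 (words_of S)) proj1.
Qed.
HB.instance Definition _ :=
  GRing.isLinear.Build K (free_algebra K (X 0)) A *:%R std_eval std_eval_linear.
HB.instance Definition _ :=
  GRing.isMonoidMorphism.Build (free_algebra K (X 0)) A std_eval std_eval_mult.

Lemma words_relation (z : X 1) :
  words_of S (cell_coord (cell_src (gen_cell z) : cells S 0)) - words_of S (cell_coord (cell_tgt (gen_cell z) : cells S 0)) = - gen_gap z.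
Proof. by rewrite !words_coord opprB. Qed.

(** The 1-cells u|v present the multiplication of the letters: their source minus
    target is the opposite of the gap. *)
Lemma ideal_relator (y : fbim S 0) : exists2 p,
  ideal_gen (relations (X := underlying_polygraph1 P)) p & words_of S p = eval_gap y.
Proof.
elim/fbim_ind: y => [|c u z v y [p Ip ep]]; first by exists 0; [constructor | rewrite !linear0].
pose r : free_algebra K (X 0) := cell_coord (cell_src (gen_cell z) : cells S 0) - cell_coord (cell_tgt (gen_cell z) : cells S 0).
exists (- c *: (<< letters_monom u >> * r * << letters_monom v >>) + p).
  apply: ideal_add => //; apply: ideal_scale; apply: ideal_mulr; apply: ideal_mull.
  by apply: ideal_incl; exists z.
rewrite words_ofP !words_ofM !words_ofE !letters_monomK ep [in RHS]linearP -tri_mon eval_gap_tri; congr (_ + _).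
have -> : words_of S r = - gen_gap z by rewrite -words_relation; exact: linearB.
by rewrite mulrN mulNr scaleNr scalerN opprK.
Qed.

Lemma std_presentation : presentation (std_eval :
  {lrmorphism free_algebra K (gen0 (underlying_polygraph1 P)) -> A}).
Proof.
split=> [a|p].
  by exists (of_words (as_letters a)); rewrite /= /std_eval of_wordsK projK.
rewrite /= /std_eval; split=> [p0|].
  have [q Iq eq] := ideal_relator (gap_lift (words_of S p)).
  suff <- : q = p by [].
  apply: (can_inj (fa_ofK (malg_free_alg K B))); apply: etrans eq _.
  by rewrite eval_gap_gap_lift p0 linear0 subr0.
elim=> {p} [_ [z ->]||x y _ IHx _ IHy|a x _ IH|a x _ IH].
- have -> : words_of S (rsrc z - rtgt z) = - gen_gap z.
    by rewrite -words_relation; exact: linearB.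
  by rewrite linearN /= proj_gen_gap oppr0.
- by rewrite !linear0.
- have -> : words_of S (x + y) = words_of S x + words_of S y by exact: linearD.
  by rewrite linearD /= IHx IHy addr0.
- by rewrite words_ofM projM IH mulr0.
- by rewrite words_ofM projM IH mul0r.
Qed.

Lemma std_resolution : polygraphic_resolution P A.
Proof. by split; [eexists; exact: std_presentation | exact: std_acyclic]. Qed.

Lemma block_val n b : (0 < size b <= n.+1)%N ->
  cell_val (block_cell P n b : cell_of S n) = block_table b.
Proof.
elim: n => [|n IH] /andP[b0 bn] /=; case: insubP => [z _ <- //|] /= sz.
  by rewrite eqn_leq bn b0 in sz.
by apply: IH; rewrite b0 /= -ltnS ltn_neqAle sz bn.
Qed.

Lemma word_val n w : small n.+1 w -> cell_val (word_cell P n w : cell_of S n) = word_table w.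
Proof.
rewrite /word_cell /word_table; elim: w => [|b w IH]; first by rewrite !big_nil.
by case/andP=> sb /IH {}IH; rewrite !big_cons -IH -(block_val sb).
Qed.

Lemma ext_word_val n x : spanned (small n.+1) x ->
  cell_val (linear_ext (word_cell P n) x : cell_of S n) = linear_ext (@word_table K S) x.
Proof.
elim=> [|c w {}x sw _ IH]; first by rewrite !linear_ext0.
by rewrite !linear_extS -(word_val sw) -IH.
Qed.

Lemma boundary_val n tg (z : X n.+1) :
  cell_val (std_boundary (@lmul K S) P tg z : cell_of S n) = std_table tg n z.
Proof.
rewrite /std_boundary /std_table.
elim/big_rec2: _ => [//|I y x I0 <-].
by rewrite -(ext_word_val (small_bars_face tg (size_tuple z) I0)).
Qed.

Lemma std_is_std : is_std (@lmul K S) P.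
Proof.
move=> n z; split; apply: val_inj; rewrite [RHS]boundary_val; first exact: src_gen_cell.
exact: tgt_gen_cell.
Qed.

End Resolution.

(** * Sources and targets modulo identities *)

Lemma sum_ends (V : nmodType) m (F : nat -> V) :
  \sum_(i < m.+2) F i = F 0%N + (\sum_(i < m) F i.+1 + F m.+1).
Proof. by rewrite big_ord_recl big_ord_recr. Qed.

Lemma cancel_ends (V : zmodType) (u v x y : V) :
  u + (x + (v + y)) - (x + (u + y)) = v.
Proof.
have -> : u + (x + (v + y)) = v + (x + (u + y)).
  by rewrite addrCA [RHS]addrCA; congr (_ + _); exact: addrCA.
exact: addrK.
Qed.

Section Faces.
Variables (K : fieldType) (S : based_algebra K).
Local Notation B := (letter S).
Local Notation X := (std_cells B).
Local Notation P := (std_polygraph S).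
Local Notation lmul := (@lmul K S).
Local Notation ext f := (linear_ext f).

Lemma identity_lin n c (x y : P n.+1) :
  is_identity x -> is_identity y -> is_identity (c *: x + y).
Proof. by move=> [a ->] [b ->]; exists (c *: a + b); rewrite linearP. Qed.
Lemma identity0 n : is_identity (0 : P n.+1).
Proof. by exists 0; rewrite linear0. Qed.
Lemma identityD n (x y : P n.+1) : is_identity x -> is_identity y -> is_identity (x + y).
Proof. by move=> [a ->] [b ->]; exists (a + b); rewrite linearD. Qed.

(** A block which is too short for the dimension is already an identity. *)
Lemma word_cell_idc n w : small n.+1 w ->
  word_cell P n.+1 w = idc (word_cell P n w).
Proof.
rewrite /word_cell; elim: w => [|b w IH]; first by rewrite !big_nil rmorph1.
case/andP=> /andP[_ bn] /IH {}IH; rewrite !big_cons IH rmorphM; congr (_ * _).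
rewrite [LHS]/=; case: insubP => [z|//].
by move=> /eqP bz; rewrite bz ltnn in bn.
Qed.

Lemma small_identity n x : spanned (small n.+1) x -> is_identity (ext (word_cell P n.+1) x).
Proof.
elim=> [|c w {}x sw _ IH]; first by rewrite linear_ext0; apply: identity0.
rewrite linear_extS; apply: identity_lin IH.
by rewrite word_cell_idc //; eexists.
Qed.

(** The first operator leaves one block of maximal size at most, and the second
    one, further left, acts on it: when the bar j > 1 is cut, the right block is too
    short, and the left one contains the bar i. *)
Lemma small_dbar2 n t t' i j (z : seq B) : size z = n.+2 -> (0 < i < j)%N -> (j <= n.+1)%N ->
  spanned (small n) (ext (dbar lmul t i) (dbar lmul t' j [:: z])).
Proof.
move=> sz /andP[i0 ij] jn; have jz : (j < size z)%N by rewrite sz.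
rewrite [dbar lmul t' j _]/= jz; case: t'.
  rewrite linear_extU; apply: small_dbar_head; rewrite ?size_take ?jz ?i0 //.
  rewrite /small /= andbT size_drop subn_gt0 jz sz leq_subLR -addn2 addnC leq_add2r.
  exact: leq_ltn_trans ij.
case dz : (drop j.-1 z) => [|x [|y c]]; rewrite ?linear_ext0; try exact: spanned0.
rewrite linear_ext_comp /=.
apply: (spanned_lin (S := fun _ => True)) (spanned_true _) => v _.
rewrite linear_extU; have sb : size (take j.-1 z ++ v :: c) = n.+1.
  by apply: succn_inj; rewrite -sz -[in RHS](cat_take_drop j.-1 z) dz !size_cat /= !addnS.
apply: small_dbar_head; rewrite ?sb // i0.
exact: leq_trans ij _.
Qed.

Lemma sorted_enum n (I : {set 'I_n}) : sorted (fun i j : 'I_n => i < j)%N (enum I).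
Proof.
apply: sorted_filter; first by move=> a b c; apply: ltn_trans.
by have := iota_ltn_sorted 0 n; rewrite -val_enum_ord sorted_map enumT.
Qed.

Lemma small_bars_face2 tg n (z : seq B) (I : {set 'I_n.+1}) : size z = n.+2 ->
  (1 < #|I|)%N -> spanned (small n) (bars_face tg z I).
Proof.
move=> sz; rewrite cardE /bars_face; move: (sorted_enum I).
elim: (enum I) => [//|i s IH] /= ps.
case: s IH ps => [//|j s] IH /= /andP[ij ps] _.
case: s IH ps => [|k s] IH ps.
  by rewrite /= linear_extU; apply: small_dbar2; rewrite ?ltnS // -ltnS ltn_ord.
by apply: spanned_lin (IH ps isT) => w; apply: small_dbar.
Qed.

Section Dim.
Variables (tg : bool) (n : nat) (z : X n.+2).

Definition bar_term (i : nat) : P n.+1 :=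
  ext (word_cell P n.+1) (dbar lmul (odd (n.+2 - i.+1) == tg) i.+1 [:: tval z]).

(** Sets of at least two bars give identities, by [small_bars_face2]. *)
Lemma boundary_bars :
  is_identity (std_boundary lmul P tg z - \sum_(i < n.+2) bar_term i).
Proof.
rewrite /std_boundary (bigID (fun I : {set 'I_n.+2} => #|I| == 1)%N) /=.
set s1 := (X in X + _ - _); set s2 := (X in _ + X - _).
have -> : s1 = \sum_(i < n.+2) bar_term i.
  rewrite /s1 (eq_bigl (mem [set [set i] | i : 'I_n.+2])); last first.
    move=> I /=; apply/andP/imsetP => [[_ /cards1P[i ->]]|[i _ ->]]; first by exists i.
    by rewrite cards1 -card_gt0 cards1.
  rewrite big_imset /=; last by move=> i j _ _; apply: set1_inj.
  apply: eq_bigr => i _; rewrite cards1 sqrrN expr1n scale1r enum_set1 /=.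
  by rewrite /bar_term linear_extU.
rewrite addrAC subrr add0r /s2; elim/big_rec: _ => [|I x /andP[I0 I1] ix]; first exact: identity0.
apply: identity_lin ix; apply: small_identity.
apply: small_bars_face2; first by rewrite size_tuple.
by rewrite ltn_neqAle eq_sym I1 card_gt0.
Qed.

Local Notation f := (face lmul P z).
Definition tens_term (i : nat) : P n.+1 :=
  block_cell P n.+1 (take i.+1 z) * block_cell P n.+1 (drop i.+1 z).

(** With one bar, the operator is a product exactly when the corresponding face has
    the right parity; otherwise it cuts the block in two. *)
Lemma bar_termE i : (i < n.+2)%N -> bar_term i =
  (if odd (n.+3 - i.+1) == tg then f i.+1 else 0)
  + (if odd (n.+2 - i.+1) == tg then tens_term i else 0).
Proof.
move=> iz; have iz' : (i.+1 < size z)%N by rewrite size_tuple !ltnS.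
have -> : (odd (n.+3 - i.+1) == tg) = ~~ (odd (n.+2 - i.+1) == tg).
  by rewrite subSn //= -/subn; case: (odd _) tg => [] [].
rewrite /bar_term /= iz'; case: (odd _ == tg) => /=.
  by rewrite linear_extU /word_cell big_cons big_seq1 add0r.
rewrite addr0 /face /= ltn_eqF //.
case: (drop i z) => [|x [|y c]]; rewrite ?linear_ext0 //.
rewrite linear_ext2U; apply: eq_linear_ext => w.
by rewrite /word_cell big_seq1.
Qed.

Lemma tens_term_identity i : (0 < i < n.+1)%N -> is_identity (tens_term i).
Proof.
move=> /andP[i0 ni]; have sw : small n.+1 [:: take i.+1 z; drop i.+1 z].
  have iz : (i.+1 < size z)%N by rewrite size_tuple !ltnS ltnW.
  rewrite /small /= size_take iz size_drop subn_gt0 iz size_tuple /= ni andbT.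
  by rewrite leq_subLR -addn2 addnC leq_add2r ltnS.
have := word_cell_idc sw; rewrite /word_cell big_cons big_seq1 => e.
by exists (word_cell P n [:: take i.+1 z; drop i.+1 z]); rewrite /tens_term e.
Qed.

(** Cutting the first or the last bar gives the first or the last face; cutting
    another one leaves two blocks of smaller dimension. *)
Lemma boundary_faces :
  is_identity (std_boundary lmul P tg z - \sum_(i < n.+4 | odd (n.+3 - i) == tg) f i).
Proof.
rewrite -(subrK (\sum_(i < n.+2) bar_term i) (std_boundary _ _ _ _)) -addrA.
apply: identityD; first exact: boundary_bars.
(* t collects the cuts and p the products; the extreme faces are the extreme cuts. *)
pose t i := if odd (n.+2 - i.+1) == tg then tens_term i else 0.
pose p i := if odd (n.+3 - i) == tg then f i else 0.
have -> : \sum_(i < n.+4 | odd (n.+3 - i) == tg) f i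
    = t 0%N + (\sum_(i < n.+2) p i.+1 + t n.+1).
  have <- : p 0%N = t 0%N by rewrite /p /t subn0 subn1 /= negbK.
  have fn : f n.+3 = tens_term n.+1 by rewrite /face eqxx.
  have <- : p n.+3 = t n.+1 by rewrite /p /t !subnn fn.
  by rewrite big_mkcond; exact: (sum_ends n.+2 p).
have -> : \sum_(i < n.+2) bar_term i
    = \sum_(i < n.+2) p i.+1 + (t 0%N + (\sum_(i < n) t i.+1 + t n.+1)).
  rewrite (eq_bigr (fun i : 'I_n.+2 => p i.+1 + t i)); last by move=> i _; apply: bar_termE.
  by rewrite big_split (sum_ends n t).
set u := \sum_(i < n.+2) _; set v := \sum_(i < n) _.
have -> : u + (t 0%N + (v + t n.+1)) - (t 0%N + (u + t n.+1)) = v.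
  exact: cancel_ends.
rewrite /v; elim/big_rec: _ => [|i x _ ix]; first exact: identity0.
apply: identityD => //; rewrite /t; case: (_ == tg); last exact: identity0.
by apply: tens_term_identity; exact: (ltn_ord i).
Qed.

End Dim.

Lemma std_faces n (z : X n.+1) tg : exists s' : P n, is_identity s' /\
  std_boundary lmul P tg z
    = \sum_(i < n.+3 | odd (n.+2 - i) == tg) face lmul P z i + s'.
Proof.
exists (std_boundary lmul P tg z - \sum_(i < n.+3 | odd (n.+2 - i) == tg) face lmul P z i).
split; last by rewrite addrC subrK.
case: n z => [//|n] z; exact: boundary_faces.
Qed.

End Faces.

(** * From the augmentation ideal to a based algebra *)

(** Coordinates with respect to a basis: the preimages are unique, so choosing
    them is linear. *)
Lemma linear_ext_bij (K : fieldType) (I : choiceType) (V : lmodType K) (f : I -> V) :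
  injective (linear_ext f) -> (forall v, exists x, linear_ext f x = v) ->
  exists2 coords : {linear V -> {malg K[I]}}, cancel coords (linear_ext f)
    & forall i, coords (f i) = << i >>.
Proof.
move=> f_inj f_surj; pose coords v := sval (cid (f_surj v)).
have coordsK : cancel coords (linear_ext f) by move=> v; apply: (svalP (cid (f_surj v))).
have coords_lin : linear coords.
  by move=> c x y; apply: f_inj; apply: etrans (coordsK _) _; rewrite linear_extP !coordsK.
pose L := GRing.isLinear.Build K V {malg K[I]} *:%R coords coords_lin.
exists (HB.pack_for {linear V -> {malg K[I]}} coords L) => [//|i /=].
by apply: f_inj; apply: etrans (coordsK _) _; rewrite linear_extU.
Qed.

Section Augmented.
Variables (K : fieldType) (A : algType K) (eps : {lrmorphism A -> K^o}).
Variables (I : choiceType) (b : I -> A).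
Hypothesis b_basis : linear_basis_of b (fun a : A => eps a = 0).

Definition unital (o : option I) : A := if o is Some u then b u else 1.

Definition unit_part (x : {malg K[option I]}) : {malg K[I]} :=
  linear_ext (fun o => if o is Some u then << u >> else 0) x.

Lemma unital_split x : linear_ext unital x = x@_None *: 1 + linear_ext b (unit_part x).
Proof.
rewrite -(linear_ext_delta None (1 : A)) /unit_part linear_ext_comp linear_ext_addf.
apply: eq_linear_ext => -[u|] /=; first by rewrite linear_extU add0r.
by rewrite linear0 addr0.
Qed.

Lemma option_split (x : {malg K[option I]}) :
  x = x@_None *: << None >> + linear_ext (fun u => << Some u >>) (unit_part x).
Proof.
pose h : {linear _ -> {malg K[option I]}} := linear_ext (fun u : I => << Some u >>).
rewrite -[LHS]linear_ext_id -(linear_ext_delta None << None >>) /unit_part.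
rewrite -[linear_ext _ (linear_ext _ _)]/(h _) linear_ext_comp linear_ext_addf.
apply: eq_linear_ext => -[u|] /=; first by rewrite linear_extU add0r.
by rewrite linear0 addr0.
Qed.

Lemma eps_basis x : eps (linear_ext b x) = 0.
Proof. by apply/b_basis.2; exists x. Qed.

(** A is the direct sum of the constants and of the augmentation ideal: the
    augmentation computes the coordinate on 1. *)
Lemma unital_bijective : injective (linear_ext unital) /\
  (forall a, exists x, linear_ext unital x = a).
Proof.
split=> [|a].
  suff ker0 x : linear_ext unital x = 0 -> x = 0.
    move=> x y e; apply/eqP; rewrite -subr_eq0; apply/eqP/ker0.
    by rewrite linear_extB e subrr.
  rewrite unital_split => x0; have xN : x@_None = 0.
    have := congr1 eps x0; rewrite linear0 linearD linearZ /= eps_basis rmorph1 addr0.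
    by move=> e; rewrite -e -[LHS]mulr1.
  move: x0; rewrite xN scale0r add0r => x0.
  rewrite [LHS]option_split xN scale0r add0r.
  have -> : unit_part x = 0 by apply: b_basis.1; rewrite x0 linear_ext0.
  exact: linear_ext0.
have [|x xa] := (b_basis.2 (a - eps a *: 1)).1 _.
  rewrite linearB linearZ /= rmorph1; apply/eqP; rewrite subr_eq0; apply/eqP.
  by rewrite -[LHS]mulr1.
exists (eps a *: << None >> + linear_ext (fun u => << Some u >>) x).
rewrite linear_extS linear_ext2U /= [X in _ + X](_ : _ = linear_ext b x) //.
by rewrite xa addrC subrK.
Qed.

End Augmented.

Theorem corollary6p1p3 (K : fieldType) (A : algType K)
    (eps : {lrmorphism A -> K^o})
    (X : polygraph1 K) (phi : {lrmorphism free_algebra K (gen0 X) -> A})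
    (Xpres : presentation phi)
    (Xleft : left_monomial X)
    (Xconv : convergent X)
    (Xaug : forall u : red_mon X, eps (phi << val u >>) = 0) :
  linear_basis_of (fun u : red_mon X => phi << val u >>)
                  (fun a : A => eps a = 0)
  /\ exists P : polygraph K (std_cells (red_mon X)),
     [/\ is_std (red_mul (X:=X)) P,
         polygraphic_resolution P A
       & forall (n : nat) (z : std_cells (red_mon X) n.+1),
           (exists s' : P n, is_identity s' /\
              src (gen P z) =
                \sum_(i < n.+3 | ~~ odd (n.+2 - i)) face (red_mul (X:=X)) P z i
                + s')
           /\
           (exists t' : P n, is_identity t' /\
              tgt (gen P z) =
                \sum_(i < n.+3 | odd (n.+2 - i)) face (red_mul (X:=X)) P z i
                + t')].
Proof.
have b_basis := red_mon_basis Xpres Xleft Xconv Xaug.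
split; first exact: b_basis.
have [u_inj u_surj] := unital_bijective b_basis.
have [coords coordsK basisK] := linear_ext_bij u_inj u_surj.
pose S := @BasedAlgebra K A (red_mon X) _ coords coordsK basisK (erefl _) (red_mul (X:=X))
  (fun u v => esym (red_mulE Xpres Xleft Xconv Xaug u v)).
exists (std_polygraph S); split.
- exact: (@std_is_std K S).
- exact: (std_resolution S).
move=> n z; have [sE tE] := @std_is_std K S n z.
split.
  have [s' [id_s' e]] := @std_faces K S n z false; exists s'; split=> //.
  apply: etrans sE _; apply: etrans e _; congr (_ + _).
  by apply: eq_bigl => i; rewrite eqbF_neg.
have [t' [id_t' e]] := @std_faces K S n z true; exists t'; split=> //.
apply: etrans tE _; apply: etrans e _; congr (_ + _).
by apply: eq_bigl => i; rewrite eqb_id.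
Qed.
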